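(* Let $R$ be an associative ring with unit, let $\mathcal{B}$ be a class of right $R$-modules such that $\mathcal{GF}_{\mathcal{B}}(R)$ is closed under extensions, and let $\mathbf{D}\subseteq\mathrm{Ch}(R^{op})$ be a semi-definable class of complexes of right $R$-modules containing $\mathrm{Ch}(\mathcal{B})$ and all injective complexes. Consider the model structures $\mathrm{Ch}(R)_{\mathbf{D}\text{-flat}}$ and $\mathcal{M}_2$ on $\mathrm{Ch}(R)$ given by the Hovey triples $$\mathrm{Ch}(R)_{\mathbf{D}\text{-flat}}=(\mathbf{GF}_{\mathbf{D}}(R),\mathcal{W},\mathrm{dg}(\mathcal{C}(R)))\quad\text{and}\quad\mathcal{M}_2=(\mathrm{Ch}(\mathcal{GF}_{\mathcal{B}}(R)),\mathcal{W}_2,\mathrm{dg}(\mathcal{GC}_{\mathcal{B}}(R))).$$ Then the identity functor $\mathrm{id}\colon\mathrm{Ch}(R)_{\mathbf{D}\text{-flat}}\to\mathcal{M}_2$ is a left Quillen functor. So there is a derived adjunction between $$[\mathbf{GF}_{\mathbf{D}}(R)\cap\mathrm{dg}(\mathcal{C}(R))]/\!\sim\quad\text{and}\quad\mathsf{D}(\mathcal{GF}_{\mathcal{B}}(R)).$$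
   Context: Complexes have differentials $\partial_m\colon X_m\to X_{m-1}$; $Z_m$ = cycles, $B_m$ = boundaries. In an abelian category, $\mathcal{X}^\perp=\{N:\mathrm{Ext}^1(X,N)=0\ \forall X\in\mathcal{X}\}$. $\mathrm{Ch}(\mathcal{X})$ = complexes with components in $\mathcal{X}$. For $X\in\mathrm{Ch}(R^{op})$, $Y\in\mathrm{Ch}(R)$, let $X\otimes^{\cdot}Y$ be the usual tensor product, $(X\otimes^{\cdot}Y)_m=\bigoplus_kX_k\otimes_RY_{m-k}$, differential $x\otimes y\mapsto\partial x\otimes y+(-1)^kx\otimes\partial y$ ($x\in X_k$); the modified tensor product $X\otimes Y$ has $(X\otimes Y)_m=(X\otimes^{\cdot}Y)_m/B_m(X\otimes^{\cdot}Y)$ and differential $x\otimes y\mapsto\partial x\otimes y$. A complex $F\in\mathrm{Ch}(R)$ is flat if $-\otimes F$ is exact (equivalently, exact with flat cycles). $\mathcal{GF}_{\mathcal{B}}(R)$: left modules $Z_0(F)$ with $F$ an exact complex of flat modules such that $B\otimes_RF$ is exact for all $B\in\mathcal{B}$; $\mathcal{GC}_{\mathcal{B}}(R)=\mathcal{GF}_{\mathcal{B}}(R)^\perp$. $\mathbf{GF}_{\mathbf{D}}(R)$: complexes $Z_0(F_\bullet)$ with $F_\bullet\in\mathrm{Ch}(\mathrm{Ch}(R))$ an exact complex of flat complexes such that $D\otimes F_\bullet$ is exact for all $D\in\mathbf{D}$. $\mathcal{C}(R)$: cotorsion modules (right $\mathrm{Ext}^1$-orthogonal of flat modules). $\mathrm{dg}(\mathcal{C}(R))$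 (resp. $\mathrm{dg}(\mathcal{GC}_{\mathcal{B}}(R))$): complexes $Y$ with components in $\mathcal{C}(R)$ (resp. $\mathcal{GC}_{\mathcal{B}}(R)$) such that the Hom complex $\mathcal{H}om(X,Y)$ is exact for every exact complex $X$ with cycles flat (resp. in $\mathcal{GF}_{\mathcal{B}}(R)$). $\mathrm{dg}(\mathcal{C}(R))$ coincides with the class of cotorsion complexes, i.e. the right $\mathrm{Ext}^1$-orthogonal of the flat complexes. Semi-definable: a short exact sequence of complexes is pure if it remains exact under $\mathrm{Hom}(L,-)$ for all finitely presented $L$; pure-injective = injective relative to pure exact sequences; a class is definable if closed under products, direct limits and pure subobjects; an elementary cogenerator of a definable class $\mathcal{D}$ is a pure-injective $D_0\in\mathcal{D}$ such that every $D\in\mathcal{D}$ is a pure subobject of a product of copies of $D_0$; a class is semi-definable if it is closed under products and contains an elementary cogenerator of its definable closure (the smallest definable class containing it). A Hovey triple $(\mathcal{Q},\mathcal{W},\mathcal{R})$ = (cofibrant, trivial, fibrant objects): $\mathcal{W}$ is thick and $(\mathcal{Q},\mathcal{R}\cap\mathcal{W})$, $(\mathcal{Q}\cap\mathcal{W},\mathcal{R})$ are complete cotorsion pairs; (trivial) cofibrations are monomorphisms with cokernel in $\mathcal{Q}$ (resp. $\mathcal{Q}\cap\mathcal{W}$), (trivial) fibrations are epimorphisms with kernel in $\mathcal{R}$ (resp. $\mathcal{R}\cap\mathcal{W}$). Both triples in the claim exist and $\mathcal{W},\mathcal{W}_2$ are uniquely determined; the trivially cofibrant objects of $\mathrm{Ch}(R)_{\mathbf{D}\text{-flat}}$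 are the flat complexes, and those of $\mathcal{M}_2$ are the exact complexes with cycles in $\mathcal{GF}_{\mathcal{B}}(R)$ (this class is denoted $\widetilde{\mathcal{GF}}_{\mathcal{B}}(R)$). $\mathrm{Ho}(\mathrm{Ch}(R)_{\mathbf{D}\text{-flat}})$ is triangle equivalent to the stable category $[\mathbf{GF}_{\mathbf{D}}(R)\cap\mathrm{dg}(\mathcal{C}(R))]/\!\sim$, where $f\sim g$ iff $f-g$ factors through a flat cotorsion complex, and $\mathrm{Ho}(\mathcal{M}_2)$ is triangle equivalent to the Verdier quotient $\mathsf{D}(\mathcal{GF}_{\mathcal{B}}(R)):=\mathsf{K}(\mathcal{GF}_{\mathcal{B}}(R))/\widetilde{\mathcal{GF}}_{\mathcal{B}}(R)$, with $\mathsf{K}(\mathcal{GF}_{\mathcal{B}}(R))$ the chain homotopy category of complexes with components in $\mathcal{GF}_{\mathcal{B}}(R)$. A left Quillen functor is a left adjoint functor between model categories preserving cofibrations and trivial cofibrations; the derived adjunction is the adjunction formed by its total left derived functor and the total right derived functor of its right adjoint. *)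

(* Defs.v *)
From HB Require Import structures.
From Stdlib Require Import Setoid Morphisms.
From mathcomp Require Import all_boot all_order all_algebra.

Set Implicit Arguments.
Unset Strict Implicit.
Unset Printing Implicit Defensive.

Import GRing.Theory.

#[local] Obligation Tactic := idtac.

Declare Scope cat_scope.
Delimit Scope cat_scope with cat.
Local Open Scope ring_scope.
Local Open Scope cat_scope.

Reserved Notation "f ≈ g" (at level 70, no associativity).
Reserved Notation "f ≡ g" (at level 70, no associativity).
Reserved Notation "f ∘ g" (at level 40, left associativity).
Reserved Notation "f ⊙ g" (at level 40, left associativity).
Reserved Notation "a ⊞ b" (at level 50, left associativity).
Reserved Notation "⊟ a" (at level 35, right associativity).

(** * Categories

    Hom-sets carry their own equality [heq], so that quotient categories and
    localizations need no quotient types. *)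

Record category := Category {
  ob :> Type;
  hom : ob -> ob -> Type;
  heq : forall X Y, hom X Y -> hom X Y -> Prop;
  cid : forall X, hom X X;
  ccomp : forall X Y Z, hom Y Z -> hom X Y -> hom X Z;
  heq_equiv : forall X Y, Equivalence (@heq X Y);
  ccomp_proper : forall X Y Z,
    Proper (@heq Y Z ==> @heq X Y ==> @heq X Z) (@ccomp X Y Z);
  ccompA : forall X Y Z T (h : hom Z T) (g : hom Y Z) (f : hom X Y),
    heq (ccomp h (ccomp g f)) (ccomp (ccomp h g) f);
  ccomp1f : forall X Y (f : hom X Y), heq (ccomp (cid Y) f) f;
  ccompf1 : forall X Y (f : hom X Y), heq (ccomp f (cid X)) f }.

Arguments heq {c X Y} _ _.
Arguments cid {c} X.
Arguments ccomp {c X Y Z} _ _.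

Notation "f ≡ g" := (heq f g) : cat_scope.
Notation "f ⊙ g" := (ccomp f g) : cat_scope.

#[export] Existing Instance heq_equiv.
#[export] Existing Instance ccomp_proper.

Record functor (C D : category) := Functor {
  fob :> C -> D;
  fmap : forall X Y, hom X Y -> hom (fob X) (fob Y);
  fmap_proper : forall X Y, Proper (heq ==> heq) (@fmap X Y);
  fmap1 : forall X, fmap (cid X) ≡ cid (fob X);
  fmapM : forall X Y Z (g : hom Y Z) (f : hom X Y),
    fmap (g ⊙ f) ≡ fmap g ⊙ fmap f }.

Arguments fmap {C D} _ {X Y} _.
#[export] Existing Instance fmap_proper.

Program Definition idf (C : category) : functor C C :=
  {| fob := id; fmap := fun X Y f => f |}.
Next Obligation. by move=> C X Y f g. Qed.
Next Obligation. by move=> C X /=; reflexivity. Qed.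
Next Obligation. by move=> C X Y Z g f /=; reflexivity. Qed.

Program Definition fcomp (C D E : category) (G : functor D E)
    (F : functor C D) : functor C E :=
  {| fob := fun X => G (F X); fmap := fun X Y f => fmap G (fmap F f) |}.
Next Obligation. by move=> C D E G F X Y f g fg; rewrite fg; reflexivity. Qed.
Next Obligation. by move=> C D E G F X /=; rewrite !fmap1; reflexivity. Qed.
Next Obligation.
by move=> C D E G F X Y Z g f /=; rewrite !fmapM; reflexivity.
Qed.

Record nattrans (C D : category) (F G : functor C D) := Nattrans {
  ncomp :> forall X, hom (F X) (G X);
  natural : forall X Y (f : hom X Y), ncomp Y ⊙ fmap F f ≡ fmap G f ⊙ ncomp X }.

Record natiso (C D : category) (F G : functor C D) := Natiso {
  nfwd :> nattrans F G;
  nbwd : nattrans G F;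
  nfwdK : forall X, nbwd X ⊙ nfwd X ≡ cid (F X);
  nbwdK : forall X, nfwd X ⊙ nbwd X ≡ cid (G X) }.

Definition is_equivalence (C D : category) (F : functor C D) : Prop :=
  exists G : functor D C,
    inhabited (natiso (fcomp G F) (idf C)) /\
    inhabited (natiso (fcomp F G) (idf D)).

Record adjunction (C D : category) (F : functor C D) (G : functor D C) :=
  Adjunction {
  aunit : nattrans (idf C) (fcomp G F);
  acounit : nattrans (fcomp F G) (idf D);
  triangleL : forall X, acounit (F X) ⊙ fmap F (aunit X) ≡ cid (F X);
  triangleR : forall Y, fmap G (acounit Y) ⊙ aunit (G Y) ≡ cid (G Y) }.

Definition is_left_adjoint (C D : category) (F : functor C D) : Prop :=
  exists G : functor D C, inhabited (adjunction F G).

Program Definition idf_adjunction (C : category) :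
    adjunction (idf C) (idf C) :=
  {| aunit := @Nattrans C C (idf C) (fcomp (idf C) (idf C)) (@cid C) _;
     acounit := @Nattrans C C (fcomp (idf C) (idf C)) (idf C) (@cid C) _ |}.
Next Obligation. by move=> C X Y f /=; rewrite ccomp1f ccompf1; reflexivity. Qed.
Next Obligation. by move=> C X Y f /=; rewrite ccomp1f ccompf1; reflexivity. Qed.
Next Obligation. by move=> C X /=; rewrite ccomp1f; reflexivity. Qed.
Next Obligation. by move=> C X /=; rewrite ccomp1f; reflexivity. Qed.

Program Definition fullsub (C : category) (P : C -> Prop) : category :=
  {| ob := {X : C | P X};
     hom := fun X Y => hom (sval X) (sval Y);
     heq := fun X Y f g => f ≡ g;
     cid := fun X => cid (sval X);
     ccomp := fun X Y Z g f => g ⊙ f |}.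
Next Obligation. by move=> C P *; apply: ccompA. Qed.
Next Obligation. by move=> C P *; apply: ccomp1f. Qed.
Next Obligation. by move=> C P *; apply: ccompf1. Qed.

Program Definition fullsub_incl (C : category) (P : C -> Prop) :
    functor (fullsub P) C :=
  {| fob := fun X : fullsub P => sval X; fmap := fun X Y f => f |}.
Next Obligation. by move=> C P X Y f g. Qed.
Next Obligation. by move=> C P X; reflexivity. Qed.
Next Obligation. by move=> C P *; reflexivity. Qed.

(** The quotient category [C/r]: same morphisms, identified by the least
    congruence containing [r] (which is [r] itself when [r] is a congruence, as
    for chain homotopy, and for the stable categories below when the class of
    objects factored through is closed under finite direct sums). *)

Inductive quot_eq (C : category)
    (r : forall X Y : C, hom X Y -> hom X Y -> Prop) :
    forall X Y : C, hom X Y -> hom X Y -> Prop :=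
| quot_rel X Y (f g : hom X Y) : r X Y f g -> quot_eq r f g
| quot_heq X Y (f g : hom X Y) : f ≡ g -> quot_eq r f g
| quot_sym X Y (f g : hom X Y) : quot_eq r f g -> quot_eq r g f
| quot_trans X Y (f g h : hom X Y) :
    quot_eq r f g -> quot_eq r g h -> quot_eq r f h
| quot_comp X Y Z (g g' : hom Y Z) (f f' : hom X Y) :
    quot_eq r g g' -> quot_eq r f f' -> quot_eq r (g ⊙ f) (g' ⊙ f').

Program Definition quot_cat (C : category)
    (r : forall X Y : C, hom X Y -> hom X Y -> Prop) : category :=
  {| ob := C; hom := @hom C; heq := quot_eq r;
     cid := @cid C; ccomp := @ccomp C |}.
Next Obligation.
move=> C r X Y; split.
- by move=> f; apply: quot_heq; reflexivity.
- by move=> f g; apply: quot_sym.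
- by move=> f g h; apply: quot_trans.
Qed.
Next Obligation. by move=> C r X Y Z g g' gg' f f' ff'; apply: quot_comp. Qed.
Next Obligation. by move=> C r *; apply/quot_heq/ccompA. Qed.
Next Obligation. by move=> C r *; apply/quot_heq/ccomp1f. Qed.
Next Obligation. by move=> C r *; apply/quot_heq/ccompf1. Qed.

Program Definition quot_proj (C : category)
    (r : forall X Y : C, hom X Y -> hom X Y -> Prop) :
    functor C (quot_cat r) :=
  {| fob := fun X : C => (X : quot_cat r); fmap := fun X Y f => f |}.
Next Obligation. by move=> C r X Y f g; apply: quot_heq. Qed.
Next Obligation. by move=> C r X; apply: quot_heq; reflexivity. Qed.
Next Obligation. by move=> C r *; apply: quot_heq; reflexivity. Qed.

(** The localization [C[W^-1]]: morphisms are zigzags, identified by the least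
    congruence making [C -> C[W^-1]] a functor that inverts [W]. *)

Inductive zigzag (C : category) (W : forall X Y : C, hom X Y -> Prop) :
    C -> C -> Type :=
| zid X : zigzag W X X
| zmor X Y (f : hom X Y) : zigzag W X Y
| zinv X Y (w : hom X Y) (Ww : W X Y w) : zigzag W Y X
| zcomp X Y Z (g : zigzag W Y Z) (f : zigzag W X Y) : zigzag W X Z.

Arguments zid {C W} X.
Arguments zmor {C W X Y} f.
Arguments zinv {C W X Y} w Ww.
Arguments zcomp {C W X Y Z} g f.

Inductive zigzag_eq (C : category) (W : forall X Y : C, hom X Y -> Prop) :
    forall X Y : C, zigzag W X Y -> zigzag W X Y -> Prop :=
| zz_refl X Y (f : zigzag W X Y) : zigzag_eq f f
| zz_sym X Y (f g : zigzag W X Y) : zigzag_eq f g -> zigzag_eq g f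
| zz_trans X Y (f g h : zigzag W X Y) :
    zigzag_eq f g -> zigzag_eq g h -> zigzag_eq f h
| zz_comp X Y Z (g g' : zigzag W Y Z) (f f' : zigzag W X Y) :
    zigzag_eq g g' -> zigzag_eq f f' -> zigzag_eq (zcomp g f) (zcomp g' f')
| zz_assoc X Y Z T (h : zigzag W Z T) (g : zigzag W Y Z) (f : zigzag W X Y) :
    zigzag_eq (zcomp h (zcomp g f)) (zcomp (zcomp h g) f)
| zz_1f X Y (f : zigzag W X Y) : zigzag_eq (zcomp (zid Y) f) f
| zz_f1 X Y (f : zigzag W X Y) : zigzag_eq (zcomp f (zid X)) f
| zz_mor X Y (f g : hom X Y) :
    f ≡ g -> zigzag_eq (W := W) (zmor f) (zmor g)
| zz_mor1 X : zigzag_eq (W := W) (zmor (cid X)) (zid X)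
| zz_morM X Y Z (g : hom Y Z) (f : hom X Y) :
    zigzag_eq (W := W) (zmor (g ⊙ f)) (zcomp (zmor g) (zmor f))
| zz_invl X Y (w : hom X Y) (Ww : W X Y w) :
    zigzag_eq (zcomp (zinv w Ww) (zmor w)) (zid X)
| zz_invr X Y (w : hom X Y) (Ww : W X Y w) :
    zigzag_eq (zcomp (zmor w) (zinv w Ww)) (zid Y).

Program Definition localization (C : category)
    (W : forall X Y : C, hom X Y -> Prop) : category :=
  {| ob := C; hom := zigzag W; heq := @zigzag_eq C W;
     cid := @zid C W; ccomp := @zcomp C W |}.
Next Obligation.
move=> C W X Y; split.
- by move=> f; apply: zz_refl.
- by move=> f g; apply: zz_sym.
- by move=> f g h; apply: zz_trans.
Qed.
Next Obligation. by move=> C W X Y Z g g' gg' f f' ff'; apply: zz_comp. Qed.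
Next Obligation. by move=> C W *; apply: zz_assoc. Qed.
Next Obligation. by move=> C W *; apply: zz_1f. Qed.
Next Obligation. by move=> C W *; apply: zz_f1. Qed.

Program Definition loc_functor (C : category)
    (W : forall X Y : C, hom X Y -> Prop) : functor C (localization W) :=
  {| fob := fun X : C => (X : localization W);
     fmap := fun X Y f => (zmor f : @hom (localization W) X Y) |}.
Next Obligation. by move=> C W X Y f g; apply: zz_mor. Qed.
Next Obligation. by move=> C W X; apply: zz_mor1. Qed.
Next Obligation. by move=> C W *; apply: zz_morM. Qed.

(** * Model structures and derived functors *)

(** The classes of morphisms of a model structure; the weak equivalences are
    the composites of a trivial cofibration followed by a trivial fibration. *)

Record model_classes (C : category) := ModelClasses {
  cofib : forall X Y : C, hom X Y -> Prop;
  tcofib : forall X Y : C, hom X Y -> Prop;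
  fib : forall X Y : C, hom X Y -> Prop;
  tfib : forall X Y : C, hom X Y -> Prop }.

Definition weq (C : category) (M : model_classes C) (X Y : C) (f : hom X Y) :
    Prop :=
  exists Z (i : hom X Z) (p : hom Z Y), [/\ tcofib M i, tfib M p & f ≡ p ⊙ i].

Definition Ho (C : category) (M : model_classes C) : category :=
  localization (weq M).

Definition gamma (C : category) (M : model_classes C) : functor C (Ho M) :=
  loc_functor (weq M).

Definition left_quillen (C D : category) (M : model_classes C)
    (N : model_classes D) (F : functor C D) : Prop :=
  [/\ is_left_adjoint F,
      forall X Y (f : hom X Y), cofib M f -> cofib N (fmap F f)
    & forall X Y (f : hom X Y), tcofib M f -> tcofib N (fmap F f)].

Section Derived.
Variables (C D : category) (M : model_classes C) (N : model_classes D).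

Definition is_total_left_derived (F : functor C D) (LF : functor (Ho M) (Ho N))
    (eps : nattrans (fcomp LF (gamma M)) (fcomp (gamma N) F)) : Prop :=
  forall (H : functor (Ho M) (Ho N))
    (z : nattrans (fcomp H (gamma M)) (fcomp (gamma N) F)),
  exists t : nattrans H LF,
    (forall X, eps X ⊙ t (gamma M X) ≡ z X) /\
    (forall t' : nattrans H LF,
       (forall X, eps X ⊙ t' (gamma M X) ≡ z X) -> forall X, t' X ≡ t X).

Definition is_total_right_derived (G : functor D C)
    (RG : functor (Ho N) (Ho M))
    (eta : nattrans (fcomp (gamma M) G) (fcomp RG (gamma N))) : Prop :=
  forall (H : functor (Ho N) (Ho M))
    (z : nattrans (fcomp (gamma M) G) (fcomp H (gamma N))),
  exists t : nattrans RG H,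
    (forall Y, t (gamma N Y) ⊙ eta Y ≡ z Y) /\
    (forall t' : nattrans RG H,
       (forall Y, t' (gamma N Y) ⊙ eta Y ≡ z Y) -> forall Y, t' Y ≡ t Y).

(** The derived adjunction of [a : F -| G]; the last two fields say that its
    unit and counit are induced by those of [a]. *)

Record derived_adjunction (F : functor C D) (G : functor D C)
    (a : adjunction F G) := DerivedAdjunction {
  derL : functor (Ho M) (Ho N);
  derR : functor (Ho N) (Ho M);
  der_eps : nattrans (fcomp derL (gamma M)) (fcomp (gamma N) F);
  der_eta : nattrans (fcomp (gamma M) G) (fcomp derR (gamma N));
  derLP : is_total_left_derived der_eps;
  derRP : is_total_right_derived der_eta;
  der_adj : adjunction derL derR;
  der_unit : forall X : C,
    fmap derR (der_eps X) ⊙ aunit der_adj (gamma M X)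
    ≡ der_eta (F X) ⊙ fmap (gamma M) (aunit a X);
  der_counit : forall Y : D,
    acounit der_adj (gamma N Y) ⊙ fmap derL (der_eta Y)
    ≡ fmap (gamma N) (acounit a Y) ⊙ der_eps (G Y) }.

End Derived.

(** [a'] corresponds to [a] under the functors [E] and [E'] (which are meant to
    be equivalences of categories). *)

Definition adjunction_transported (C D C' D' : category)
    (L : functor C D) (R : functor D C) (a : adjunction L R)
    (L' : functor C' D') (R' : functor D' C') (a' : adjunction L' R')
    (E : functor C' C) (E' : functor D' D) : Prop :=
  exists (p : natiso (fcomp E' L') (fcomp L E))
         (q : natiso (fcomp E R') (fcomp R E')),
    forall X : C',
      fmap R (p X) ⊙ (q (L' X) ⊙ fmap E (aunit a' X)) ≡ aunit a (E X).

(** * Abelian groups with an explicit equality *)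

Record egrp := Egrp {
  esort :> Type;
  eeq : esort -> esort -> Prop;
  ezero : esort;
  eadd : esort -> esort -> esort;
  eopp : esort -> esort;
  eeq_equiv : Equivalence eeq;
  eadd_proper : Proper (eeq ==> eeq ==> eeq) eadd;
  eopp_proper : Proper (eeq ==> eeq) eopp;
  eaddA : forall a b c, eeq (eadd a (eadd b c)) (eadd (eadd a b) c);
  eaddC : forall a b, eeq (eadd a b) (eadd b a);
  eadd0 : forall a, eeq (eadd a ezero) a;
  eaddN : forall a, eeq (eadd a (eopp a)) ezero }.

Arguments eeq {e} _ _.
Arguments ezero {e}.
Arguments eadd {e} _ _.
Arguments eopp {e} _.

Notation "a ≈ b" := (eeq a b) : cat_scope.
Notation "a ⊞ b" := (eadd a b) : cat_scope.
Notation "⊟ a" := (eopp a) : cat_scope.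

#[export] Existing Instance eeq_equiv.
#[export] Existing Instance eadd_proper.
#[export] Existing Instance eopp_proper.

Section EgrpTheory.
Variable A : egrp.
Implicit Types a b c d : A.

Lemma e0add a : ezero ⊞ a ≈ a.
Proof. by rewrite eaddC; apply: eadd0. Qed.

Lemma eNadd a : ⊟ a ⊞ a ≈ ezero.
Proof. by rewrite eaddC; apply: eaddN. Qed.

Lemma eaddI a b c : a ⊞ b ≈ a ⊞ c -> b ≈ c.
Proof.
move=> e; rewrite -(e0add b) -(eNadd a) -eaddA e eaddA eNadd.
exact: e0add.
Qed.

Lemma eaddACA a b c d : (a ⊞ b) ⊞ (c ⊞ d) ≈ (a ⊞ c) ⊞ (b ⊞ d).
Proof.
by rewrite -!eaddA (eaddA b) (eaddC b c) -eaddA; reflexivity.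
Qed.

Lemma eopp_uniq a b : a ⊞ b ≈ ezero -> b ≈ ⊟ a.
Proof. by move=> e; apply: (@eaddI a); rewrite e eaddN; reflexivity. Qed.

Lemma eopp0 : ⊟ (ezero : A) ≈ ezero.
Proof. by symmetry; apply: eopp_uniq; apply: eadd0. Qed.

Lemma eoppK a : ⊟ (⊟ a) ≈ a.
Proof. by symmetry; apply: eopp_uniq; apply: eNadd. Qed.

Lemma eoppD a b : ⊟ (a ⊞ b) ≈ ⊟ a ⊞ ⊟ b.
Proof.
by symmetry; apply: eopp_uniq; rewrite eaddACA !eaddN; apply: eadd0.
Qed.

Definition esign (n : int) a : A := if odd (absz n) then ⊟ a else a.

#[export] Instance esign_proper n : Proper (eeq ==> eeq) (esign n).
Proof. by move=> a b ab; rewrite /esign; case: (odd _); rewrite ab; reflexivity. Qed.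

Lemma esignD n a b : esign n (a ⊞ b) ≈ esign n a ⊞ esign n b.
Proof.
by rewrite /esign; case: (odd _); [apply: eoppD | reflexivity].
Qed.

Lemma esign0 n : esign n ezero ≈ ezero.
Proof. by rewrite /esign; case: (odd _); [apply: eopp0 | reflexivity]. Qed.

Lemma esignN n a : esign n (⊟ a) ≈ ⊟ (esign n a).
Proof. by rewrite /esign; case: (odd _); reflexivity. Qed.

Lemma esignK n a : esign n (esign n a) ≈ a.
Proof. by rewrite /esign; case: (odd _); [apply: eoppK | reflexivity]. Qed.

Lemma odd_absz_succ (n : int) : odd (absz (n + 1)) = ~~ odd (absz n).
Proof.
case: n => [n|[|n]] //; first by rewrite -PoszD /= addn1.
have -> : Negz n.+1 + 1 = Negz n by rewrite !NegzE -addn1 PoszD opprD addrNK.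
by rewrite /= negbK.
Qed.

Lemma esignS n a : esign (n + 1) a ≈ ⊟ (esign n a).
Proof.
rewrite /esign odd_absz_succ; case: (odd _) => /=.
  by symmetry; apply: eoppK.
reflexivity.
Qed.

End EgrpTheory.

Record ehom (A B : egrp) := Ehom {
  efun :> A -> B;
  ehom_proper : Proper (eeq ==> eeq) efun;
  ehomD : forall a b, efun (a ⊞ b) ≈ efun a ⊞ efun b }.

#[export] Existing Instance ehom_proper.

Lemma ehom0 (A B : egrp) (f : ehom A B) : f ezero ≈ ezero.
Proof.
by apply: (@eaddI _ (f ezero)); rewrite -ehomD !eadd0; reflexivity.
Qed.

Lemma ehomN (A B : egrp) (f : ehom A B) a : f (⊟ a) ≈ ⊟ (f a).
Proof. by apply: eopp_uniq; rewrite -ehomD eaddN; apply: ehom0. Qed.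

Program Definition ehom_egrp (A B : egrp) : egrp :=
  {| esort := ehom A B;
     eeq := fun f g => forall a, f a ≈ g a;
     ezero := {| efun := fun _ => ezero |};
     eadd := fun f g => {| efun := fun a => f a ⊞ g a |};
     eopp := fun f => {| efun := fun a => ⊟ (f a) |} |}.
Next Obligation. by move=> A B a b _ /=; reflexivity. Qed.
Next Obligation. by move=> A B a b /=; rewrite eadd0; reflexivity. Qed.
Next Obligation. by move=> A B f g a b ab /=; rewrite ab; reflexivity. Qed.
Next Obligation.
by move=> A B f g a b /=; rewrite !ehomD; apply: eaddACA.
Qed.
Next Obligation. by move=> A B f a b ab /=; rewrite ab; reflexivity. Qed.
Next Obligation. by move=> A B f a b /=; rewrite ehomD; apply: eoppD. Qed.
Next Obligation.
move=> A B; split.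
- by move=> f a; reflexivity.
- by move=> f g fg a; rewrite fg; reflexivity.
- by move=> f g h fg gh a; rewrite fg gh; reflexivity.
Qed.
Next Obligation.
by move=> A B f f' ff' g g' gg' a /=; rewrite ff' gg'; reflexivity.
Qed.
Next Obligation. by move=> A B f f' ff' a /=; rewrite ff'; reflexivity. Qed.
Next Obligation. by move=> A B f g h a /=; apply: eaddA. Qed.
Next Obligation. by move=> A B f g a /=; apply: eaddC. Qed.
Next Obligation. by move=> A B f a /=; apply: eadd0. Qed.
Next Obligation. by move=> A B f a /=; apply: eaddN. Qed.

(** * Preadditive categories *)

Record preadd := Preadd {
  pob :> Type;
  phom : pob -> pob -> egrp;
  pid : forall X, phom X X;
  pcomp : forall X Y Z, phom Y Z -> phom X Y -> phom X Z;
  pcomp_proper : forall X Y Z,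
    Proper (eeq ==> eeq ==> eeq) (@pcomp X Y Z);
  pcompDl : forall X Y Z (g g' : phom Y Z) (f : phom X Y),
    pcomp (g ⊞ g') f ≈ pcomp g f ⊞ pcomp g' f;
  pcompDr : forall X Y Z (g : phom Y Z) (f f' : phom X Y),
    pcomp g (f ⊞ f') ≈ pcomp g f ⊞ pcomp g f';
  pcompA : forall X Y Z T (h : phom Z T) (g : phom Y Z) (f : phom X Y),
    pcomp h (pcomp g f) ≈ pcomp (pcomp h g) f;
  pcomp1f : forall X Y (f : phom X Y), pcomp (pid Y) f ≈ f;
  pcompf1 : forall X Y (f : phom X Y), pcomp f (pid X) ≈ f }.

Arguments phom {p} X Y.
Arguments pid {p} X.
Arguments pcomp {p X Y Z} _ _.

Notation "f ∘ g" := (pcomp f g) : cat_scope.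

#[export] Existing Instance pcomp_proper.

Definition pcat (C : preadd) : category :=
  @Category C (fun X Y => phom X Y) (fun X Y => @eeq (phom X Y))
    (@pid C) (@pcomp C) (fun X Y => eeq_equiv (phom X Y)) (@pcomp_proper C)
    (@pcompA C) (@pcomp1f C) (@pcompf1 C).

Section PreaddTheory.
Variable C : preadd.

Program Definition postcomp (L X Y : C) (f : phom X Y) :
    ehom (phom L X) (phom L Y) := {| efun := fun u => f ∘ u |}.
Next Obligation. by move=> L X Y f u v uv /=; rewrite uv; reflexivity. Qed.
Next Obligation. by move=> L X Y f u v /=; apply: pcompDr. Qed.

Program Definition precomp (X Y Z : C) (f : phom X Y) :
    ehom (phom Y Z) (phom X Z) := {| efun := fun u => u ∘ f |}.
Next Obligation. by move=> X Y Z f u v uv /=; rewrite uv; reflexivity. Qed.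
Next Obligation. by move=> X Y Z f u v /=; apply: pcompDl. Qed.

Lemma pcomp0f (X Y Z : C) (f : phom X Y) : (ezero : phom Y Z) ∘ f ≈ ezero.
Proof. exact: (ehom0 (precomp Z f)). Qed.

Lemma pcompf0 (X Y Z : C) (f : phom Y Z) : f ∘ (ezero : phom X Y) ≈ ezero.
Proof. exact: (ehom0 (postcomp X f)). Qed.

Lemma pcompNf (X Y Z : C) (g : phom Y Z) (f : phom X Y) :
  (⊟ g) ∘ f ≈ ⊟ (g ∘ f).
Proof. exact: (ehomN (precomp Z f) g). Qed.

Lemma pcompfN (X Y Z : C) (g : phom Y Z) (f : phom X Y) :
  g ∘ (⊟ f) ≈ ⊟ (g ∘ f).
Proof. exact: (ehomN (postcomp X g) f). Qed.

Lemma pcompSf (X Y Z : C) n (g : phom Y Z) (f : phom X Y) :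
  (esign n g) ∘ f ≈ esign n (g ∘ f).
Proof. by rewrite /esign; case: (odd _); [apply: pcompNf | reflexivity]. Qed.

Lemma pcompfS (X Y Z : C) n (g : phom Y Z) (f : phom X Y) :
  g ∘ (esign n f) ≈ esign n (g ∘ f).
Proof. by rewrite /esign; case: (odd _); [apply: pcompfN | reflexivity]. Qed.

End PreaddTheory.

Program Definition EAb : preadd :=
  {| pob := egrp; phom := ehom_egrp;
     pid := fun A => {| efun := fun a : A => a |};
     pcomp := fun A B D g f => {| efun := fun a : A => (g : ehom B D) ((f : ehom A B) a) |} |}.
Next Obligation. by move=> A a b. Qed.
Next Obligation. by move=> A a b /=; reflexivity. Qed.
Next Obligation. by move=> A B D g f a b ab /=; rewrite ab; reflexivity. Qed.
Next Obligation. by move=> A B D g f a b /=; rewrite !ehomD; reflexivity. Qed.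
Next Obligation.
move=> A B D g g' gg' f f' ff' a /=; rewrite (ff' a : f a ≈ f' a).
exact: gg'.
Qed.
Next Obligation. by move=> A B D g g' f a /=; reflexivity. Qed.
Next Obligation. by move=> A B D g f f' a /=; apply: ehomD. Qed.
Next Obligation. by move=> A B D E h g f a /=; reflexivity. Qed.
Next Obligation. by move=> A B f a /=; reflexivity. Qed.
Next Obligation. by move=> A B f a /=; reflexivity. Qed.

(** * Notions of abelian categories *)

Section Abelian.
Variable C : preadd.
Implicit Types X Y Z A B K N : C.

Definition is_mono X Y (f : phom X Y) : Prop :=
  forall T (u v : phom T X), f ∘ u ≈ f ∘ v -> u ≈ v.

Definition is_epi X Y (f : phom X Y) : Prop :=
  forall T (u v : phom Y T), u ∘ f ≈ v ∘ f -> u ≈ v.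

Definition is_kernel X Y (f : phom X Y) K (k : phom K X) : Prop :=
  [/\ f ∘ k ≈ ezero, is_mono k
    & forall T (u : phom T X), f ∘ u ≈ ezero -> exists v, k ∘ v ≈ u].

Definition is_cokernel X Y (f : phom X Y) Q (q : phom Y Q) : Prop :=
  [/\ q ∘ f ≈ ezero, is_epi q
    & forall T (u : phom Y T), u ∘ f ≈ ezero -> exists v, v ∘ q ≈ u].

Definition ses A X B (f : phom A X) (g : phom X B) : Prop :=
  is_kernel g f /\ is_cokernel f g.

Definition exact_seq X Y Z (f : phom X Y) (g : phom Y Z) : Prop :=
  exists K (k : phom K Y) (e : phom X K),
    [/\ is_kernel g k, is_epi e & f ≈ k ∘ e].

(** [Ext^1(X, N) = 0], for the Yoneda [Ext]: every extension is split. *)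
Definition ext1_zero X N : Prop :=
  forall E (f : phom N E) (g : phom E X), ses f g ->
  exists s : phom X E, g ∘ s ≈ pid X.

Definition rorth (P : C -> Prop) N : Prop := forall X, P X -> ext1_zero X N.
Definition lorth (P : C -> Prop) X : Prop := forall N, P N -> ext1_zero X N.

Definition ext_closed (P : C -> Prop) : Prop :=
  forall A X B (f : phom A X) (g : phom X B), ses f g -> P A -> P B -> P X.

Definition is_retract X Y : Prop :=
  exists (s : phom X Y) (r : phom Y X), r ∘ s ≈ pid X.

Definition thick (P : C -> Prop) : Prop :=
  (forall X Y, is_retract X Y -> P Y -> P X) /\
  (forall A X B (f : phom A X) (g : phom X B), ses f g ->
     [/\ P A -> P X -> P B, P A -> P B -> P X & P X -> P B -> P A]).

Definition cotorsion_pair (P Q : C -> Prop) : Prop :=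
  (forall X, P X <-> lorth Q X) /\ (forall Y, Q Y <-> rorth P Y).

Definition complete_cotorsion_pair (P Q : C -> Prop) : Prop :=
  [/\ cotorsion_pair P Q,
      forall X, exists B A (f : phom B A) (g : phom A X),
        [/\ ses f g, P A & Q B]
    & forall X, exists B A (f : phom X B) (g : phom B A),
        [/\ ses f g, P A & Q B]].

Definition both (P Q : C -> Prop) X : Prop := P X /\ Q X.

Definition hovey_triple (Q W R : C -> Prop) : Prop :=
  [/\ thick W, complete_cotorsion_pair Q (both R W)
    & complete_cotorsion_pair (both Q W) R].

Definition mono_with_coker (P : C -> Prop) X Y (f : phom X Y) : Prop :=
  is_mono f /\ exists Q (q : phom Y Q), is_cokernel f q /\ P Q.

Definition epi_with_ker (P : C -> Prop) X Y (f : phom X Y) : Prop :=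
  is_epi f /\ exists K (k : phom K X), is_kernel f k /\ P K.

Definition hovey_model (Q W R : C -> Prop) : model_classes (pcat C) :=
  @ModelClasses (pcat C)
    (fun X Y f => mono_with_coker Q f)
    (fun X Y f => mono_with_coker (both Q W) f)
    (fun X Y f => epi_with_ker R f)
    (fun X Y f => epi_with_ker (both R W) f).

Definition injective_object E : Prop :=
  forall X Y (f : phom X Y) (g : phom X E), is_mono f -> exists h, h ∘ f ≈ g.

(** The stable category of the full subcategory [P], modulo the morphisms
    factoring through an object of [N]. *)
Definition stable_rel (P N : C -> Prop) (X Y : @fullsub (pcat C) P)
    (f g : hom X Y) : Prop :=
  exists Z (a : phom (sval X) Z) (b : phom Z (sval Y)),
    N Z /\ (f : phom (sval X) (sval Y)) ⊞ ⊟ (g : phom (sval X) (sval Y)) ≈ b ∘ a.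

Definition stable_cat (P N : C -> Prop) : category :=
  quot_cat (@stable_rel P N).

End Abelian.

Definition exact_functor (C D : preadd) (T : functor (pcat C) (pcat D)) :
    Prop :=
  forall (A X B : C) (f : phom A X) (g : phom X B),
    ses f g -> @ses D (T A) (T X) (T B) (fmap T f) (fmap T g).

(** * Purity and semi-definable classes *)

Section Definable.
Variable C : preadd.
Implicit Types (X Y L D E : C) (P : C -> Prop).

Definition is_product (I : Type) (F : I -> C) X (p : forall i, phom X (F i)) :
    Prop :=
  forall T (u : forall i, phom T (F i)),
    (exists v : phom T X, forall i, p i ∘ v ≈ u i) /\
    (forall v v' : phom T X, (forall i, p i ∘ v ≈ p i ∘ v') -> v ≈ v').

Record dirsys := Dirsys {
  ds_idx : Type;
  ds_le : ds_idx -> ds_idx -> Prop;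
  ds_refl : forall i, ds_le i i;
  ds_trans : forall i j k, ds_le i j -> ds_le j k -> ds_le i k;
  ds_inh : inhabited ds_idx;
  ds_dir : forall i j, exists k, ds_le i k /\ ds_le j k;
  ds_ob :> ds_idx -> C;
  ds_map : forall i j, ds_le i j -> phom (ds_ob i) (ds_ob j);
  ds_map1 : forall i (h : ds_le i i), ds_map h ≈ pid (ds_ob i);
  ds_mapM : forall i j k (h : ds_le i j) (h' : ds_le j k) (h'' : ds_le i k),
    ds_map h' ∘ ds_map h ≈ ds_map h'' }.

Definition is_dirlim (S : dirsys) X (c : forall i : ds_idx S, phom (S i) X) :
    Prop :=
  (forall i j (h : ds_le i j), c j ∘ ds_map h ≈ c i) /\
  (forall T (u : forall i, phom (S i) T),
     (forall i j (h : ds_le i j), u j ∘ ds_map h ≈ u i) ->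
     (exists v : phom X T, forall i, v ∘ c i ≈ u i) /\
     (forall v v' : phom X T, (forall i, v ∘ c i ≈ v' ∘ c i) -> v ≈ v')).

(** [Hom(L, -)] preserves direct limits, spelled out with the explicit
    description of a direct limit of abelian groups. *)
Definition finitely_presented L : Prop :=
  forall (S : dirsys) X (c : forall i : ds_idx S, phom (S i) X), is_dirlim c ->
    (forall f : phom L X, exists i (g : phom L (S i)), c i ∘ g ≈ f) /\
    (forall i (g : phom L (S i)), c i ∘ g ≈ ezero ->
       exists j (h : ds_le i j), ds_map h ∘ g ≈ ezero).

Definition pure_ses X Y Z (f : phom X Y) (g : phom Y Z) : Prop :=
  ses f g /\
  forall L, finitely_presented L -> @ses EAb _ _ _ (postcomp L f) (postcomp L g).

Definition pure_mono X Y (f : phom X Y) : Prop :=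
  exists Z (g : phom Y Z), pure_ses f g.

Definition pure_injective E : Prop :=
  forall X Y (f : phom X Y) (g : phom X E),
    pure_mono f -> exists h, h ∘ f ≈ g.

Definition product_closed P : Prop :=
  forall (I : Type) (F : I -> C) X (p : forall i, phom X (F i)),
    is_product p -> (forall i, P (F i)) -> P X.

Definition dirlim_closed P : Prop :=
  forall (S : dirsys) X (c : forall i : ds_idx S, phom (S i) X),
    is_dirlim c -> (forall i, P (S i)) -> P X.

Definition definable P : Prop :=
  [/\ product_closed P, dirlim_closed P
    & forall X Y (f : phom X Y), pure_mono f -> P Y -> P X].

Definition definable_closure P X : Prop :=
  forall P', definable P' -> (forall Y, P Y -> P' Y) -> P' X.

Definition elementary_cogenerator P D0 : Prop :=
  [/\ pure_injective D0, P D0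
    & forall D, P D ->
        exists (I : Type) X (p : I -> phom X D0) (f : phom D X),
          is_product p /\ pure_mono f].

Definition semi_definable P : Prop :=
  product_closed P /\
  exists D0, P D0 /\ elementary_cogenerator (definable_closure P) D0.

End Definable.

(** * Complexes *)

(** Indexing the differential by a proof of [i = j + 1] avoids transporting
    objects along equalities of indices. *)
Record complex (C : preadd) := Complex {
  cob :> int -> C;
  cd : forall i j : int, i = j + 1 -> phom (cob i) (cob j);
  cdd : forall (i j k : int) (h : i = j + 1) (h' : j = k + 1), cd h' ∘ cd h ≈ ezero }.

Arguments cd {C} c {i j} h.

Record chmap (C : preadd) (X Y : complex C) := Chmap {
  chm :> forall i, phom (X i) (Y i);
  chm_comm : forall (i j : int) (h : i = j + 1), cd Y h ∘ chm i ≈ chm j ∘ cd X h }.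

Program Definition chmap_egrp (C : preadd) (X Y : complex C) : egrp :=
  {| esort := chmap X Y;
     eeq := fun f g => forall i, f i ≈ g i;
     ezero := {| chm := fun i => ezero |};
     eadd := fun f g => {| chm := fun i => f i ⊞ g i |};
     eopp := fun f => {| chm := fun i => ⊟ (f i) |} |}.
Next Obligation.
by move=> C X Y i j h /=; rewrite pcomp0f pcompf0; reflexivity.
Qed.
Next Obligation.
by move=> C X Y f g i j h /=; rewrite pcompDl pcompDr !chm_comm; reflexivity.
Qed.
Next Obligation.
by move=> C X Y f i j h /=; rewrite pcompNf pcompfN !chm_comm; reflexivity.
Qed.
Next Obligation.
move=> C X Y; split.
- by move=> f i; reflexivity.
- by move=> f g fg i; rewrite fg; reflexivity.
- by move=> f g h fg gh i; rewrite fg gh; reflexivity.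
Qed.
Next Obligation.
by move=> C X Y f f' ff' g g' gg' i /=; rewrite ff' gg'; reflexivity.
Qed.
Next Obligation. by move=> C X Y f f' ff' i /=; rewrite ff'; reflexivity. Qed.
Next Obligation. by move=> C X Y f g h i /=; apply: eaddA. Qed.
Next Obligation. by move=> C X Y f g i /=; apply: eaddC. Qed.
Next Obligation. by move=> C X Y f i /=; apply: eadd0. Qed.
Next Obligation. by move=> C X Y f i /=; apply: eaddN. Qed.

Program Definition Ch (C : preadd) : preadd :=
  {| pob := complex C; phom := @chmap_egrp C;
     pid := fun X => {| chm := fun i => pid (X i) |};
     pcomp := fun X Y Z g f =>
       {| chm := fun i => (g : chmap Y Z) i ∘ (f : chmap X Y) i |} |}.
Next Obligation. by move=> C X i j h /=; rewrite pcomp1f pcompf1; reflexivity. Qed.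
Next Obligation.
by move=> C X Y Z g f i j h /=; rewrite pcompA chm_comm -pcompA chm_comm pcompA; reflexivity.
Qed.
Next Obligation.
by move=> C X Y Z g g' gg' f f' ff' i; apply: pcomp_proper; [apply: gg' | apply: ff'].
Qed.
Next Obligation. by move=> C X Y Z g g' f i /=; apply: pcompDl. Qed.
Next Obligation. by move=> C X Y Z g f f' i /=; apply: pcompDr. Qed.
Next Obligation. by move=> C X Y Z T h g f i /=; apply: pcompA. Qed.
Next Obligation. by move=> C X Y f i /=; apply: pcomp1f. Qed.
Next Obligation. by move=> C X Y f i /=; apply: pcompf1. Qed.

Section Complexes.
Variable C : preadd.
Implicit Types (X Y : complex C) (P : C -> Prop).

Definition exact_complex X : Prop :=
  forall (i j k : int) (h : i = j + 1) (h' : j = k + 1),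
    exact_seq (cd X h) (cd X h').

Definition is_cycles X (n : int) (Z : C) : Prop :=
  exists (m : int) (h : n = m + 1) (z : phom Z (X n)), is_kernel (cd X h) z.

(** [Ch(P)] *)
Definition compwise P X : Prop := forall i, P (X i).

Definition exact_with_cycles P X : Prop :=
  exact_complex X /\ forall n, exists Z, is_cycles X n Z /\ P Z.

Definition homotopic X Y (f g : chmap X Y) : Prop :=
  exists s : forall i j : int, j = i + 1 -> phom (X i) (Y j),
  forall (i j k : int) (h : j = i + 1) (h' : i = k + 1),
    f i ⊞ ⊟ (g i) ≈ cd Y h ∘ s i j h ⊞ s k i h' ∘ cd X h'.

(** [Cf] is (isomorphic to) the mapping cone of [f]: its components are the
    biproducts [Y j (+) X i], [j = i + 1], with differential
    [(y, x) |-> (d y + f x, - d x)]. *)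
Definition is_cone X Y (f : chmap X Y) (Cf : complex C) : Prop :=
  exists (i1 : forall j, phom (Y j) (Cf j)) (p1 : forall j, phom (Cf j) (Y j))
    (i2 : forall i j : int, j = i + 1 -> phom (X i) (Cf j))
    (p2 : forall i j : int, j = i + 1 -> phom (Cf j) (X i)),
  (forall (i j : int) (h : j = i + 1),
     [/\ p1 j ∘ i1 j ≈ pid (Y j), p2 i j h ∘ i2 i j h ≈ pid (X i),
         p1 j ∘ i2 i j h ≈ ezero, p2 i j h ∘ i1 j ≈ ezero
       & i1 j ∘ p1 j ⊞ i2 i j h ∘ p2 i j h ≈ pid (Cf j)]) /\
  (forall (i j k : int) (h : j = i + 1) (h' : k = j + 1),
     cd Cf h ∘ i1 j ≈ i1 i ∘ cd Y h /\
     cd Cf h' ∘ i2 j k h' ≈ i1 j ∘ f j ⊞ ⊟ (i2 i j h ∘ cd X h)).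

(** [K(P)], the chain homotopy category of [Ch(P)]. *)
Definition homotopy_rel P (X Y : @fullsub (pcat (Ch C)) (compwise P))
    (f g : hom X Y) : Prop :=
  @homotopic (sval X) (sval Y) f g.

Definition homotopy_cat P : category := quot_cat (@homotopy_rel P).

(** The Verdier quotient [K(P)/N]: the localization of [K(P)] at the morphisms
    whose mapping cone lies in [N]. *)
Definition cone_in P (N : complex C -> Prop) (X Y : homotopy_cat P)
    (f : hom X Y) : Prop :=
  exists Cf : complex C, @is_cone (sval X) (sval Y) f Cf /\ N Cf.

Definition verdier_quotient P (N : complex C -> Prop) : category :=
  localization (@cone_in P N).

Definition verdier_functor P (N : complex C -> Prop) :
    functor (@fullsub (pcat (Ch C)) (compwise P)) (verdier_quotient P N) :=
  fcomp (loc_functor (@cone_in P N)) (quot_proj (@homotopy_rel P)).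

End Complexes.

(** [T] carries the complex [F] to an exact complex. *)
Definition exact_after (C D : preadd) (T : functor (pcat C) (pcat D))
    (F : complex C) : Prop :=
  forall (i j k : int) (h : i = j + 1) (h' : j = k + 1),
    @exact_seq D (T (F i)) (T (F j)) (T (F k))
      (fmap T (cd F h)) (fmap T (cd F h')).

(** * The Hom complex *)

Section HomComplex.
Variables (C : preadd) (X Y : complex C).

Program Definition hom_deg (n : int) : egrp :=
  {| esort := forall i j : int, j = i + n -> phom (X i) (Y j);
     eeq := fun u v => forall i j h, u i j h ≈ v i j h;
     ezero := fun i j h => ezero;
     eadd := fun u v i j h => u i j h ⊞ v i j h;
     eopp := fun u i j h => ⊟ (u i j h) |}.
Next Obligation.
move=> n; split.
- by move=> u i j h; reflexivity.
- by move=> u v uv i j h; rewrite uv; reflexivity.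
- by move=> u v w uv vw i j h; rewrite uv vw; reflexivity.
Qed.
Next Obligation.
by move=> n u u' uu' v v' vv' i j h /=; rewrite uu' vv'; reflexivity.
Qed.
Next Obligation. by move=> n u u' uu' i j h /=; rewrite uu'; reflexivity. Qed.
Next Obligation. by move=> n u v w i j h /=; apply: eaddA. Qed.
Next Obligation. by move=> n u v i j h /=; apply: eaddC. Qed.
Next Obligation. by move=> n u i j h /=; apply: eadd0. Qed.
Next Obligation. by move=> n u i j h /=; apply: eaddN. Qed.

Lemma hom_idxl (i j m n : int) : n = m + 1 -> j = i + m -> j + 1 = i + n.
Proof. by move=> -> ->; rewrite addrA. Qed.

Lemma hom_idxr (i j m n : int) : n = m + 1 -> j = i + m -> j = (i - 1) + n.
Proof. by move=> -> ->; rewrite addrACA addNr addr0. Qed.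

Lemma idx_pred (i : int) : i = (i - 1) + 1.
Proof. by rewrite subrK. Qed.

(** [u |-> d u - (-1)^n u d] in degree [n]. *)
Program Definition hom_diff (n m : int) (h : n = m + 1) :
    ehom (hom_deg n) (hom_deg m) :=
  {| efun := fun u i j e =>
       cd Y (erefl (j + 1)) ∘ u i (j + 1) (hom_idxl h e)
       ⊞ ⊟ (esign n (u (i - 1) j (hom_idxr h e) ∘ cd X (idx_pred i))) |}.
Next Obligation.
move=> n m h u v uv i j e /=.
by rewrite (uv _ _ (hom_idxl h e)) (uv _ _ (hom_idxr h e)); reflexivity.
Qed.
Next Obligation.
move=> n m h u v i j e /=.
by rewrite pcompDl pcompDr esignD eoppD; apply: eaddACA.
Qed.

Lemma hom_diffK (n m k : int) (h : n = m + 1) (h' : m = k + 1) (u : hom_deg n) (i j : int) e :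
  hom_diff h' (hom_diff h u) i j e ≈ ezero.
Proof.
rewrite /= pcompDr pcompDl pcompfN pcompfS !pcompNf !pcompSf.
rewrite pcompA cdd pcomp0f e0add -pcompA -(pcompA (u _ _ _)) cdd pcompf0 esign0.
rewrite eopp0 eadd0.
rewrite (eq_irrelevance (hom_idxr h (hom_idxl h' e)) (hom_idxl h (hom_idxr h' e))).
subst n; rewrite esignS eoppK; apply: eaddN.
Qed.

Program Definition Hom_complex : complex EAb :=
  {| cob := hom_deg; cd := hom_diff |}.
Next Obligation. by move=> i j k h h' u a b e; apply: hom_diffK. Qed.

End HomComplex.

(** * Abelian groups presented by generators and relations *)

(** A word [[:: (e1, g1); ...]] stands for the sum of the [g]s with sign [+]
    for [true] and [-] for [false]. *)

Definition word (G : Type) := seq (bool * G).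

Inductive pres_eq (G : Type) (r : word G -> word G -> Prop) :
    word G -> word G -> Prop :=
| pres_rel s t : r s t -> pres_eq r s t
| pres_refl s : pres_eq r s s
| pres_sym s t : pres_eq r s t -> pres_eq r t s
| pres_trans s t u : pres_eq r s t -> pres_eq r t u -> pres_eq r s u
| pres_cat s s' t t' :
    pres_eq r s s' -> pres_eq r t t' -> pres_eq r (s ++ t) (s' ++ t')
| pres_catC s t : pres_eq r (s ++ t) (t ++ s)
| pres_cancel e g : pres_eq r [:: (e, g); (~~ e, g)] [::].

Definition word_opp (G : Type) (s : word G) : word G :=
  [seq (~~ p.1, p.2) | p <- s].

Lemma pres_catN G r (s : word G) : pres_eq r (s ++ word_opp s) [::].
Proof.
elim: s => [|[e g] s IHs] /=; first exact: pres_refl.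
apply: (@pres_trans _ _ _ ([:: (e, g); (~~ e, g)] ++ (s ++ word_opp s))).
  rewrite -[(e, g) :: _]/([:: (e, g)] ++ _).
  rewrite -[_ ++ (s ++ word_opp s)]/([:: (e, g)] ++ ([:: (~~ e, g)] ++ (s ++ word_opp s))).
  apply: pres_cat; first exact: pres_refl.
  rewrite -[(~~ e, g) :: word_opp s]/([:: (~~ e, g)] ++ word_opp s) !catA.
  by apply: pres_cat; [apply: pres_catC | apply: pres_refl].
rewrite -[X in pres_eq r _ X]/([::] ++ [::]).
by apply: pres_cat => //; apply: pres_cancel.
Qed.

Program Definition pres (G : Type) (r : word G -> word G -> Prop) : egrp :=
  {| esort := word G; eeq := pres_eq r; ezero := [::];
     eadd := cat; eopp := @word_opp G |}.
Next Obligation.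
move=> G r; split.
- by move=> s; apply: pres_refl.
- by move=> s t; apply: pres_sym.
- by move=> s t u; apply: pres_trans.
Qed.
Next Obligation. by move=> G r s s' ss' t t' tt'; apply: pres_cat. Qed.
Next Obligation.
move=> G r s t st.
have st' : pres_eq r ((word_opp s ++ s) ++ word_opp t)
                     (word_opp s ++ (t ++ word_opp t)).
  rewrite -catA; apply: pres_cat; first exact: pres_refl.
  by apply: pres_cat => //; apply: pres_refl.
apply: pres_sym; apply: pres_trans; last apply: pres_trans st' _.
  apply: pres_sym; rewrite -[X in pres_eq r _ X]/([::] ++ word_opp t).
  apply: pres_cat; last exact: pres_refl.
  by apply: pres_trans (pres_catN r s); apply: pres_catC.
rewrite -[X in pres_eq r _ X]cats0.
by apply: pres_cat; [apply: pres_refl | apply: pres_catN].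
Qed.
Next Obligation. by move=> G r s t u; rewrite /= catA; apply: pres_refl. Qed.
Next Obligation. by move=> G r s t; apply: pres_catC. Qed.
Next Obligation. by move=> G r s; rewrite /= cats0; apply: pres_refl. Qed.
Next Obligation. by move=> G r s; apply: pres_catN. Qed.

Definition gen (G : Type) (r : word G -> word G -> Prop) (g : G) : pres r :=
  [:: (true, g)].

Section PresLift.
Variables (G : Type) (r : word G -> word G -> Prop) (A : egrp) (f : G -> A).

Definition weval (s : word G) : A :=
  foldr (fun p a => (if p.1 then f p.2 else ⊟ (f p.2)) ⊞ a) ezero s.

Hypothesis rf : forall s t, r s t -> weval s ≈ weval t.

Lemma weval_cat s t : weval (s ++ t) ≈ weval s ⊞ weval t.
Proof.
elim: s => [|p s IHs] /=; first by rewrite e0add; reflexivity.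
by rewrite IHs; apply: eaddA.
Qed.

Lemma weval_proper s t : pres_eq r s t -> weval s ≈ weval t.
Proof.
elim=> {s t}; first exact: rf.
- by move=> s; reflexivity.
- by move=> s t _ e; symmetry.
- by move=> s t u _ e _ e'; rewrite e.
- by move=> s s' t t' _ e _ e'; rewrite !weval_cat e e'; reflexivity.
- by move=> s t; rewrite !weval_cat; apply: eaddC.
- by case=> g /=; rewrite eadd0; [apply: eaddN | apply: eNadd].
Qed.

Definition pres_lift : ehom (pres r) A :=
  @Ehom (pres r) A weval weval_proper weval_cat.

End PresLift.

Lemma pres_ext (G : Type) (r : word G -> word G -> Prop) (A : egrp)
    (u v : ehom (pres r) A) :
  (forall g, u (gen r g) ≈ v (gen r g)) -> forall s, u s ≈ v s.
Proof.
move=> e; elim=> [|[b g] s IHs].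
  by rewrite (ehom0 u) (ehom0 v); reflexivity.
have -> : (b, g) :: s = ((if b then gen r g else ⊟ (gen r g)) ⊞ (s : pres r)).
  by case: b.
rewrite !ehomD IHs; case: b; first by rewrite e; reflexivity.
by rewrite !ehomN e; reflexivity.
Qed.

(** * Direct sums and cokernels of abelian groups *)

Inductive dsum_rel (I : Type) (A : I -> egrp) :
    word {i : I & A i} -> word {i : I & A i} -> Prop :=
| dsum_add i (a b : A i) :
    dsum_rel [:: (true, existT _ i (a ⊞ b))]
             [:: (true, existT _ i a); (true, existT _ i b)]
| dsum_eq i (a b : A i) :
    a ≈ b -> dsum_rel [:: (true, existT _ i a)] [:: (true, existT _ i b)].

Definition dsum (I : Type) (A : I -> egrp) : egrp := pres (@dsum_rel I A).

Program Definition dsum_in (I : Type) (A : I -> egrp) (i : I) :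
    ehom (A i) (dsum A) :=
  {| efun := fun a => gen (@dsum_rel I A) (existT _ i a) |}.
Next Obligation. by move=> I A i a b ab; apply/pres_rel/dsum_eq. Qed.
Next Obligation. by move=> I A i a b; apply/pres_rel/dsum_add. Qed.

Lemma dsum_liftP (I : Type) (A : I -> egrp) (B : egrp)
    (f : forall i, ehom (A i) B) s t :
  dsum_rel s t ->
  weval (fun p => f (projT1 p) (projT2 p)) s
  ≈ weval (fun p => f (projT1 p) (projT2 p)) t.
Proof.
case=> i a b /=; first by rewrite ehomD eaddA; reflexivity.
by move=> e; rewrite e; reflexivity.
Qed.

Definition dsum_lift (I : Type) (A : I -> egrp) (B : egrp)
    (f : forall i, ehom (A i) B) : ehom (dsum A) B :=
  pres_lift (dsum_liftP f).

Lemma dsum_lift_in (I : Type) (A : I -> egrp) (B : egrp)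
    (f : forall i, ehom (A i) B) i a :
  dsum_lift f (dsum_in A i a) ≈ f i a.
Proof. by rewrite /= eadd0; reflexivity. Qed.

Lemma dsum_ext (I : Type) (A : I -> egrp) (B : egrp) (u v : ehom (dsum A) B) :
  (forall i a, u (dsum_in A i a) ≈ v (dsum_in A i a)) -> forall s, u s ≈ v s.
Proof. by move=> e; apply: pres_ext => -[i a]; apply: e. Qed.

Lemma ecoker_equiv (A B : egrp) (f : ehom A B) :
  Equivalence (fun s t : B => exists a, s ≈ t ⊞ f a).
Proof.
split.
- by move=> s; exists ezero; rewrite ehom0 eadd0; reflexivity.
- move=> s t [a e]; exists (⊟ a).
  by rewrite e ehomN -eaddA eaddN eadd0; reflexivity.
- move=> s t u [a e] [b e']; exists (b ⊞ a).
  by rewrite e e' ehomD eaddA; reflexivity.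
Qed.

(** [B / f(A)] *)
Program Definition ecoker (A B : egrp) (f : ehom A B) : egrp :=
  {| esort := B; eeq := fun s t => exists a, s ≈ t ⊞ f a;
     ezero := ezero; eadd := eadd; eopp := eopp |}.
Next Obligation. by move=> A B f; apply: ecoker_equiv. Qed.
Next Obligation.
move=> A B f s s' [a e] t t' [b e']; exists (a ⊞ b).
by rewrite e e' ehomD; apply: eaddACA.
Qed.
Next Obligation.
by move=> A B f s s' [a e]; exists (⊟ a); rewrite e eoppD ehomN; reflexivity.
Qed.
Next Obligation.
by move=> A B f a b c; exists ezero; rewrite ehom0 eadd0; apply: eaddA.
Qed.
Next Obligation.
by move=> A B f a b; exists ezero; rewrite ehom0 eadd0; apply: eaddC.
Qed.
Next Obligation.
by move=> A B f a; exists ezero; rewrite ehom0 !eadd0; reflexivity.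
Qed.
Next Obligation.
by move=> A B f a; exists ezero; rewrite ehom0 eadd0; apply: eaddN.
Qed.

Lemma ecoker_eq (A B : egrp) (f : ehom A B) (s t : B) :
  s ≈ t -> (s : ecoker f) ≈ t.
Proof. by move=> e; exists ezero; rewrite ehom0 eadd0. Qed.

(** * Modules and tensor products *)

Definition linear_comp (R : pzRingType) (M N P : lmodType R)
    (g : {linear N -> P}) (f : {linear M -> N}) : {linear M -> P} := g \o f.

Program Definition lin_egrp (R : pzRingType) (M N : lmodType R) : egrp :=
  {| esort := {linear M -> N}; eeq := fun f g => f =1 g;
     ezero := (\0 : {linear M -> N}); eadd := fun f g => (f \+ g : {linear M -> N});
     eopp := fun f => (\- f : {linear M -> N}) |}.
Next Obligation.
move=> R M N; split.
- by [].
- by move=> f g fg x; rewrite fg.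
- by move=> f g h fg gh x; rewrite fg gh.
Qed.
Next Obligation. by move=> R M N f f' ff' g g' gg' x /=; rewrite ff' gg'. Qed.
Next Obligation. by move=> R M N f f' ff' x /=; rewrite ff'. Qed.
Next Obligation. by move=> R M N f g h x /=; rewrite addrA. Qed.
Next Obligation. by move=> R M N f g x /=; rewrite addrC. Qed.
Next Obligation. by move=> R M N f x /=; rewrite addr0. Qed.
Next Obligation. by move=> R M N f x /=; rewrite subrr. Qed.

(** Left [R]-modules; right [R]-modules are the left modules over the opposite
    ring [R^c], with [x r] written [(r : R^c) *: x]. *)
Program Definition RMod (R : pzRingType) : preadd :=
  {| pob := lmodType R; phom := @lin_egrp R;
     pid := fun M => (idfun : {linear M -> M}); pcomp := @linear_comp R |}.
Next Obligation. by move=> R M N P g g' gg' f f' ff' x /=; rewrite ff' gg'. Qed.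
Next Obligation. by []. Qed.
Next Obligation. by move=> R M N P g f f' x /=; rewrite linearD. Qed.
Next Obligation. by []. Qed.
Next Obligation. by []. Qed.
Next Obligation. by []. Qed.

Section Tensor.
Variable R : pzRingType.

Inductive tens_rel (M : RMod R^c) (N : RMod R) :
    word (M * N) -> word (M * N) -> Prop :=
| tensDl (x x' : M) (y : N) :
    tens_rel [:: (true, (x + x', y))] [:: (true, (x, y)); (true, (x', y))]
| tensDr (x : M) (y y' : N) :
    tens_rel [:: (true, (x, y + y'))] [:: (true, (x, y)); (true, (x, y'))]
| tensZ (r : R) (x : M) (y : N) :
    tens_rel [:: (true, ((r : R^c) *: x, y))] [:: (true, (x, r *: y))].

Definition tens (M : RMod R^c) (N : RMod R) : egrp := pres (@tens_rel M N).

Definition tprod (M : RMod R^c) (N : RMod R) (x : M) (y : N) : tens M N :=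
  gen (@tens_rel M N) (x, y).

Lemma tens_mapP (M M' : RMod R^c) (N N' : RMod R) (f : phom M M')
    (g : phom N N') s t : tens_rel s t ->
  weval (fun p => tprod ((f : {linear _ -> _}) p.1) ((g : {linear _ -> _}) p.2)) s
  ≈ weval (fun p => tprod ((f : {linear _ -> _}) p.1) ((g : {linear _ -> _}) p.2)) t.
Proof.
case=> [x x' y|x y y'|a x y] /=.
- by rewrite linearD; apply/pres_rel/tensDl.
- by rewrite linearD; apply/pres_rel/tensDr.
- by rewrite !linearZ; apply/pres_rel/tensZ.
Qed.

Definition tens_map (M M' : RMod R^c) (N N' : RMod R) (f : phom M M')
    (g : phom N N') : @phom EAb (tens M N) (tens M' N') :=
  pres_lift (tens_mapP f g).

Lemma tens_map_proper (M M' : RMod R^c) (N N' : RMod R) :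
  Proper (eeq ==> eeq ==> eeq) (@tens_map M M' N N').
Proof.
move=> f f' ff' g g' gg'; apply: pres_ext => -[x y] /=.
by rewrite (ff' x) (gg' y); apply: pres_refl.
Qed.

#[export] Existing Instance tens_map_proper.

Lemma tens_map1 (M : RMod R^c) (N : RMod R) :
  tens_map (pid M) (pid N) ≈ pid (tens M N : EAb).
Proof. by apply: pres_ext => -[x y]; apply: pres_refl. Qed.

Lemma tens_mapM (M M' M'' : RMod R^c) (N N' N'' : RMod R) (f' : phom M' M'')
    (f : phom M M') (g' : phom N' N'') (g : phom N N') :
  tens_map (f' ∘ f) (g' ∘ g) ≈ tens_map f' g' ∘ tens_map f g.
Proof. by apply: pres_ext => -[x y]; apply: pres_refl. Qed.

Lemma tprod0l (M : RMod R^c) (N : RMod R) (y : N) : tprod (0 : M) y ≈ ezero.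
Proof.
apply: (@eaddI _ (tprod (0 : M) y)); rewrite eadd0.
by symmetry; rewrite -{1}[0 : M]addr0; apply/pres_rel/tensDl.
Qed.

Lemma tprod0r (M : RMod R^c) (N : RMod R) (x : M) : tprod x (0 : N) ≈ ezero.
Proof.
apply: (@eaddI _ (tprod x (0 : N))); rewrite eadd0.
by symmetry; rewrite -{1}[0 : N]addr0; apply/pres_rel/tensDr.
Qed.

Lemma tens_map0l (M M' : RMod R^c) (N N' : RMod R) (g : phom N N') :
  tens_map (ezero : phom M M') g ≈ ezero.
Proof.
apply: (@pres_ext _ _ _ (tens_map (ezero : phom M M') g) (ezero : @phom EAb _ _)).
by move=> -[x y]; apply: tprod0l.
Qed.

Lemma tens_map0r (M M' : RMod R^c) (N N' : RMod R) (f : phom M M') :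
  tens_map f (ezero : phom N N') ≈ ezero.
Proof.
apply: (@pres_ext _ _ _ (tens_map f (ezero : phom N N')) (ezero : @phom EAb _ _)).
by move=> -[x y]; apply: tprod0r.
Qed.

Program Definition tens_l (M : RMod R^c) : functor (pcat (RMod R)) (pcat EAb) :=
  {| fob := fun N : RMod R => (tens M N : EAb);
     fmap := fun N N' g => tens_map (pid M) g |}.
Next Obligation. by move=> M N N' g g' gg'; apply: tens_map_proper. Qed.
Next Obligation. by move=> M N; apply: tens_map1. Qed.
Next Obligation.
by move=> M N N' N'' g' g; apply: (tens_mapM (pid M) (pid M) g' g).
Qed.

Program Definition tens_r (N : RMod R) :
    functor (pcat (RMod R^c)) (pcat EAb) :=
  {| fob := fun M : RMod R^c => (tens M N : EAb);
     fmap := fun M M' f => tens_map f (pid N) |}.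
Next Obligation. by move=> N M M' f f' ff'; apply: tens_map_proper. Qed.
Next Obligation. by move=> N M; apply: tens_map1. Qed.
Next Obligation.
by move=> N M M' M'' f' f; apply: (tens_mapM f' f (pid N) (pid N)).
Qed.

Record tidx (m : int) := Tidx { ti : int; tj : int; tij : ti + tj = m }.

Lemma tidx_predl (i j m n : int) : i + j = m -> m = n + 1 -> (i - 1) + j = n.
Proof. by move=> <- e; apply: (addIr 1); rewrite -e addrAC subrK. Qed.

Lemma tidx_predr (i j m n : int) : i + j = m -> m = n + 1 -> i + (j - 1) = n.
Proof. by move=> <- e; apply: (addIr 1); rewrite -e -addrA subrK. Qed.

Section TensorComplex.
Variables (X : Ch (RMod R^c)) (Y : Ch (RMod R)).

(** The degree [m] part of the usual tensor product of complexes, and its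
    homogeneous components. *)
Definition dot_deg (m : int) : EAb :=
  dsum (fun p : tidx m => tens (X (ti p)) (Y (tj p))).

Definition dot_in (m i j : int) (e : i + j = m) :
    @phom EAb (tens (X i) (Y j)) (dot_deg m) :=
  dsum_in (fun p : tidx m => tens (X (ti p)) (Y (tj p))) (Tidx e).

Lemma dot_in_irr m i j (e e' : i + j = m) : dot_in e = dot_in e'.
Proof. by rewrite (eq_irrelevance e e'). Qed.

Definition dot_d1 (m n : int) (h : m = n + 1) (i j : int) (e : i + j = m) :
    @phom EAb (tens (X i) (Y j)) (dot_deg n) :=
  dot_in (tidx_predl e h) ∘ tens_map (cd X (idx_pred i)) (pid (Y j)).

Definition dot_d2 (m n : int) (h : m = n + 1) (i j : int) (e : i + j = m) :
    @phom EAb (tens (X i) (Y j)) (dot_deg n) :=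
  dot_in (tidx_predr e h) ∘ tens_map (pid (X i)) (cd Y (idx_pred j)).

Definition dot_diff (m n : int) (h : m = n + 1) :
    @phom EAb (dot_deg m) (dot_deg n) :=
  dsum_lift (fun p => dot_d1 h (tij p) ⊞ esign (ti p) (dot_d2 h (tij p))
             : @phom EAb _ _).

(** [x (x) y |-> d x (x) y] *)
Definition mod_diff (m n : int) (h : m = n + 1) :
    @phom EAb (dot_deg m) (dot_deg n) :=
  dsum_lift (fun p => dot_d1 h (tij p)).

Lemma dot_diff_in (m n : int) (h : m = n + 1) (i j : int) (e : i + j = m) :
  dot_diff h ∘ dot_in e ≈ dot_d1 h e ⊞ esign i (dot_d2 h e).
Proof. by move=> a; apply: dsum_lift_in. Qed.

Lemma mod_diff_in (m n : int) (h : m = n + 1) (i j : int) (e : i + j = m) :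
  mod_diff h ∘ dot_in e ≈ dot_d1 h e.
Proof. by move=> a; apply: dsum_lift_in. Qed.

Lemma dot_ext m (B : EAb) (u v : @phom EAb (dot_deg m) B) :
  (forall (i j : int) (e : i + j = m), u ∘ dot_in e ≈ v ∘ dot_in e) -> u ≈ v.
Proof. by move=> uv; apply: dsum_ext => -[i j e] a; apply: (uv i j e a). Qed.

Section Squares.
Variables (m n k : int) (h : m = n + 1) (h' : n = k + 1).
Variables (i j : int) (e : i + j = m).

Definition dot_d12 : @phom EAb (tens (X i) (Y j)) (dot_deg k) :=
  dot_in (tidx_predr (tidx_predl e h) h')
  ∘ tens_map (cd X (idx_pred i)) (cd Y (idx_pred j)).

Lemma mod_diff_d1 : mod_diff h' ∘ dot_d1 h e ≈ ezero.
Proof.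
rewrite /dot_d1 pcompA mod_diff_in /dot_d1 -pcompA -tens_mapM cdd.
by rewrite tens_map0l pcompf0; reflexivity.
Qed.

Lemma mod_diff_d2 : mod_diff h' ∘ dot_d2 h e ≈ dot_d12.
Proof.
rewrite /dot_d2 pcompA mod_diff_in /dot_d1 -pcompA -tens_mapM.
rewrite pcompf1 pcomp1f /dot_d12.
by rewrite (dot_in_irr (tidx_predl (tidx_predr e h) h')
             (tidx_predr (tidx_predl e h) h')); reflexivity.
Qed.

Lemma dot_diff_d1 : dot_diff h' ∘ dot_d1 h e ≈ esign (i - 1) dot_d12.
Proof.
rewrite /dot_d1 pcompA dot_diff_in pcompDl /dot_d1 -pcompA -tens_mapM cdd.
rewrite tens_map0l pcompf0 e0add pcompSf /dot_d2 -pcompA -tens_mapM.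
by rewrite pcomp1f pcompf1; reflexivity.
Qed.

Lemma dot_diff_d2 : dot_diff h' ∘ dot_d2 h e ≈ dot_d12.
Proof.
rewrite /dot_d2 pcompA dot_diff_in pcompDl pcompSf /dot_d2.
rewrite -(pcompA _ (tens_map _ _) (tens_map _ _)) -tens_mapM cdd.
rewrite tens_map0r pcompf0 esign0 eadd0 -mod_diff_d2 /dot_d2 pcompA.
by rewrite mod_diff_in; reflexivity.
Qed.

End Squares.

Lemma esign_pred (A : egrp) (i : int) (a : A) :
  esign (i - 1) a ≈ ⊟ (esign i a).
Proof.
by rewrite {2}(idx_pred i) esignS eoppK; reflexivity.
Qed.

Lemma dot_diffK (m n k : int) (h : m = n + 1) (h' : n = k + 1) :
  dot_diff h' ∘ dot_diff h ≈ ezero.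
Proof.
apply: dot_ext => i j e; rewrite -pcompA dot_diff_in pcompDr pcompfS.
by rewrite dot_diff_d1 dot_diff_d2 esign_pred eNadd pcomp0f; reflexivity.
Qed.

Definition dot_tensor : Ch EAb := @Complex EAb dot_deg dot_diff dot_diffK.

Lemma mod_diffK (m n k : int) (h : m = n + 1) (h' : n = k + 1) :
  mod_diff h' ∘ mod_diff h ≈ ezero.
Proof.
apply: dot_ext => i j e; rewrite -pcompA mod_diff_in mod_diff_d1 pcomp0f.
reflexivity.
Qed.

(** [mod_diff] carries boundaries to boundaries. *)
Lemma mod_diff_dot (m n k : int) (h : m = n + 1) (h' : n = k + 1) :
  mod_diff h' ∘ dot_diff h ≈ ⊟ (dot_diff h' ∘ mod_diff h).
Proof.
apply: dot_ext => i j e; rewrite -pcompA dot_diff_in pcompDr pcompfS.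
rewrite mod_diff_d1 mod_diff_d2 e0add pcompNf -pcompA mod_diff_in.
by rewrite dot_diff_d1 esign_pred eoppK; reflexivity.
Qed.

Definition mtens_deg (m : int) : EAb := ecoker (dot_diff (erefl (m + 1))).

Program Definition mtens_diff (m n : int) (h : m = n + 1) :
    @phom EAb (mtens_deg m) (mtens_deg n) :=
  @Ehom (mtens_deg m) (mtens_deg n) (mod_diff h : ehom (dot_deg m) (dot_deg n)) _ _.
Next Obligation.
move=> m n h; subst m => s t [b e].
exists (⊟ ((mod_diff (erefl (n + 1 + 1)) : ehom (dot_deg _) (dot_deg _)) b)).
rewrite e ehomD ehomN.
have E : (mod_diff (erefl (n + 1)) : ehom (dot_deg _) (dot_deg _))
           ((dot_diff (erefl (n + 1 + 1)) : ehom (dot_deg _) (dot_deg _)) b)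
    ≈ ⊟ ((dot_diff (erefl (n + 1)) : ehom (dot_deg _) (dot_deg _))
           ((mod_diff (erefl (n + 1 + 1)) : ehom (dot_deg _) (dot_deg _)) b)).
  exact: (mod_diff_dot (erefl (n + 1 + 1)) (erefl (n + 1)) b).
by rewrite E; reflexivity.
Qed.
Next Obligation. by move=> m n h s t; apply: ecoker_eq; apply: ehomD. Qed.

Lemma mtens_diffK (m n k : int) (h : m = n + 1) (h' : n = k + 1) :
  mtens_diff h' ∘ mtens_diff h ≈ ezero.
Proof. by move=> s; apply: ecoker_eq; apply: (mod_diffK h h' s). Qed.

(** The modified tensor product. *)
Definition mtens : Ch EAb := @Complex EAb mtens_deg mtens_diff mtens_diffK.

End TensorComplex.

Section TensorComplexMap.
Variables (X X' : Ch (RMod R^c)) (Y Y' : Ch (RMod R)).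
Variables (f : phom X X') (g : phom Y Y').

Definition dot_map m : @phom EAb (dot_deg X Y m) (dot_deg X' Y' m) :=
  dsum_lift (fun p : tidx m =>
    dot_in X' Y' (tij p)
    ∘ tens_map ((f : chmap X X') (ti p)) ((g : chmap Y Y') (tj p))).

Lemma dot_map_in (m i j : int) (e : i + j = m) :
  dot_map m ∘ dot_in X Y e
  ≈ dot_in X' Y' e ∘ tens_map ((f : chmap X X') i) ((g : chmap Y Y') j).
Proof. by move=> a; apply: dsum_lift_in. Qed.

Lemma dot_map_d1 (m n : int) (h : m = n + 1) (i j : int) (e : i + j = m) :
  dot_map n ∘ dot_d1 X Y h e
  ≈ dot_d1 X' Y' h e ∘ tens_map ((f : chmap X X') i) ((g : chmap Y Y') j).
Proof.
rewrite /dot_d1 pcompA dot_map_in -!pcompA -!tens_mapM chm_comm.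
by rewrite pcomp1f pcompf1; reflexivity.
Qed.

Lemma dot_map_d2 (m n : int) (h : m = n + 1) (i j : int) (e : i + j = m) :
  dot_map n ∘ dot_d2 X Y h e
  ≈ dot_d2 X' Y' h e ∘ tens_map ((f : chmap X X') i) ((g : chmap Y Y') j).
Proof.
rewrite /dot_d2 pcompA dot_map_in -!pcompA -!tens_mapM chm_comm.
by rewrite pcomp1f pcompf1; reflexivity.
Qed.

Lemma dot_map_diff (m n : int) (h : m = n + 1) :
  dot_map n ∘ dot_diff X Y h ≈ dot_diff X' Y' h ∘ dot_map m.
Proof.
apply: dot_ext => i j e; rewrite -!pcompA dot_diff_in dot_map_in.
rewrite pcompDr pcompfS (pcompA (dot_diff X' Y' h)) dot_diff_in pcompDl pcompSf.
by rewrite dot_map_d1 dot_map_d2; reflexivity.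
Qed.

Lemma dot_map_mod (m n : int) (h : m = n + 1) :
  dot_map n ∘ mod_diff X Y h ≈ mod_diff X' Y' h ∘ dot_map m.
Proof.
apply: dot_ext => i j e; rewrite -!pcompA mod_diff_in dot_map_in.
by rewrite (pcompA (mod_diff X' Y' h)) mod_diff_in dot_map_d1; reflexivity.
Qed.

Program Definition mtens_map_deg m :
    @phom EAb (mtens X Y m) (mtens X' Y' m) :=
  @Ehom (mtens_deg X Y m) (mtens_deg X' Y' m)
    (dot_map m : ehom (dot_deg X Y m) (dot_deg X' Y' m)) _ _.
Next Obligation.
move=> m s t [b e]; exists ((dot_map (m + 1) : ehom (dot_deg X Y _) (dot_deg X' Y' _)) b).
rewrite e ehomD; apply: eadd_proper; first by reflexivity.
exact: (dot_map_diff (erefl (m + 1)) b).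
Qed.
Next Obligation. by move=> m s t; apply: ecoker_eq; apply: ehomD. Qed.

Lemma mtens_map_comm (m n : int) (h : m = n + 1) :
  cd (mtens X' Y') h ∘ mtens_map_deg m ≈ mtens_map_deg n ∘ cd (mtens X Y) h.
Proof.
by move=> s; apply: ecoker_eq; symmetry; apply: (dot_map_mod h s).
Qed.

Definition mtens_map : @phom (Ch EAb) (mtens X Y) (mtens X' Y') :=
  @Chmap EAb (mtens X Y) (mtens X' Y') mtens_map_deg mtens_map_comm.

End TensorComplexMap.

Lemma mtens_map_proper (X X' : Ch (RMod R^c)) (Y Y' : Ch (RMod R)) :
  Proper (eeq ==> eeq ==> eeq) (@mtens_map X X' Y Y').
Proof.
move=> f f' ff' g g' gg' m s; apply: ecoker_eq; move: s.
apply: (@dot_ext X Y m _ (dot_map f g m) (dot_map f' g' m)) => i j e.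
by rewrite !dot_map_in (ff' i) (gg' j); reflexivity.
Qed.

Lemma mtens_map1 (X : Ch (RMod R^c)) (Y : Ch (RMod R)) :
  mtens_map (pid X) (pid Y) ≈ pid (mtens X Y).
Proof.
move=> m s; apply: ecoker_eq; move: s.
apply: (@dot_ext X Y m _ (dot_map (pid X) (pid Y) m) (pid _)) => i j e.
by rewrite dot_map_in tens_map1 pcompf1 pcomp1f; reflexivity.
Qed.

Lemma mtens_mapM (X X' X'' : Ch (RMod R^c)) (Y Y' Y'' : Ch (RMod R))
    (f' : phom X' X'') (f : phom X X') (g' : phom Y' Y'') (g : phom Y Y') :
  mtens_map (f' ∘ f) (g' ∘ g) ≈ mtens_map f' g' ∘ mtens_map f g.
Proof.
move=> m s; apply: ecoker_eq; move: s.
apply: (@dot_ext X Y m _ (dot_map (f' ∘ f) (g' ∘ g) m)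
          (dot_map f' g' m ∘ dot_map f g m)) => i j e.
by rewrite -pcompA !dot_map_in pcompA dot_map_in -pcompA -tens_mapM; reflexivity.
Qed.

Program Definition mtens_l (X : Ch (RMod R^c)) :
    functor (pcat (Ch (RMod R))) (pcat (Ch EAb)) :=
  {| fob := fun Y : Ch (RMod R) => mtens X Y;
     fmap := fun Y Y' g => mtens_map (pid X) g |}.
Next Obligation.
by move=> X Y Y' g g' gg'; apply: mtens_map_proper => //; reflexivity.
Qed.
Next Obligation. by move=> X Y; apply: mtens_map1. Qed.
Next Obligation.
move=> X Y Y' Y'' g' g.
etransitivity; last exact: (mtens_mapM (pid X) (pid X) g' g).
by apply: mtens_map_proper; [symmetry; apply: pcomp1f | reflexivity].
Qed.

Program Definition mtens_r (Y : Ch (RMod R)) :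
    functor (pcat (Ch (RMod R^c))) (pcat (Ch EAb)) :=
  {| fob := fun X : Ch (RMod R^c) => mtens X Y;
     fmap := fun X X' f => mtens_map f (pid Y) |}.
Next Obligation.
by move=> Y X X' f f' ff'; apply: mtens_map_proper => //; reflexivity.
Qed.
Next Obligation. by move=> Y X; apply: mtens_map1. Qed.
Next Obligation.
move=> Y X X' X'' f' f.
etransitivity; last exact: (mtens_mapM f' f (pid Y) (pid Y)).
by apply: mtens_map_proper; [reflexivity | symmetry; apply: pcomp1f].
Qed.

(** * Gorenstein flat modules and complexes relative to a class *)

Definition flat_module (F : RMod R) : Prop := exact_functor (tens_r F).

Definition flat_complex (F : Ch (RMod R)) : Prop := exact_functor (mtens_r F).

Definition gorflat_module (B : RMod R^c -> Prop) (M : RMod R) : Prop :=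
  exists F : complex (RMod R),
    [/\ exact_complex F, compwise flat_module F,
        forall N, B N -> exact_after (tens_l N) F & is_cycles F 0 M].

Definition gorflat_complex (D : Ch (RMod R^c) -> Prop) (M : Ch (RMod R)) :
    Prop :=
  exists F : complex (Ch (RMod R)),
    [/\ exact_complex F, compwise flat_complex F,
        forall X, D X -> exact_after (mtens_l X) F & is_cycles F 0 M].

(** The complexes with components in the right [Ext]-orthogonal of [A] for
    which [Hom(X, -)] is exact on the exact complexes [X] with cycles in [A]:
    [dg (C(R))] for [A] the flat modules and [dg (GC_B(R))] for
    [A = GF_B(R)]. *)
Definition dg_rorth (A : RMod R -> Prop) (Y : Ch (RMod R)) : Prop :=
  compwise (rorth A) Y /\
  forall X, exact_with_cycles A X -> exact_complex (Hom_complex X Y).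

Definition flat_cotorsion_complex (X : Ch (RMod R)) : Prop :=
  flat_complex X /\ rorth flat_complex X.

(** [Ch(R)_{D-flat}] and [M_2], for given classes of trivial objects. *)
Definition Dflat_model (D : Ch (RMod R^c) -> Prop) (W : Ch (RMod R) -> Prop) :=
  hovey_model (gorflat_complex D) W (dg_rorth flat_module).

Definition GF_model (B : RMod R^c -> Prop) (W : Ch (RMod R) -> Prop) :=
  hovey_model (compwise (gorflat_module B) : Ch (RMod R) -> Prop) W
    (dg_rorth (gorflat_module B)).

Definition Dflat_core (D : Ch (RMod R^c) -> Prop) : Ch (RMod R) -> Prop :=
  both (gorflat_complex D) (dg_rorth flat_module).

(** [[GF_D(R) /\ dg(C(R))] / ~] *)
Definition Dflat_stable (D : Ch (RMod R^c) -> Prop) : category :=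
  stable_cat (Dflat_core D) flat_cotorsion_complex.

Definition Dflat_stable_proj (D : Ch (RMod R^c) -> Prop) :
    functor (@fullsub (pcat (Ch (RMod R))) (Dflat_core D)) (Dflat_stable D) :=
  quot_proj (@stable_rel _ (Dflat_core D) flat_cotorsion_complex).

(** [D(GF_B(R))] *)
Definition D_GF (B : RMod R^c -> Prop) : category :=
  verdier_quotient (gorflat_module B) (exact_with_cycles (gorflat_module B)).

Definition D_GF_functor (B : RMod R^c -> Prop) :
    functor (@fullsub (pcat (Ch (RMod R))) (compwise (gorflat_module B)))
      (D_GF B) :=
  verdier_functor (gorflat_module B) (exact_with_cycles (gorflat_module B)).

End Tensor.

(* Main.v *)
(* The identity is left Quillen because, on the one hand, a complex in GF_D has
    components in GF_B (test D-exactness on complexes with components in B and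
    differentials alternating between 0 and id) and, on the other hand,
    dg(GC_B) is contained in dg(C), flat modules being in GF_B.

    The homotopy category of a Hovey triple is the category of bifibrant objects
    modulo the maps that factor through a trivial bifibrant object: a map lifts
    along cofibrant and fibrant replacements uniquely up to such maps. Hence the
    derived adjunction always exists. In the first model, flat complexes are
    exact with flat cycles, hence trivially cofibrant; and a trivial bifibrant Z,
    being Z_0 of a complex of flat complexes, embeds in a flat complex F with
    quotient Z' in GF_D; the sequence splits as soon as Ext(Z', Z) = 0, so that
    Z is flat cotorsion. In the second model, the trivially cofibrant
    objects are the exact complexes with cycles in GF_B, and trivial bifibrant
    complexes are contractible, so that maps between bifibrant complexes with the
    same image in the homotopy category are chain homotopic; this gives the
    Verdier quotient. *)
From HB Require Import structures.
From Stdlib Require Import Setoid Morphisms ClassicalEpsilon.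
From mathcomp Require Import all_boot all_order all_algebra.
Require Import Defs.

Set Implicit Arguments.
Unset Strict Implicit.
Unset Printing Implicit Defensive.

Import GRing.Theory.

#[local] Obligation Tactic := idtac.

Local Open Scope ring_scope.
Local Open Scope cat_scope.

(** A functor out of a homotopy category only has to invert trivial cofibrations and trivial
    fibrations, weak equivalences being their composites. Trivial fibrations are easy, since
    cofibrant replacements lift along them. A trivial cofibration [i : X -> Y] is the obstacle, as
    its lift to cofibrant replacements need not be a monomorphism: the replacement map of [X]
    followed by [i] is factored anew, and thickness of [W] makes the first factor a trivial
    cofibration.

    A flat complex [F] is exact because tensoring with [F] keeps the embedding of a complex into its
    cone injective: for the complex with [R] in every degree and zero differential, the class of
    [1 (x) y], [y] a cycle of [F], becomes a boundary in the cone, so it vanishes beforehand, and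
    [y] is a boundary.

    The test complexes, both for tensor products and for extensions, carry one object in every
    degree instead of a single sphere or disk, so that no component depends on deciding whether two
    degrees are equal. *)

Definition witness (A : Type) (P : A -> Prop) (h : exists x, P x) : A :=
  proj1_sig (constructive_indefinite_description P h).

Lemma witnessP (A : Type) (P : A -> Prop) (h : exists x, P x) : P (witness h).
Proof. exact: proj2_sig. Qed.

(** Cotorsion pairs only assert that approximations and lifts exist, whereas functors need them as
    functions; indefinite description supplies these choices. *)
Lemma dep_choice (I : Type) (T : I -> Type) (P : forall i, T i -> Prop) :
  (forall i, exists x, P i x) -> exists f : forall i, T i, forall i, P i (f i).
Proof. by move=> h; exists (fun i => witness (h i)) => i; apply: witnessP. Qed.

(** * Isomorphisms, localizations and equivalences *)

Section Iso.
Variable C : category.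
Implicit Types X Y Z : C.

Definition iso X Y (f : hom X Y) : Prop :=
  exists g : hom Y X, g ⊙ f ≡ cid X /\ f ⊙ g ≡ cid Y.

Definition inv X Y (f : hom X Y) (h : iso f) : hom Y X := witness h.

Lemma invl X Y (f : hom X Y) (h : iso f) : inv h ⊙ f ≡ cid X.
Proof. by have [] := witnessP h. Qed.

Lemma invr X Y (f : hom X Y) (h : iso f) : f ⊙ inv h ≡ cid Y.
Proof. by have [] := witnessP h. Qed.

Lemma invlA X Y Z (f : hom X Y) (h : iso f) (u : hom Z X) :
  inv h ⊙ (f ⊙ u) ≡ u.
Proof. by rewrite ccompA invl ccomp1f; reflexivity. Qed.

Lemma invrA X Y Z (f : hom X Y) (h : iso f) (u : hom Z Y) :
  f ⊙ (inv h ⊙ u) ≡ u.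
Proof. by rewrite ccompA invr ccomp1f; reflexivity. Qed.

Lemma iso_id X : iso (cid X).
Proof. by exists (cid X); rewrite ccomp1f; split; reflexivity. Qed.

Lemma iso_inv X Y (f : hom X Y) (h : iso f) : iso (inv h).
Proof. by exists f; split; [apply: invr | apply: invl]. Qed.

Lemma iso_comp X Y Z (g : hom Y Z) (f : hom X Y) :
  iso g -> iso f -> iso (g ⊙ f).
Proof.
move=> hg hf; exists (inv hf ⊙ inv hg); split.
  by rewrite -ccompA invlA invl; reflexivity.
by rewrite -ccompA invrA invr; reflexivity.
Qed.

Lemma iso_heq X Y (f g : hom X Y) : f ≡ g -> iso f -> iso g.
Proof. by move=> fg [h [e e']]; exists h; rewrite -fg. Qed.

Lemma iso_mono X Y Z (f : hom X Y) (u v : hom Z X) :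
  iso f -> f ⊙ u ≡ f ⊙ v -> u ≡ v.
Proof. by move=> h e; rewrite -(invlA h u) e invlA; reflexivity. Qed.

Lemma iso_epi X Y Z (f : hom X Y) (u v : hom Y Z) :
  iso f -> u ⊙ f ≡ v ⊙ f -> u ≡ v.
Proof.
move=> h e; rewrite -(ccompf1 u) -(invr h) ccompA e -ccompA invr ccompf1.
reflexivity.
Qed.

Lemma iso_retraction X Y (f : hom X Y) (g : hom Y X) :
  iso f -> g ⊙ f ≡ cid X -> iso g.
Proof.
move=> h e; exists f; split=> //; apply: (iso_epi h).
by rewrite -ccompA e ccomp1f ccompf1; reflexivity.
Qed.

Lemma inv_uniq X Y (f : hom X Y) (h : iso f) (g : hom Y X) :
  f ⊙ g ≡ cid Y -> g ≡ inv h.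
Proof. by move=> e; apply: (iso_mono h); rewrite e invr; reflexivity. Qed.

End Iso.

Lemma iso_fmap (C D : category) (F : functor C D) (X Y : C) (f : hom X Y) :
  iso f -> iso (fmap F f).
Proof.
case=> g [e e']; exists (fmap F g).
by rewrite -!fmapM e e' !fmap1; split; reflexivity.
Qed.

Lemma fmap_inv (C D : category) (F : functor C D) (X Y : C) (f : hom X Y)
    (h : iso f) (h' : iso (fmap F f)) : fmap F (inv h) ≡ inv h'.
Proof. by apply: inv_uniq; rewrite -fmapM invr fmap1; reflexivity. Qed.

Program Definition natiso_of (C D : category) (F G : functor C D)
    (t : nattrans F G) (h : forall X, iso (t X)) : natiso F G :=
  {| nfwd := t; nbwd := {| ncomp := fun X => inv (h X) |} |}.
Next Obligation.
move=> C D F G t h X Y f /=; apply: (iso_mono (h Y)); rewrite invrA ccompA.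
by rewrite natural -ccompA invr ccompf1; reflexivity.
Qed.
Next Obligation. by move=> *; apply: invl. Qed.
Next Obligation. by move=> *; apply: invr. Qed.

Lemma natiso_iso (C D : category) (F G : functor C D) (t : natiso F G) X :
  iso (t X).
Proof. by exists (nbwd t X); split; [apply: nfwdK | apply: nbwdK]. Qed.

(** * Universal properties of localizations and quotient categories *)

Section LocLift.
Variables (C E : category) (W : forall X Y : C, hom X Y -> Prop).

Section Lift.
Variable T : functor C E.
Hypothesis TW : forall X Y (w : hom X Y), W w -> iso (fmap T w).

Fixpoint loc_map X Y (z : zigzag W X Y) : hom (T X) (T Y) :=
  match z with
  | zid X => cid (T X)
  | zmor _ _ f => fmap T f
  | zinv _ _ _ Ww => inv (TW Ww)
  | zcomp _ _ _ g f => loc_map g ⊙ loc_map f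
  end.

Program Definition loc_lift : functor (localization W) E :=
  {| fob := fun X : localization W => T X; fmap := fun X Y z => loc_map z |}.
Next Obligation.
move=> X Y z z'; elim=> {X Y z z'} /=.
- by move=> *; reflexivity.
- by move=> *; symmetry.
- by move=> X Y f g h _ -> _ ->; reflexivity.
- by move=> X Y Z g g' f f' _ -> _ ->; reflexivity.
- by move=> *; apply: ccompA.
- by move=> *; apply: ccomp1f.
- by move=> *; apply: ccompf1.
- by move=> X Y f g ->; reflexivity.
- by move=> *; apply: fmap1.
- by move=> *; apply: fmapM.
- by move=> *; apply: invl.
- by move=> *; apply: invr.
Qed.
Next Obligation. by move=> X; reflexivity. Qed.
Next Obligation. by move=> X Y Z g f; reflexivity. Qed.

End Lift.

Lemma loc_iso X Y (w : @hom C X Y) : W w -> iso (fmap (loc_functor W) w).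
Proof. by move=> Ww; exists (zinv w Ww); split; [apply: zz_invl | apply: zz_invr]. Qed.

Section Nat.
Variables (F G : functor (localization W) E).
Variable t : forall X : C, hom (F X) (G X).
Hypothesis tP : forall X Y (f : @hom C X Y),
  t Y ⊙ fmap F (fmap (loc_functor W) f)
  ≡ fmap G (fmap (loc_functor W) f) ⊙ t X.

(** Naturality on zigzags follows from naturality on the morphisms of [C]: the square of a formal
    inverse is the square of [w] with the isomorphism [F w] cancelled. *)
Program Definition loc_nat : nattrans F G :=
  {| ncomp := fun X : localization W => t X |}.
Next Obligation.
move=> X Y z; elim: z => {X Y} [X|X Y f|X Y w Ww|X Y Z g IHg f IHf].
- rewrite (fmap1 F (X : localization W)) (fmap1 G (X : localization W)).
  by rewrite ccompf1 ccomp1f; reflexivity.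
- exact: tP.
- have iw := loc_iso Ww; apply: (iso_epi (iso_fmap F iw)).
  rewrite -!ccompA tP -fmapM (ccompA _ _ (t X)) -fmapM.
  have -> : fmap G ((zinv w Ww : @hom (localization W) _ _) ⊙ fmap (loc_functor W) w)
     ≡ cid (G X).
    by rewrite -fmap1; apply: fmap_proper; apply: zz_invl.
  have -> : fmap F ((zinv w Ww : @hom (localization W) _ _) ⊙ fmap (loc_functor W) w)
     ≡ cid (F X).
    by rewrite -fmap1; apply: fmap_proper; apply: zz_invl.
  by rewrite ccomp1f ccompf1; reflexivity.
- rewrite (fmapM F (g : @hom (localization W) _ _) f).
  rewrite (fmapM G (g : @hom (localization W) _ _) f).
  by rewrite ccompA IHg -ccompA IHf ccompA; reflexivity.
Qed.

End Nat.
End LocLift.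

Section QuotLift.
Variables (C E : category) (r : forall X Y : C, hom X Y -> hom X Y -> Prop).
Variable T : functor C E.
Hypothesis Tr : forall X Y (f g : hom X Y), r f g -> fmap T f ≡ fmap T g.

Program Definition quot_lift : functor (quot_cat r) E :=
  {| fob := fun X : quot_cat r => T X; fmap := fun X Y f => fmap T f |}.
Next Obligation.
move=> X Y f g; elim=> {X Y f g}.
- by move=> X Y f g; apply: Tr.
- by move=> X Y f g ->; reflexivity.
- by move=> X Y f g _; symmetry.
- by move=> X Y f g h _ -> _ ->; reflexivity.
- by move=> X Y Z g g' f f' _ eg _ ef; rewrite !fmapM eg ef; reflexivity.
Qed.
Next Obligation. by move=> X /=; apply: fmap1. Qed.
Next Obligation. by move=> X Y Z g f /=; apply: fmapM. Qed.

(** The composite agrees with [T] definitionally; identities serve as components because functors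
    are compared up to natural isomorphism. *)
Lemma quot_lift_natiso : inhabited (natiso (fcomp quot_lift (quot_proj r)) T).
Proof.
constructor; apply: (natiso_of (t := @Nattrans _ _ (fcomp quot_lift (quot_proj r)) T
  (fun X => cid (T X)) _)) => [X Y f|X h]; last exact: iso_id.
by rewrite ccomp1f ccompf1; reflexivity.
Qed.

Variable W : forall X Y : quot_cat r, hom X Y -> Prop.
Hypothesis TW : forall (X Y : quot_cat r) (w : hom X Y), W w -> iso (fmap quot_lift w).

Lemma loc_quot_lift_natiso :
  inhabited (natiso (fcomp (loc_lift TW) (fcomp (loc_functor W) (quot_proj r))) T).
Proof.
constructor; apply: (natiso_of (t := @Nattrans _ _
  (fcomp (loc_lift TW) (fcomp (loc_functor W) (quot_proj r))) T
  (fun X => cid (T X)) _)) => [X Y f|X h]; last exact: iso_id.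
by rewrite ccomp1f ccompf1; reflexivity.
Qed.

End QuotLift.

Section Equivalence.
Variables (C D : category) (E : functor C D) (K : functor D C).

Lemma faithful_of (a : natiso (fcomp K E) (idf C)) X Y (f g : @hom C X Y) :
  fmap E f ≡ fmap E g -> f ≡ g.
Proof.
move=> e; apply: (iso_epi (natiso_iso a X)).
have := natural a f; have := natural a g; rewrite /= => <- <-.
by rewrite e; reflexivity.
Qed.

End Equivalence.

Lemma full_of (C D : category) (E : functor C D) (K : functor D C)
    (a : natiso (fcomp K E) (idf C)) (b : natiso (fcomp E K) (idf D)) X Y
    (f : hom (E X) (E Y)) :
  exists g : hom X Y, fmap E g ≡ f.
Proof.
(* [b] makes [K] faithful, so it is enough to compare images under [K]; these are conjugates by the
   isomorphism [a]. *)
exists (a Y ⊙ (fmap K f ⊙ nbwd a X)); apply: (faithful_of b).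
apply: (iso_mono (natiso_iso a Y)).
have := natural a (a Y ⊙ (fmap K f ⊙ nbwd a X)) => /= ->.
by rewrite -!ccompA (nfwdK a) ccompf1; reflexivity.
Qed.

(** * Transport of an adjunction along equivalences *)

Section Transport.
Variables (C D C' D' : category) (L : functor C D) (R : functor D C).
Variables (a : adjunction L R) (E : functor C' C) (E' : functor D' D).

(** The quasi-inverses are not assumed to form adjoint equivalences, so unit and counit are not
    composed from them: fullness provides maps whose images under [E] and [E'] are the required
    composites. Faithfulness then reduces naturality and the triangle identities to those of [a],
    and the compatibility of the units holds by construction. *)
Lemma transport_adjunction : is_equivalence E -> is_equivalence E' ->
  exists (L' : functor C' D') (R' : functor D' C') (a' : adjunction L' R'),
    adjunction_transported a a' E E'.
Proof.
case=> K [[al] [be]] [K' [[al'] [be']]].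
pose L' := fcomp K' (fcomp L E); pose R' := fcomp K (fcomp R E').
pose p X : hom (E' (L' X)) (L (E X)) := be' (L (E X)).
pose pi X : hom (L (E X)) (E' (L' X)) := nbwd be' (L (E X)).
pose q Y : hom (E (R' Y)) (R (E' Y)) := be (R (E' Y)).
pose qi Y : hom (R (E' Y)) (E (R' Y)) := nbwd be (R (E' Y)).
have pN X Y (f : hom X Y) : p Y ⊙ fmap E' (fmap L' f) ≡ fmap L (fmap E f) ⊙ p X.
  exact: (natural be').
have piN X Y (f : hom X Y) : pi Y ⊙ fmap L (fmap E f) ≡ fmap E' (fmap L' f) ⊙ pi X.
  exact: (natural (nbwd be')).
have qN X Y (f : hom X Y) : q Y ⊙ fmap E (fmap R' f) ≡ fmap R (fmap E' f) ⊙ q X.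
  exact: (natural be).
have qiN X Y (f : hom X Y) : qi Y ⊙ fmap R (fmap E' f) ≡ fmap E (fmap R' f) ⊙ qi X.
  exact: (natural (nbwd be)).
have ppi X : p X ⊙ pi X ≡ cid _ := nbwdK be' (L (E X)).
have pip X : pi X ⊙ p X ≡ cid _ := nfwdK be' (L (E X)).
have qqi X : q X ⊙ qi X ≡ cid _ := nbwdK be (R (E' X)).
have ff X Y (f g : hom X Y) : fmap E f ≡ fmap E g -> f ≡ g := @faithful_of _ _ E K al X Y f g.
have ff' X Y (f g : hom X Y) : fmap E' f ≡ fmap E' g -> f ≡ g := @faithful_of _ _ E' K' al' X Y f g.
have [u uP] := dep_choice (fun X => full_of al be
  (qi (L' X) ⊙ (fmap R (pi X) ⊙ aunit a (E X)) : hom (E X) (E (R' (L' X))))).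
have [v vP] := dep_choice (fun Y => full_of al' be'
  (acounit a (E' Y) ⊙ (fmap L (q Y) ⊙ p (R' Y)) : hom (E' (L' (R' Y))) (E' Y))).
have uN X Y (f : hom X Y) : u Y ⊙ f ≡ fmap R' (fmap L' f) ⊙ u X.
  apply: (@ff); rewrite !fmapM !uP -!ccompA (ccompA (fmap E _)) -qiN -!ccompA.
  have /= -> := natural (aunit a) (fmap E f).
  by rewrite !ccompA -(ccompA (qi _) (fmap R _)) -fmapM piN fmapM -!ccompA; reflexivity.
have vN X Y (f : hom X Y) : v Y ⊙ fmap L' (fmap R' f) ≡ f ⊙ v X.
  apply: (@ff'); rewrite !fmapM !vP -!ccompA pN (ccompA (fmap L (q Y))) -fmapM qN.
  have /= e := natural (acounit a) (fmap E' f).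
  by rewrite fmapM -!ccompA (ccompA (acounit a (E' Y))) e -!ccompA; reflexivity.
have tL X : v (L' X) ⊙ fmap L' (u X) ≡ cid (L' X).
  apply: (@ff'); rewrite fmap1 fmapM vP -!ccompA pN uP (ccompA (fmap L (q _))) -fmapM.
  rewrite (ccompA (q _) (qi _)) qqi ccomp1f fmapM -ccompA.
  have /= e := natural (acounit a) (pi X).
  rewrite (ccompA (acounit a _) (fmap L (fmap R (pi X)))) e -ccompA.
  have /= e' := triangleL a (E X).
  by rewrite (ccompA (acounit a _)) e' ccomp1f pip; reflexivity.
have tR Y : fmap R' (v Y) ⊙ u (R' Y) ≡ cid (R' Y).
  apply: (@ff); apply: (iso_mono (natiso_iso be (R (E' Y)))).
  rewrite -/(q Y) fmap1 ccompf1 fmapM ccompA qN uP vP !fmapM -!ccompA.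
  rewrite (ccompA (q _) (qi _)) qqi ccomp1f (ccompA (fmap R (p _))) -fmapM ppi fmap1.
  rewrite ccomp1f; have /= <- := natural (aunit a) (q Y).
  have /= e := triangleR a (E' Y).
  by rewrite ccompA e ccomp1f; reflexivity.
pose a' : adjunction L' R' := @Adjunction _ _ L' R'
  (@Nattrans _ _ (idf C') (fcomp R' L') u uN)
  (@Nattrans _ _ (fcomp L' R') (idf D') v vN) tL tR.
exists L', R', a'.
pose np : nattrans (fcomp E' L') (fcomp L E) := @Nattrans _ _ (fcomp E' L') (fcomp L E) p pN.
pose nq : nattrans (fcomp E R') (fcomp R E') := @Nattrans _ _ (fcomp E R') (fcomp R E') q qN.
exists (natiso_of (t := np) (fun X => natiso_iso be' _)),
       (natiso_of (t := nq) (fun X => natiso_iso be _)) => X /=.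
rewrite uP (ccompA (q _)) qqi ccomp1f ccompA -fmapM ppi fmap1 ccomp1f.
reflexivity.
Qed.

End Transport.

(** * A decision procedure for abelian groups *)

Inductive aexp := AVar of nat | AZero | AAdd of aexp & aexp | AOpp of aexp.

Section AbelDec.
Variables (A : egrp) (env : seq A).

Fixpoint aval (e : aexp) : A :=
  match e with
  | AVar n => nth ezero env n
  | AZero => ezero
  | AAdd a b => aval a ⊞ aval b
  | AOpp a => ⊟ (aval a)
  end.

(** The numbers of positive ([b = true]) and negative occurrences of a variable. *)
Fixpoint acount (b : bool) (e : aexp) (n : nat) : nat :=
  match e with
  | AVar m => (b && (m == n))%N
  | AZero => 0%N
  | AAdd x y => (acount b x n + acount b y n)%N
  | AOpp x => acount (~~ b) x n
  end.

Definition amul (n : nat) (a : A) : A := iter n (eadd a) ezero.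

Lemma amulD m n a : amul (m + n) a ≈ amul m a ⊞ amul n a.
Proof.
elim: m => [|m IHm] /=; first by rewrite e0add; reflexivity.
by rewrite IHm; apply: eaddA.
Qed.

Definition asum (f : nat -> nat) : A :=
  foldr (fun n s => amul (f n) (nth ezero env n) ⊞ s) ezero (iota 0 (size env)).

Lemma asumD f g : asum (fun n => (f n + g n)%N) ≈ asum f ⊞ asum g.
Proof.
rewrite /asum; elim: (iota _ _) => [|n s IHs] /=.
  by rewrite eadd0; reflexivity.
by rewrite IHs amulD; apply: eaddACA.
Qed.

Lemma asum0 : asum (fun=> 0%N) ≈ ezero.
Proof.
by rewrite /asum; elim: (iota _ _) => //= [|n s ->]; rewrite ?eadd0; reflexivity.
Qed.

Lemma asum1 m : asum (fun n => (m == n) : nat) ≈ nth ezero env m.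
Proof.
rewrite /asum; have [lt_m|le_m] := ltnP m (size env); last first.
  rewrite nth_default //.
  have: all (fun n => n != m) (iota 0 (size env)).
    by apply/allP => n; rewrite mem_iota /= => lt_n; rewrite ltn_eqF // (leq_trans lt_n).
  elim: (iota _ _) => [|n s IHs] /=; first by reflexivity.
  by case/andP => /negPf nm /IHs ->; rewrite eq_sym nm /= eadd0; reflexivity.
have: m \in iota 0 (size env) by rewrite mem_iota.
have := iota_uniq 0 (size env).
elim: (iota _ _) => [|n s IHs] //= /andP[ns us]; rewrite inE.
have [-> _|nm /= ms] := eqVneq m n.
  have: all (fun k => k != n) s.
    by apply/allP => k ks; apply: contraNneq ns => <-.
  elim: s {IHs us ns} => [|k s IHs] /=; first by rewrite !eadd0; reflexivity.
  by case/andP => /negPf kn /IHs; rewrite eq_sym kn /= e0add.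
by rewrite IHs // e0add; reflexivity.
Qed.

Lemma avalE e : aval e ≈ asum (acount true e) ⊞ ⊟ (asum (acount false e)).
Proof.
elim: e => [m||a IHa b IHb|a IHa] /=.
- by rewrite asum1 asum0 eopp0 eadd0; reflexivity.
- by rewrite asum0 eaddN; reflexivity.
- by rewrite IHa IHb !asumD eoppD eaddACA; reflexivity.
- by rewrite IHa eoppD eoppK eaddC; reflexivity.
Qed.

(** Adding the positive occurrences on one side to the negative ones on the other keeps all counts
    in [nat]. Indices beyond the size of [env] denote zero and need no test. *)
Lemma abel_dec e e' :
  all (fun n => acount true e n + acount false e' n
                == acount true e' n + acount false e n)%N (iota 0 (size env)) ->
  aval e ≈ aval e'.
Proof.
move=> h; rewrite !avalE; set p := asum _; set q := asum _; set p' := asum _.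
set q' := asum _.
have E : p ⊞ q' ≈ p' ⊞ q.
  rewrite -!asumD /asum; move: h; elim: (iota _ _) => [|n s IHs] /=.
    by reflexivity.
  by case/andP => /eqP -> /IHs ->; reflexivity.
transitivity ((p ⊞ q') ⊞ (⊟ q ⊞ ⊟ q')).
  by rewrite eaddACA eaddN eadd0; reflexivity.
by rewrite E (eaddC (⊟ q)) eaddACA eaddN eadd0; reflexivity.
Qed.

End AbelDec.

Lemma esub_eq (A : egrp) (a b : A) : a ⊞ ⊟ b ≈ ezero -> a ≈ b.
Proof.
move=> e; apply: (@eaddI _ (⊟ b)); rewrite eNadd eaddC; exact: e.
Qed.

Lemma eq_esub (A : egrp) (a b : A) : a ≈ b -> a ⊞ ⊟ b ≈ ezero.
Proof. by move=> ->; apply: eaddN. Qed.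

(** Atoms are compared syntactically. The dummy [match] runs the tactic [constr_eq] while a term is
    being computed, so that its failure selects the next branch. *)
Ltac abel_mem a l :=
  lazymatch l with
  | nil => constr:(false)
  | cons ?b ?l' =>
      match constr:(Set) with
      | _ => let _ := match constr:(Set) with _ => constr_eq a b end in constr:(true)
      | _ => abel_mem a l'
      end
  end.
Ltac abel_atoms t l :=
  lazymatch t with
  | eadd ?a ?b => let l' := abel_atoms a l in abel_atoms b l'
  | eopp ?a => abel_atoms a l
  | ezero => l
  | _ => let b := abel_mem t l in
         lazymatch b with true => l | false => constr:(cons t l) end
  end.
Ltac abel_idx a l :=
  lazymatch l with
  | cons ?b ?l' =>
      match constr:(Set) with
      | _ => let _ := match constr:(Set) with _ => constr_eq a b end in constr:(0%N)
      | _ => let n := abel_idx a l' in constr:(S n)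
      end
  end.
Ltac abel_reify t l :=
  lazymatch t with
  | eadd ?a ?b =>
      let x := abel_reify a l in let y := abel_reify b l in constr:(AAdd x y)
  | eopp ?a => let x := abel_reify a l in constr:(AOpp x)
  | ezero => constr:(AZero)
  | _ => let n := abel_idx t l in constr:(AVar n)
  end.
Ltac abel :=
  lazymatch goal with
  | |- @eeq ?A ?a ?b =>
      let l0 := abel_atoms a (@nil (esort A)) in
      let l := abel_atoms b l0 in
      let x := abel_reify a l in let y := abel_reify b l in
      exact (@abel_dec A l x y (erefl true))
  end.

(** * Abelian categories *)

Lemma pcomp_eql (C : preadd) (X Y Z : C) (g g' : phom Y Z) (f : phom X Y) :
  g ≈ g' -> g ∘ f ≈ g' ∘ f.
Proof. by move=> ->; reflexivity. Qed.

Lemma pcomp_eqr (C : preadd) (X Y Z : C) (g : phom Y Z) (f f' : phom X Y) :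
  f ≈ f' -> g ∘ f ≈ g ∘ f'.
Proof. by move=> ->; reflexivity. Qed.

Definition biproduct (C : preadd) (X Y B : C) (i1 : phom X B) (i2 : phom Y B)
    (p1 : phom B X) (p2 : phom B Y) : Prop :=
  [/\ p1 ∘ i1 ≈ pid X, p2 ∘ i2 ≈ pid Y, p1 ∘ i2 ≈ ezero, p2 ∘ i1 ≈ ezero
    & i1 ∘ p1 ⊞ i2 ∘ p2 ≈ pid B].

Record abelian (C : preadd) : Prop := Abelian {
  ab_zero : exists Z : C, pid Z ≈ ezero;
  ab_bip : forall X Y : C, exists B (i1 : phom X B) (i2 : phom Y B)
    (p1 : phom B X) (p2 : phom B Y), biproduct i1 i2 p1 p2;
  ab_ker : forall (X Y : C) (f : phom X Y), exists K (k : phom K X), is_kernel f k;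
  ab_cok : forall (X Y : C) (f : phom X Y),
    exists Q (q : phom Y Q), is_cokernel f q;
  ab_mono : forall (X Y Q : C) (f : phom X Y) (q : phom Y Q),
    is_mono f -> is_cokernel f q -> is_kernel q f;
  ab_epi : forall (X Y K : C) (g : phom X Y) (k : phom K X),
    is_epi g -> is_kernel g k -> is_cokernel k g }.

(** Duality halves the diagram chases: pushouts, extensions of maps and cokernels come from
    pullbacks, lifts and kernels in [opp C], mostly by conversion. *)
Program Definition opp (C : preadd) : preadd :=
  {| pob := C; phom := fun X Y => @phom C Y X; pid := @pid C;
     pcomp := fun X Y Z g f => @pcomp C Z Y X f g |}.
Next Obligation. by move=> C X Y Z g g' gg' f f' ff'; apply: pcomp_proper. Qed.
Next Obligation. by move=> C X Y Z g g' f; apply: pcompDr. Qed.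
Next Obligation. by move=> C X Y Z g f f'; apply: pcompDl. Qed.
Next Obligation. by move=> C X Y Z T h g f /=; symmetry; apply: pcompA. Qed.
Next Obligation. by move=> C X Y f; apply: pcompf1. Qed.
Next Obligation. by move=> C X Y f; apply: pcomp1f. Qed.

Lemma abelian_opp (C : preadd) : abelian C -> abelian (opp C).
Proof.
case=> z b k c m e; split.
- by have [Z hZ] := z; exists Z.
- move=> X Y; have [B [i1 [i2 [p1 [p2 [h1 h2 h3 h4 h5]]]]]] := b X Y.
  by exists B, p1, p2, i1, i2; split.
- by move=> X Y f; have [Q [q [h1 h2 h3]]] := c Y X f; exists Q, q.
- by move=> X Y f; have [Q [q [h1 h2 h3]]] := k Y X f; exists Q, q.
- by move=> X Y Q f q hf [h1 h2 h3]; have [//|] := e _ _ _ f q hf.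
- by move=> X Y Q f q hf [h1 h2 h3]; have [//|] := m _ _ _ f q hf.
Qed.

Lemma ses_opp (C : preadd) (A X B : C) (f : phom A X) (g : phom X B) :
  ses f g <-> @ses (opp C) B X A g f.
Proof. by split=> -[[? ? ?] [? ? ?]]. Qed.

Section Preadditive.
Variable C : preadd.
Implicit Types X Y Z A B K N T : C.

Lemma mono0 X Y (f : phom X Y) T (u : phom T X) :
  is_mono f -> f ∘ u ≈ ezero -> u ≈ ezero.
Proof. by move=> m e; apply: m; rewrite e pcompf0; reflexivity. Qed.

Lemma epi0 X Y (f : phom X Y) T (u : phom Y T) :
  is_epi f -> u ∘ f ≈ ezero -> u ≈ ezero.
Proof. by move=> m e; apply: m; rewrite e pcomp0f; reflexivity. Qed.

Lemma mono_of0 X Y (f : phom X Y) :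
  (forall T (u : phom T X), f ∘ u ≈ ezero -> u ≈ ezero) -> is_mono f.
Proof.
by move=> h T u v e; apply: esub_eq; apply: h; rewrite pcompDr pcompfN e eaddN; reflexivity.
Qed.

Lemma epi_of0 X Y (f : phom X Y) :
  (forall T (u : phom Y T), u ∘ f ≈ ezero -> u ≈ ezero) -> is_epi f.
Proof.
by move=> h T u v e; apply: esub_eq; apply: h; rewrite pcompDl pcompNf e eaddN; reflexivity.
Qed.

Lemma mono_comp X Y Z (g : phom Y Z) (f : phom X Y) :
  is_mono g -> is_mono f -> is_mono (g ∘ f).
Proof. by move=> hg hf T u v; rewrite -!pcompA => /hg /hf. Qed.

Lemma epi_comp X Y Z (g : phom Y Z) (f : phom X Y) :
  is_epi g -> is_epi f -> is_epi (g ∘ f).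
Proof. by move=> hg hf T u v; rewrite !pcompA => /hf /hg. Qed.

Lemma mono_cancel X Y Z (g : phom Y Z) (f : phom X Y) :
  is_mono (g ∘ f) -> is_mono f.
Proof. by move=> h T u v e; apply: h; rewrite -!pcompA e; reflexivity. Qed.

Lemma epi_cancel X Y Z (g : phom Y Z) (f : phom X Y) :
  is_epi (g ∘ f) -> is_epi g.
Proof. by move=> h T u v e; apply: h; rewrite !pcompA e; reflexivity. Qed.

Lemma mono_heq X Y (f g : phom X Y) : f ≈ g -> is_mono f -> is_mono g.
Proof. by move=> e h T u v; rewrite -e; apply: h. Qed.

Lemma epi_heq X Y (f g : phom X Y) : f ≈ g -> is_epi f -> is_epi g.
Proof. by move=> e h T u v; rewrite -e; apply: h. Qed.

Lemma split_epi X Y (g : phom X Y) (s : phom Y X) : g ∘ s ≈ pid Y -> is_epi g.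
Proof.
move=> e T u v; rewrite -{2}(pcompf1 u) -{2}(pcompf1 v) -e !pcompA => ->.
reflexivity.
Qed.

Lemma split_mono X Y (g : phom X Y) (r : phom Y X) : r ∘ g ≈ pid X -> is_mono g.
Proof.
move=> e T u v; rewrite -{2}(pcomp1f u) -{2}(pcomp1f v) -e -!pcompA => ->.
reflexivity.
Qed.

Lemma kernel_heq X Y (f f' : phom X Y) K (k k' : phom K X) :
  f ≈ f' -> k ≈ k' -> is_kernel f k -> is_kernel f' k'.
Proof.
move=> ef ek [h m u]; split; first by rewrite -ef -ek.
  exact: mono_heq m.
by move=> T v; rewrite -ef => /u[w e]; exists w; rewrite -ek.
Qed.

Lemma kernel_mono_comp X Y Z (f : phom X Y) (m : phom Y Z) K (k : phom K X) :
  is_mono m -> is_kernel f k <-> is_kernel (m ∘ f) k.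
Proof.
move=> hm; split=> -[h hk u].
  split=> //; first by rewrite -pcompA h pcompf0; reflexivity.
  by move=> T v; rewrite -pcompA => /(mono0 hm)/u.
split=> //; first by apply: (mono0 hm); rewrite pcompA.
by move=> T v e; apply: u; rewrite -pcompA e pcompf0; reflexivity.
Qed.

Lemma kernel_uniq X Y (f : phom X Y) K (k : phom K X) K' (k' : phom K' X) :
  is_kernel f k -> is_kernel f k' ->
  exists u v, [/\ u ∘ v ≈ pid K', v ∘ u ≈ pid K, k' ∘ u ≈ k & k ∘ v ≈ k'].
Proof.
move=> [h m e] [h' m' e']; have [u hu] := e' _ k h; have [v hv] := e _ k' h'.
exists u, v; split=> //.
  by apply: m'; rewrite pcompA hu hv pcompf1; reflexivity.
by apply: m; rewrite pcompA hv hu pcompf1; reflexivity.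
Qed.

Lemma ses_epi A X B (f : phom A X) (g : phom X B) : ses f g -> is_epi g.
Proof. by case=> _ []. Qed.
Lemma ses_mono A X B (f : phom A X) (g : phom X B) : ses f g -> is_mono f.
Proof. by case=> -[]. Qed.
Lemma ses0 A X B (f : phom A X) (g : phom X B) : ses f g -> g ∘ f ≈ ezero.
Proof. by case=> -[]. Qed.

Lemma ses_retraction A X B (f : phom A X) (g : phom X B) (s : phom B X) :
  ses f g -> g ∘ s ≈ pid B -> exists r, r ∘ f ≈ pid A.
Proof.
move=> [[gf mf kf] _] gs.
have [|r hr] := kf _ (pid X ⊞ ⊟ (s ∘ g)).
  rewrite pcompDr pcompfN pcompA gs pcompf1 pcomp1f; exact: eaddN.
exists r; apply: mf; rewrite pcompA hr pcompDl pcompNf -pcompA gf pcompf0 eopp0.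
by rewrite eadd0 pcomp1f pcompf1; reflexivity.
Qed.

Lemma ses_section A X B (f : phom A X) (g : phom X B) (r : phom X A) :
  ses f g -> r ∘ f ≈ pid A -> exists s, g ∘ s ≈ pid B.
Proof.
move=> [_ [gf eg cg]] rf.
have [|s hs] := cg _ (pid X ⊞ ⊟ (f ∘ r)).
  rewrite pcompDl pcompNf -pcompA rf pcompf1 pcomp1f; exact: eaddN.
exists s; apply: eg; rewrite -pcompA hs pcompDr pcompfN pcompA gf pcomp0f eopp0.
by rewrite eadd0 pcomp1f pcompf1; reflexivity.
Qed.

Lemma bip_ses X Y B (i1 : phom X B) (i2 : phom Y B) (p1 : phom B X)
    (p2 : phom B Y) : biproduct i1 i2 p1 p2 -> ses i1 p2.
Proof.
move=> [h1 h2 h12 h21 h]; split; split=> //.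
- exact: split_mono h1.
- move=> T u e; exists (p1 ∘ u); rewrite pcompA -{2}(pcomp1f u) -h pcompDl.
  by rewrite -(pcompA i2) e pcompf0 eadd0; reflexivity.
- exact: split_epi h2.
- move=> T u e; exists (u ∘ i2); rewrite -pcompA -{2}(pcompf1 u) -h pcompDr.
  by rewrite (pcompA u i1) e pcomp0f e0add; reflexivity.
Qed.

Lemma bip_sym X Y B (i1 : phom X B) (i2 : phom Y B) (p1 : phom B X)
    (p2 : phom B Y) : biproduct i1 i2 p1 p2 -> biproduct i2 i1 p2 p1.
Proof. by move=> [h1 h2 h12 h21 h]; split=> //; rewrite eaddC. Qed.

Lemma retract_kernel X Y K X' Y' K' (f : phom X Y) (k : phom K X)
    (f' : phom X' Y') (k' : phom K' X') (sx : phom X' X) (rx : phom X X')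
    (sy : phom Y' Y) (ry : phom Y Y') (sk : phom K' K) (rk : phom K K') :
  rx ∘ sx ≈ pid X' -> ry ∘ sy ≈ pid Y' -> rk ∘ sk ≈ pid K' ->
  f ∘ sx ≈ sy ∘ f' -> f' ∘ rx ≈ ry ∘ f -> k ∘ sk ≈ sx ∘ k' -> k' ∘ rk ≈ rx ∘ k ->
  is_kernel f k -> is_kernel f' k'.
Proof.
move=> ex ey ek fs fr ks kr [h m u]; split.
- rewrite -(pcomp1f (f' ∘ k')) -ey -pcompA (pcompA sy) -fs -(pcompA f) -ks.
  by rewrite (pcompA f) h pcomp0f pcompf0; reflexivity.
- apply: (@mono_cancel _ _ _ sx); apply: (mono_heq ks); apply: mono_comp => //.
  exact: split_mono ek.
- move=> T v e; have [|w hw] := u _ (sx ∘ v).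
    by rewrite pcompA fs -pcompA e pcompf0; reflexivity.
  by exists (rk ∘ w); rewrite pcompA kr -pcompA hw pcompA ex pcomp1f; reflexivity.
Qed.

End Preadditive.

Lemma retract_cokernel (C : preadd) (X Y Q X' Y' Q' : C) (f : phom X Y)
    (q : phom Y Q) (f' : phom X' Y') (q' : phom Y' Q') (sx : phom X' X)
    (rx : phom X X') (sy : phom Y' Y) (ry : phom Y Y') (sq : phom Q' Q)
    (rq : phom Q Q') :
  rx ∘ sx ≈ pid X' -> ry ∘ sy ≈ pid Y' -> rq ∘ sq ≈ pid Q' ->
  f ∘ sx ≈ sy ∘ f' -> f' ∘ rx ≈ ry ∘ f -> q ∘ sy ≈ sq ∘ q' -> q' ∘ ry ≈ rq ∘ q ->
  is_cokernel f q -> is_cokernel f' q'.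
Proof.
move=> ex ey eq fs fr qs qr [h1 h2 h3].
suff [? ? ?] : @is_kernel (opp C) _ _ f' _ q' by split.
apply: (@retract_kernel (opp C) _ _ _ _ _ _ f q f' q' ry sy rx sx rq sq) => //=.
- by symmetry.
- by symmetry.
- by symmetry.
- by symmetry.
Qed.

Section Abelian.
Variables (C : preadd) (abC : abelian C).
Implicit Types X Y Z A B K N T : C.

Lemma ses_of_epi X Y K (g : phom X Y) (k : phom K X) :
  is_epi g -> is_kernel g k -> ses k g.
Proof. by move=> hg hk; split=> //; apply: ab_epi. Qed.

Lemma ses_of_mono X Y Q (f : phom X Y) (q : phom Y Q) :
  is_mono f -> is_cokernel f q -> ses f q.
Proof. by move=> hf hq; split=> //; apply: ab_mono. Qed.

(** The pullback is the kernel of [d = p p1 - u p2] on the biproduct of [X] and [A]. *)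
Lemma pullback X Y A (p : phom X Y) (u : phom A Y) :
  exists E (a : phom E X) (b : phom E A),
  [/\ p ∘ a ≈ u ∘ b,
      forall T (s : phom T X) (t : phom T A), p ∘ s ≈ u ∘ t ->
        exists w, a ∘ w ≈ s /\ b ∘ w ≈ t,
      forall T (s t : phom T E), a ∘ s ≈ a ∘ t -> b ∘ s ≈ b ∘ t -> s ≈ t
    & is_epi p -> is_epi b].
Proof.
have [B [i1 [i2 [p1 [p2 hB]]]]] := ab_bip abC X A.
have [h1 h2 h12 h21 h] := hB.
pose d := p ∘ p1 ⊞ ⊟ (u ∘ p2).
have [E [k [dk mk uk]]] := ab_ker abC d.
have dE T (w : phom T B) : d ∘ w ≈ p ∘ (p1 ∘ w) ⊞ ⊟ (u ∘ (p2 ∘ w)).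
  by rewrite /d pcompDl pcompNf !pcompA; reflexivity.
exists E, (p1 ∘ k), (p2 ∘ k); split.
- by apply: esub_eq; rewrite -dE.
- move=> T s t e; have [|w hw] := uk _ (i1 ∘ s ⊞ i2 ∘ t).
    rewrite dE !pcompDr !(pcompA p1) !(pcompA p2) h1 h2 h12 h21 !pcomp0f !pcomp1f.
    by rewrite !pcompf0 e0add eadd0 e eaddN; reflexivity.
  exists w; rewrite -!pcompA hw !pcompDr !pcompA h1 h2 h12 h21 !pcomp0f !pcomp1f.
  by rewrite e0add eadd0; split; reflexivity.
- move=> T s t e e'; apply: mk.
  rewrite -(pcomp1f (k ∘ s)) -(pcomp1f (k ∘ t)) -h !pcompDl -!pcompA.
  by rewrite !(pcompA p1) !(pcompA p2) e e'; reflexivity.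
(* Stability of epimorphisms: if [v] kills [b], then [v p2] factors through [d], the cokernel of
   [k]; restricted to [X], the factor kills the epimorphism [p] and so vanishes. *)
- move=> ep; have ed : is_epi d.
    apply: (@epi_cancel _ _ _ _ _ i1); apply: (epi_heq _ ep).
    by rewrite dE h1 h21 pcompf0 eopp0 eadd0 pcompf1; reflexivity.
  have [_ _ cd] : is_cokernel k d by apply: (ab_epi abC).
  apply: epi_of0 => T v; rewrite pcompA => /cd[w hw].
  have w0 : w ≈ ezero.
    apply: (epi0 ep); transitivity (v ∘ p2 ∘ i1).
      rewrite -hw -pcompA dE h1 h21 pcompf0 eopp0 eadd0 pcompf1; reflexivity.
    by rewrite -pcompA h21 pcompf0; reflexivity.
  rewrite -(pcompf1 v) -h2 pcompA -hw w0 !pcomp0f; reflexivity.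
Qed.

(** Replaces the choice of preimages in diagram chases: a generalized element of [Y] lifts to [X]
    after passing to a cover of its domain. *)
Lemma epi_cover X Y A (p : phom X Y) (u : phom A Y) : is_epi p ->
  exists E (c : phom E A) (v : phom E X), is_epi c /\ p ∘ v ≈ u ∘ c.
Proof.
move=> hp; have [E [a [b [e _ _ hb]]]] := pullback p u.
by exists E, b, a; split=> //; apply: hb.
Qed.

(** Pulling [K -> X -> Y] back along [u] gives an extension of [A] by [K]; a section of it yields
    the lift. *)
Lemma lift_ext X Y K A (p : phom X Y) (k : phom K X) (u : phom A Y) :
  is_epi p -> is_kernel p k -> ext1_zero A K -> exists v, p ∘ v ≈ u.
Proof.
move=> hp [pk mk kk] hA; have [E [a [b [e ue je hb]]]] := pullback p u.
have [|k' [ak' bk']] := ue _ k ezero; first by rewrite pk pcompf0; reflexivity.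
have kk' : is_kernel b k'.
  split=> //; first by apply: (@mono_cancel _ _ _ _ a); apply: (mono_heq _ mk); symmetry.
  move=> T t bt; have [|w hw] := kk _ (a ∘ t).
    by rewrite pcompA e -pcompA bt pcompf0; reflexivity.
  exists w; apply: je; first by rewrite pcompA ak'.
  by rewrite pcompA bk' bt pcomp0f; reflexivity.
have [s bs] := hA _ _ _ (ses_of_epi (hb hp) kk').
by exists (a ∘ s); rewrite pcompA e -pcompA bs pcompf1; reflexivity.
Qed.

(** A case of the snake lemma. Its dual serves to compose cofibrations. *)
Lemma composite_epi_ses X Y Z (p : phom X Y) (q : phom Y Z) K (k : phom K X)
    L (l : phom L Y) M (m : phom M X) :
  is_epi p -> is_epi q -> is_kernel p k -> is_kernel q l ->
  is_kernel (q ∘ p) m ->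
  exists (a : phom K M) (b : phom M L), ses a b.
Proof.
move=> hp hq [pk mk kk] [ql ml kl] [qm mm km].
have [|a ha] := km _ k; first by rewrite -pcompA pk pcompf0; reflexivity.
have [|b hb] := kl _ (p ∘ m); first by rewrite pcompA qm; reflexivity.
exists a, b; apply: ses_of_epi.
  have [E [c [v [ec e]]]] := epi_cover l hp.
  have [|w hw] := km _ v; first by rewrite -pcompA e pcompA ql pcomp0f; reflexivity.
  apply: (@epi_cancel _ _ _ _ _ w); apply: (epi_heq _ ec).
  by apply: ml; rewrite (pcompA l) hb -pcompA hw e; reflexivity.
split.
- apply: (mono0 ml); rewrite pcompA hb -pcompA ha; exact: pk.
- by apply: (@mono_cancel _ _ _ _ m); apply: (mono_heq _ mk); symmetry.
- move=> T u e; have [|w hw] := kk _ (m ∘ u).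
    by rewrite pcompA -hb -pcompA e pcompf0; reflexivity.
  by exists w; apply: mm; rewrite pcompA ha.
Qed.

End Abelian.

Lemma ext1_opp (C : preadd) (X N : C) : ext1_zero X N -> @ext1_zero (opp C) N X.
Proof.
move=> h E f g /ses_opp sgf; have [s hs] := h _ _ _ sgf.
by have [r hr] := ses_retraction sgf hs; exists r.
Qed.

Lemma extend_ext (C : preadd) (abC : abelian C) (X Y P N : C) (f : phom X Y)
    (q : phom Y P) (u : phom X N) :
  is_mono f -> is_cokernel f q -> ext1_zero P N -> exists v, v ∘ f ≈ u.
Proof.
move=> hf [h1 h2 h3] h.
exact: (@lift_ext (opp C) (abelian_opp abC) _ _ _ _ f q u hf _ (ext1_opp h)).
Qed.

(** * Ext-orthogonal classes *)

Section Orthogonal.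
Variables (C : preadd) (abC : abelian C).
Implicit Types X N : C.

(** Given an extension [F] of [A] by [E], the map [e : E -> L] extends to [v] on [F] because
    [Ext(A, L) = 0]. The kernel of [v] is an extension of [A] by [K], and a section of it is a
    section of [F]. *)
Lemma rorth_ext (P : C -> Prop) : ext_closed (rorth P).
Proof.
move=> K E L k e se hK hL A PA F f g sf.
have [[ek mk kk] [_ ee ce]] := se; have [[gf mf kf] [_ eg cg]] := sf.
have [v vf] : exists v : phom F L, v ∘ f ≈ e := extend_ext abC _ mf (proj2 sf) (hL _ PA).
have [G [m [vm mm km]]] := ab_ker abC v.
have [|k' hk'] := km _ (f ∘ k); first by rewrite pcompA vf ek; reflexivity.
have sG : ses k' (g ∘ m).
  apply: (ses_of_epi abC).
    have [T [c [y [ec ye]]]] := epi_cover abC v ee.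
    have [|w hw] := km _ (c ⊞ ⊟ (f ∘ y)).
      by rewrite pcompDr pcompfN pcompA vf ye eaddN; reflexivity.
    apply: (@epi_cancel _ _ _ _ _ w).
    apply: (@epi_heq _ _ _ (g ∘ c)); last exact: epi_comp.
    by rewrite -pcompA hw pcompDr pcompfN pcompA gf pcomp0f eopp0 eadd0; reflexivity.
  split.
  - by rewrite -pcompA hk' pcompA gf pcomp0f; reflexivity.
  - apply: (@mono_cancel _ _ _ _ m); apply: (@mono_heq _ _ _ (f ∘ k)).
      by symmetry.
    exact: mono_comp.
  - move=> T u; rewrite -pcompA => /kf[x fx].
    have [|w kw] := kk _ x.
      by rewrite -vf -pcompA fx pcompA vm pcomp0f; reflexivity.
    by exists w; apply: mm; rewrite pcompA hk' -fx -kw pcompA; reflexivity.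
have [s hs] := hK _ PA _ _ _ sG.
by exists (m ∘ s); rewrite pcompA.
Qed.

Lemma ext1_zero_retraction X N : ext1_zero X N <->
  forall E (f : phom N E) (g : phom E X), ses f g -> exists r, r ∘ f ≈ pid N.
Proof.
split=> h E f g sfg; have [s hs] := h _ _ _ sfg.
  exact: ses_retraction sfg hs.
exact: ses_section sfg hs.
Qed.

(** The 3x3 lemma for the square [t j = i q]. *)
Lemma coker_filtration (X Y P A Z N K L : C) (i : phom X Y) (y : phom Y P)
    (q : phom A X) (k : phom K A) (t : phom Z Y) (l : phom L Z)
    (j : phom A Z) (n : phom Z N) :
  is_mono i -> is_cokernel i y -> is_epi q -> is_kernel q k ->
  is_epi t -> is_kernel t l -> is_mono j -> is_cokernel j n ->
  t ∘ j ≈ i ∘ q ->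
  exists M (a : phom K L) (b : phom L M) (c : phom M N) (d : phom N P),
    ses a b /\ ses c d.
Proof.
move=> hi hy hq [qk mk kk] ht [tl ml kl] hj hn e.
have [_ _ iK] := ab_mono abC hi hy; have [nj nn jK] := ab_mono abC hj hn.
have [yi ey yK] := hy; have [_ en nK] := hn.
have [|d hd] := nK _ (y ∘ t).
  by rewrite -pcompA e pcompA yi pcomp0f; reflexivity.
have [M [c hc]] := ab_ker abC d; have [dc mc cK] := hc.
have [|a ha] := kl _ (j ∘ k).
  by rewrite pcompA e -pcompA qk pcompf0; reflexivity.
have [|b hb] := cK _ (n ∘ l).
  by rewrite pcompA hd -pcompA tl pcompf0; reflexivity.
have ed : is_epi d.
  by apply: (@epi_cancel _ _ _ _ _ n); apply: (@epi_heq _ _ _ (y ∘ t));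
    [symmetry | apply: epi_comp].
exists M, a, b, c, d; split; last exact: ses_of_epi.
apply: (ses_of_epi abC).
  have [E [f [z [ef ez]]]] := epi_cover abC c en.
  have [|x hx] := iK _ (t ∘ z).
    by rewrite pcompA -hd -pcompA ez pcompA dc pcomp0f; reflexivity.
  have [E' [f' [w [ef' ew]]]] := epi_cover abC x hq.
  have [|v hv] := kl _ (z ∘ f' ⊞ ⊟ (j ∘ w)).
    rewrite pcompDr pcompfN !pcompA e -hx -!pcompA ew; exact: eaddN.
  apply: (@epi_cancel _ _ _ _ _ v); apply: (@epi_heq _ _ _ (f ∘ f')).
    apply: mc; rewrite !pcompA -ez hb -(pcompA n l) hv pcompDr pcompfN.
    by rewrite (pcompA n j) nj pcomp0f eopp0 eadd0 pcompA; reflexivity.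
  exact: epi_comp.
split.
- by apply: (mono0 mc); rewrite pcompA hb -pcompA ha pcompA nj pcomp0f; reflexivity.
- apply: (@mono_cancel _ _ _ _ l); apply: (@mono_heq _ _ _ (j ∘ k)).
    by symmetry.
  exact: mono_comp.
- move=> T u bu; have [|v hv] := jK _ (l ∘ u).
    by rewrite pcompA -hb -pcompA bu pcompf0; reflexivity.
  have [|w hw] := kk _ v.
    by apply: (mono0 hi); rewrite pcompA -e -pcompA hv pcompA tl pcomp0f; reflexivity.
  by exists w; apply: ml; rewrite pcompA ha -pcompA hw hv; reflexivity.
Qed.

End Orthogonal.

Lemma lorth_ext (C : preadd) (abC : abelian C) (P : C -> Prop) :
  ext_closed (lorth P).
Proof.
move=> K E L k e /ses_opp se hK hL N PN; apply: (@ext1_opp (opp C)).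
by apply: (rorth_ext (abelian_opp abC) se _ _ PN) => Z PZ;
  apply: ext1_opp; [apply: hL | apply: hK].
Qed.

Lemma composite_mono_ses (C : preadd) (abC : abelian C) (X Y Z K L M : C)
    (p : phom X Y) (q : phom Y Z) (k : phom Y K) (l : phom Z L) (m : phom Z M) :
  is_mono p -> is_mono q -> is_cokernel p k -> is_cokernel q l ->
  is_cokernel (q ∘ p) m ->
  exists (a : phom K M) (b : phom M L), ses a b.
Proof.
move=> hp hq [k1 k2 k3] [l1 l2 l3] [m1 m2 m3].
have [] := @composite_epi_ses _ (abelian_opp abC) Z Y X q p _ l _ k _ m hq hp.
- by split.
- by split.
- by split.
by move=> a [b /(ses_opp (C := opp C)) s]; exists b, a; case: s => -[? ? ?] [? ? ?].
Qed.

Lemma pushout (C : preadd) (abC : abelian C) (X Y A : C) (f : phom Y X)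
    (u : phom Y A) :
  exists E (a : phom X E) (b : phom A E),
  [/\ a ∘ f ≈ b ∘ u,
      forall T (s : phom X T) (t : phom A T), s ∘ f ≈ t ∘ u ->
        exists w, w ∘ a ≈ s /\ w ∘ b ≈ t,
      forall T (s t : phom E T), s ∘ a ≈ t ∘ a -> s ∘ b ≈ t ∘ b -> s ≈ t
    & is_mono f -> is_mono b].
Proof. exact: (@pullback _ (abelian_opp abC) X Y A f u). Qed.

(** * The homotopy category of a Hovey triple *)

Section Hovey.
Variables (C : preadd) (abC : abelian C) (Q W R : C -> Prop).
Hypothesis hQWR : hovey_triple Q W R.
Implicit Types X Y Z A B K N T : C.

Let M := hovey_model Q W R.

Let thickW : thick W := let: And3 h _ _ := hQWR in h.

Lemma cof_tfib_ext A K : Q A -> both R W K -> ext1_zero A K.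
Proof. by case: hQWR => _ [[h _] _ _] _ /h; apply. Qed.

Lemma tcof_fib_ext P N : both Q W P -> R N -> ext1_zero P N.
Proof. by case: hQWR => _ _ [[h _] _ _] /h; apply. Qed.

Lemma cofE A : Q A <-> lorth (both R W) A.
Proof. by case: hQWR => _ [[]]. Qed.

Lemma tcofE A : both Q W A <-> lorth R A.
Proof. by case: hQWR => _ _ [[]]. Qed.

Lemma fibE A : R A <-> rorth (both Q W) A.
Proof. by case: hQWR => _ _ [[]]. Qed.

Lemma tfibE A : both R W A <-> rorth Q A.
Proof. by case: hQWR => _ [[]]. Qed.

Lemma cof_ext : ext_closed Q.
Proof.
by move=> A X B f g s /cofE hA /cofE hB; apply/cofE; apply: lorth_ext s hA hB.
Qed.

Lemma tcof_ext : ext_closed (both Q W).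
Proof.
by move=> A X B f g s /tcofE hA /tcofE hB; apply/tcofE; apply: lorth_ext s hA hB.
Qed.

Lemma fib_ext : ext_closed R.
Proof.
by move=> A X B f g s /fibE hA /fibE hB; apply/fibE; apply: rorth_ext s hA hB.
Qed.

Lemma tfib_ext : ext_closed (both R W).
Proof.
by move=> A X B f g s /tfibE hA /tfibE hB; apply/tfibE; apply: rorth_ext s hA hB.
Qed.

Definition bifib : C -> Prop := both (both Q R) W.

Lemma bifib_ext : ext_closed bifib.
Proof.
move=> A X B f g s [[qA rA] wA] [[qB rB] wB]; have [qX wX] : both Q W X.
  by apply: tcof_ext s _ _; split.
by do !split=> //; apply: fib_ext s _ _.
Qed.

Lemma zero_bifib Z : pid Z ≈ ezero -> bifib Z.
Proof.
move=> z; have zl P : lorth P Z.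
  move=> N _ E f g _; exists ezero; rewrite pcompf0 z; reflexivity.
have zr P : rorth P Z.
  by move=> N _; apply/ext1_zero_retraction => E f g _; exists ezero; rewrite pcomp0f z; reflexivity.
have [h1 _] : both Q W Z by apply/tcofE.
have [h2 h3] : both R W Z by apply/tfibE.
by [].
Qed.

Lemma bip_bifib X Y B (i1 : phom X B) (i2 : phom Y B) (p1 : phom B X)
    (p2 : phom B Y) : biproduct i1 i2 p1 p2 -> bifib X -> bifib Y -> bifib B.
Proof. by move=> /bip_ses; apply: bifib_ext. Qed.

Lemma tfib_id X : epi_with_ker (both R W) (pid X).
Proof.
split; first by move=> T u v; rewrite !pcompf1.
have [Z hZ] := ab_zero abC; exists Z, ezero; split.
  split; first exact: pcompf0.
    by move=> T u v _; rewrite -(pcomp1f u) -(pcomp1f v) hZ !pcomp0f; reflexivity.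
  by move=> T u; rewrite pcomp1f => e; exists ezero; rewrite e; apply: pcompf0.
by have [[_ ?] ?] := zero_bifib hZ.
Qed.

Lemma tcof_id X : mono_with_coker (both Q W) (pid X).
Proof.
split; first by move=> T u v; rewrite !pcomp1f.
have [Z hZ] := ab_zero abC; exists Z, ezero; split.
  split; first exact: pcomp0f.
    by move=> T u v _; rewrite -(pcompf1 u) -(pcompf1 v) hZ !pcompf0; reflexivity.
  by move=> T u; rewrite pcompf1 => e; exists ezero; rewrite e; apply: pcomp0f.
by have [[? _] ?] := zero_bifib hZ.
Qed.

Lemma weq_tcof X Y (f : phom X Y) : tcofib M f -> weq M f.
Proof.
move=> h; exists Y, f, (pid Y); split=> //; first exact: tfib_id.
by symmetry; apply: pcomp1f.
Qed.

Lemma weq_tfib X Y (f : phom X Y) : tfib M f -> weq M f.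
Proof.
move=> h; exists X, (pid X), f; split=> //; first exact: tcof_id.
by symmetry; apply: pcompf1.
Qed.

(** * Maps modulo those that factor through a trivial bifibrant object *)

Definition onull X Y (f : phom X Y) : Prop :=
  exists Z (a : phom X Z) (b : phom Z Y), bifib Z /\ f ≈ b ∘ a.

Definition omeq X Y (f g : phom X Y) : Prop := onull (f ⊞ ⊟ g).

Lemma onull_heq X Y (f g : phom X Y) : f ≈ g -> onull f -> onull g.
Proof. by move=> e [Z [a [b [h e']]]]; exists Z, a, b; rewrite -e. Qed.

Lemma onull0 X Y : onull (ezero : phom X Y).
Proof.
have [Z hZ] := ab_zero abC; exists Z, ezero, ezero; split; first exact: zero_bifib.
by symmetry; apply: pcompf0.
Qed.

Lemma onullD X Y (f g : phom X Y) : onull f -> onull g -> onull (f ⊞ g).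
Proof.
move=> [Z [a [b [h e]]]] [Z' [a' [b' [h' e']]]].
have [B [i1 [i2 [p1 [p2 hB]]]]] := ab_bip abC Z Z'; have [h1 h2 h12 h21 _] := hB.
exists B, (i1 ∘ a ⊞ i2 ∘ a'), (b ∘ p1 ⊞ b' ∘ p2); split.
  exact: bip_bifib hB _ _.
rewrite pcompDr !pcompDl -!pcompA !(pcompA p1) !(pcompA p2) h1 h2 h12 h21.
by rewrite !pcomp0f !pcomp1f !pcompf0 eadd0 e0add e e'; reflexivity.
Qed.

Lemma onullN X Y (f : phom X Y) : onull f -> onull (⊟ f).
Proof.
move=> [Z [a [b [h e]]]]; exists Z, a, (⊟ b); split=> //.
by rewrite pcompNf e; reflexivity.
Qed.

Lemma onull_compl X Y T (g : phom Y T) (f : phom X Y) : onull f -> onull (g ∘ f).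
Proof.
move=> [Z [a [b [h e]]]]; exists Z, a, (g ∘ b); split=> //.
by rewrite e pcompA; reflexivity.
Qed.

Lemma onull_compr X Y T (g : phom Y T) (f : phom X Y) : onull g -> onull (g ∘ f).
Proof.
move=> [Z [a [b [h e]]]]; exists Z, (a ∘ f), b; split=> //.
by rewrite e pcompA; reflexivity.
Qed.

#[local] Instance omeq_equiv X Y : Equivalence (@omeq X Y).
Proof.
split.
- by move=> f; apply: (onull_heq _ (onull0 X Y)); rewrite eaddN; reflexivity.
- by move=> f g /onullN; apply: onull_heq; abel.
- by move=> f g h fg gh; apply: onull_heq (onullD fg gh); abel.
Qed.

#[local] Instance omeq_comp X Y T : Proper (@omeq Y T ==> @omeq X Y ==> @omeq X T) (@pcomp C X Y T).
Proof.
move=> g g' hg f f' hf; apply: onull_heq (onullD (onull_compr f hg) (onull_compl g' hf)).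
by rewrite pcompDl pcompDr pcompNf pcompfN; abel.
Qed.

#[local] Instance omeq_sub X Y : subrelation (@eeq (phom X Y)) (@omeq X Y).
Proof. by move=> f g /eq_esub e; apply: (onull_heq _ (onull0 X Y)); symmetry. Qed.

Local Notation "f ≃ g" := (omeq f g) (at level 70).

(** A special precover [Z] of [K], cofibrant and with trivially fibrant kernel [K'], is an extension
    of [K] by [K'] and hence trivially fibrant too; [w] lifts to [Z] since [Ext(A, K') = 0]. *)
Lemma cof_to_tfib_null A K (w : phom A K) : Q A -> both R W K -> onull w.
Proof.
move=> qA hK; have [_ [_ h _] _] := hQWR.
have [K' [Z [f [g [s qZ hK']]]]] := h K.
have hZ : both R W Z by apply: tfib_ext s _ _.
have [v hv] := lift_ext abC w (ses_epi s) (proj1 s) (cof_tfib_ext qA hK').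
by exists Z, v, g; split; [case: hZ | symmetry].
Qed.

Lemma tcof_to_fib_null P N (w : phom P N) : both Q W P -> R N -> onull w.
Proof.
move=> hP rN; have [_ _ [_ _ h]] := hQWR.
have [Z [D [f [g [s hD rZ]]]]] := h P.

have [qz wz] : both Q W Z by apply: tcof_ext s _ _.
have [v hv] := extend_ext abC w (ses_mono s) (proj2 s) (tcof_fib_ext hD rN).
by exists Z, f, v; split; [ | symmetry].
Qed.

(** The null map [p (u - v)] lifts along [p] to a null map; the rest of [u - v] lands in the kernel
    of [p], where [cof_to_tfib_null] applies. *)
Lemma tfib_omeq X Y A (p : phom X Y) (u v : phom A X) :
  epi_with_ker (both R W) p -> Q A -> p ∘ u ≃ p ∘ v -> u ≃ v.
Proof.
move=> [ep [K [k [hk hK]]]] qA [Z [a [b [hZ e]]]]; have [_ _ kk] := hk.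
have [|b' hb] := lift_ext abC b ep hk (cof_tfib_ext _ hK).
  by case: hZ => -[].
have [|w hw] := kk _ (u ⊞ ⊟ v ⊞ ⊟ (b' ∘ a)).
  rewrite !pcompDr !pcompfN e pcompA hb; exact: eaddN.
have nb : onull (b' ∘ a) by exists Z, a, b'; split=> //; reflexivity.
apply: (onull_heq _ (onullD (onull_compl k (cof_to_tfib_null w qA hK)) nb)).
by rewrite hw; abel.
Qed.

Lemma tcof_omeq A B T (r : phom A B) (u v : phom B T) :
  mono_with_coker (both Q W) r -> R T -> u ∘ r ≃ v ∘ r -> u ≃ v.
Proof.
move=> [ep [K [k [hk hK]]]] rT [Z [a [b [hZ e]]]]; have [_ _ kk] := hk.
have [|a' ha] := extend_ext abC a ep hk (tcof_fib_ext hK _).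
  by case: hZ => -[].
have [|w hw] := kk _ (u ⊞ ⊟ v ⊞ ⊟ (b ∘ a')).
  rewrite !pcompDl !pcompNf e -pcompA ha; exact: eaddN.
have nb : onull (b ∘ a') by exists Z, a', b; split=> //; reflexivity.
apply: (onull_heq _ (onullD (onull_compr k (tcof_to_fib_null w hK rT)) nb)).
by rewrite hw; abel.
Qed.

(** * Bifibrant replacement *)

Lemma cof_rep_ex X : exists p : {A : C & phom A X},
  Q (projT1 p) /\ epi_with_ker (both R W) (projT2 p).
Proof.
have [_ [_ h _] _] := hQWR; have [K [A [f [g [s qA hK]]]]] := h X.
exists (existT _ A g); split=> //; split; first exact: ses_epi s.
by exists K, f; split=> //; case: s.
Qed.

Lemma fib_rep_ex X : exists p : {A : C & phom X A},
  R (projT1 p) /\ mono_with_coker (both Q W) (projT2 p).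
Proof.
have [_ _ [_ _ h]] := hQWR; have [B [A [f [g [s hB rA]]]]] := h X.
exists (existT _ B f); split=> //; split; first exact: ses_mono s.
by exists A, g; split=> //; case: s.
Qed.

Definition cof_rep X : C := projT1 (witness (cof_rep_ex X)).
Definition cof_map X : phom (cof_rep X) X := projT2 (witness (cof_rep_ex X)).
Definition bif_rep X : C := projT1 (witness (fib_rep_ex (cof_rep X))).
Definition bif_map X : phom (cof_rep X) (bif_rep X) :=
  projT2 (witness (fib_rep_ex (cof_rep X))).

Lemma cof_rep_cof X : Q (cof_rep X).
Proof. by have [] := witnessP (cof_rep_ex X). Qed.
Lemma cof_map_tfib X : epi_with_ker (both R W) (cof_map X).
Proof. by have [] := witnessP (cof_rep_ex X). Qed.
Lemma bif_map_tcof X : mono_with_coker (both Q W) (bif_map X).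
Proof. by have [] := witnessP (fib_rep_ex (cof_rep X)). Qed.
Lemma bif_rep_fib X : R (bif_rep X).
Proof. by have [] := witnessP (fib_rep_ex (cof_rep X)). Qed.

Lemma bif_rep_core X : both Q R (bif_rep X).
Proof.
split; last exact: bif_rep_fib.
have [mf [N [n [hn [qN _]]]]] := bif_map_tcof X.
by apply: cof_ext (ses_of_mono abC mf hn) (cof_rep_cof X) qN.
Qed.

Lemma tfib_lift X Y A (p : phom X Y) (u : phom A Y) :
  epi_with_ker (both R W) p -> Q A -> exists v, p ∘ v ≈ u.
Proof. by move=> [ep [K [k [hk hK]]]] qA; apply: lift_ext ep hk (cof_tfib_ext qA hK). Qed.

Lemma tcof_extend X Y T (i : phom X Y) (u : phom X T) :
  mono_with_coker (both Q W) i -> R T -> exists v, v ∘ i ≈ u.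
Proof. by move=> [mi [K [k [hk hK]]]] rT; apply: extend_ext mi hk (tcof_fib_ext hK rT). Qed.

(** The action of bifibrant replacement on morphisms, as a relation: the lift [m] and the extension
    [g] are unique only up to null maps. *)
Definition companion X Y (f : phom X Y) (g : phom (bif_rep X) (bif_rep Y)) : Prop :=
  exists m, cof_map Y ∘ m ≈ f ∘ cof_map X /\ g ∘ bif_map X ≈ bif_map Y ∘ m.

Lemma companion_ex X Y (f : phom X Y) : exists g, companion f g.
Proof.
have [m hm] := tfib_lift (f ∘ cof_map X) (cof_map_tfib Y) (cof_rep_cof X).
have [g hg] := tcof_extend (bif_map Y ∘ m) (bif_map_tcof X) (bif_rep_fib Y).
by exists g, m.
Qed.

Lemma companion_comp X Y Z (g : phom Y Z) (f : phom X Y) g' f' :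
  companion g g' -> companion f f' -> companion (g ∘ f) (g' ∘ f').
Proof.
move=> [m [h1 h2]] [n [h3 h4]]; exists (m ∘ n); split.
  by rewrite pcompA h1 -pcompA h3 pcompA; reflexivity.
by rewrite -pcompA h4 pcompA h2 -pcompA; reflexivity.
Qed.

Lemma companion_id X : companion (pid X) (pid (bif_rep X)).
Proof. by exists (pid _); rewrite !pcomp1f !pcompf1; split; reflexivity. Qed.

Lemma companion_uniq X Y (f f' : phom X Y) g g' :
  f ≃ f' -> companion f g -> companion f' g' -> g ≃ g'.
Proof.
move=> ff' [m [h1 h2]] [m' [h1' h2']].
apply: (tcof_omeq (bif_map_tcof X) (bif_rep_fib Y)); rewrite h2 h2'.
apply: omeq_comp; first reflexivity.
apply: (tfib_omeq (cof_map_tfib Y) (cof_rep_cof X)); rewrite h1 h1'.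
by apply: omeq_comp => //; reflexivity.
Qed.

(** [cof_map Y] lifts along [p] and then along [cof_map X]; uniqueness of lifts makes the resulting
    [s] inverse to [m] up to null maps. *)
Lemma tfib_companion X Y (p : phom X Y) g : epi_with_ker (both R W) p ->
  companion p g -> exists h, h ∘ g ≃ pid _ /\ g ∘ h ≃ pid _.
Proof.
move=> hp cg; have [m [h1 h2]] := cg.
have [s0 hs0] := tfib_lift (cof_map Y) hp (cof_rep_cof Y).
have [s hs] := tfib_lift s0 (cof_map_tfib X) (cof_rep_cof Y).
have [h hh] := tcof_extend (bif_map X ∘ s) (bif_map_tcof Y) (bif_rep_fib X).
exists h; split; last first.
  apply: (companion_uniq (f := pid Y) (f' := pid Y)); first reflexivity.
    exists (m ∘ s); split.
      by rewrite pcompA h1 -pcompA hs hs0 pcomp1f; reflexivity.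
    by rewrite -pcompA hh pcompA h2 -pcompA; reflexivity.
  exact: companion_id.
apply: (tcof_omeq (bif_map_tcof X) (bif_rep_fib X)).
rewrite -pcompA h2 pcompA hh -pcompA pcomp1f -{2}(pcompf1 (bif_map X)).
apply: omeq_comp; first reflexivity.
apply: (tfib_omeq (cof_map_tfib X) (cof_rep_cof X)).
apply: (tfib_omeq hp (cof_rep_cof X)); apply: omeq_sub.
by rewrite (pcompA (cof_map X) s m) hs pcompA hs0 pcompf1 h1; reflexivity.
Qed.

(** Together, [f] and the replacement map give an epimorphism from the biproduct of [X] and
    [cof_rep Y] to [Y]. Pushing out along a special preenvelope [L -> L'] of its kernel replaces
    that kernel by a trivially fibrant one. The cokernel of [X -> E] is then an extension of the
    cofibrant objects [D] and [cof_rep Y]. *)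
Lemma cof_tfib_factor X Y (f : phom X Y) : Q X ->
  exists Z (j : phom X Z) (t : phom Z Y),
    [/\ t ∘ j ≈ f, mono_with_coker Q j, epi_with_ker (both R W) t & Q Z].
Proof.
move=> qX; have [B [i1 [i2 [p1 [p2 hB]]]]] := ab_bip abC X (cof_rep Y).
have [h1 h2 h12 h21 _] := hB.
pose g := f ∘ p1 ⊞ cof_map Y ∘ p2.
have eg : is_epi g.
  apply: (@epi_cancel _ _ _ _ _ i2); apply: (epi_heq _ (proj1 (cof_map_tfib Y))).
  by rewrite pcompDl -!pcompA h12 h2 pcompf0 e0add pcompf1; reflexivity.
have gi1 : g ∘ i1 ≈ f.
  by rewrite pcompDl -!pcompA h1 h21 pcompf0 eadd0 pcompf1; reflexivity.
have [L [l hl]] := ab_ker abC g; have [gl ml _] := hl.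
have [_ _ gc] := ab_epi abC eg hl.
have [_ [_ _ hh] _] := hQWR; have [L' [D [e [d [se qD hL']]]]] := hh L.
have [E [b [a [ae ue je ma]]]] := pushout abC e l.
have ma' := ma (ses_mono se).
have [|t [tb ta]] := ue _ ezero g; first by rewrite pcomp0f gl; reflexivity.
have [|d' [d'b d'a]] := ue _ d ezero.
  by rewrite pcomp0f (ses0 se); reflexivity.
have [_ [de dep dc]] := se.
(* A pushout keeps the cokernel: that of [a] is the cofibrant object [D]. *)
have cd' : is_cokernel a d'.
  split=> //.
    by apply: (@epi_cancel _ _ _ _ _ b); apply: (@epi_heq _ _ _ d); [symmetry|].
  move=> T u ua; have [|w hw] := dc _ (u ∘ b).
    by rewrite -pcompA ae pcompA ua pcomp0f; reflexivity.
  exists w; apply: je; first by rewrite -pcompA d'b.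
  by rewrite -pcompA d'a ua pcompf0; reflexivity.
have mb : is_mono b.
  apply: mono_of0 => T x bx; have [y hy] : exists y, e ∘ y ≈ x.
    have [[_ _ ke] _] := se; apply: ke.
    by rewrite -d'b -pcompA bx pcompf0; reflexivity.
  rewrite -hy; suff -> : y ≈ ezero by rewrite pcompf0; reflexivity.
  apply: (mono0 (mono_comp ma' ml)).
  by rewrite -ae -pcompA hy.
have et : is_epi t.
  by apply: (@epi_cancel _ _ _ _ _ a); apply: (@epi_heq _ _ _ g); [symmetry|].
(* As [b] is a monomorphism, this makes [L'] the kernel of [t]. *)
have ct : is_cokernel b t.
  split=> // T u ub; have [|w hw] := gc _ (u ∘ a).
    by rewrite -pcompA -ae pcompA ub pcomp0f; reflexivity.
  exists w; apply: je; first by rewrite -pcompA tb ub pcompf0; reflexivity.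
  by rewrite -pcompA ta.

have mi1 : is_mono i1 := ses_mono (bip_ses hB).
have [N [n hn]] := ab_cok abC (a ∘ i1).
have [? [? sN]] := composite_mono_ses abC mi1 ma' (proj2 (bip_ses hB)) cd' hn.
have qB : Q B := cof_ext (bip_ses hB) qX (cof_rep_cof Y).
exists E, (a ∘ i1), t; split.
- by rewrite pcompA ta.
- split; first exact: mono_comp.
  by exists N, n; split=> //; apply: cof_ext sN (cof_rep_cof Y) _.
- by split=> //; exists L', b; split=> //; apply: ab_mono.
- by apply: cof_ext (ses_of_mono abC ma' cd') qB _.
Qed.

(** In the factorization [t j] of [cof_map X] followed by [i], the map [j] is a trivial cofibration:
    [coker_filtration] builds its cokernel from the kernels of [cof_map X] and [t] and the cokernel
    of [i], all in [W]. Since [Z] and [cof_rep Y] are cofibrant and lie over [Y] by trivial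
    fibrations, they agree up to null maps, and inverting the companion of [i] amounts to extending
    along [j]. *)
Lemma tcof_companion X Y (i : phom X Y) g : mono_with_coker (both Q W) i ->
  companion i g -> exists h, h ∘ g ≃ pid _ /\ g ∘ h ≃ pid _.
Proof.
move=> hi cg.
have [Z [j [t [tj hj ht qZ]]]] := cof_tfib_factor (i ∘ cof_map X) (cof_rep_cof X).
have hj' : mono_with_coker (both Q W) j.
  have [mj [N [n [hn qN]]]] := hj; split=> //; exists N, n; split=> //; split=> //.
  have [mi [P [y [hy [_ wP]]]]] := hi.
  have [eq [K [k [hk [_ wK]]]]] := cof_map_tfib X.
  have [et [L [l [hl [_ wL]]]]] := ht.
  have [N' [a [b [c [d [s1 s2]]]]]] := coker_filtration abC mi hy eq hk et hl mj hn tj.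
  have [_ th] := thickW; have [wN _ _] := th _ _ _ _ _ s1.
  by have [_ h _] := th _ _ _ _ _ s2; apply: h => //; apply: wN.
have [s hs] := tfib_lift t (cof_map_tfib Y) qZ.
have [s' hs'] := tfib_lift (cof_map Y) ht (cof_rep_cof Y).
have ss' : s ∘ s' ≃ pid _.
  apply: (tfib_omeq (cof_map_tfib Y) (cof_rep_cof Y)); apply: omeq_sub.
  by rewrite pcompA hs hs' pcompf1; reflexivity.
have s's : s' ∘ s ≃ pid _.
  apply: (tfib_omeq ht qZ); apply: omeq_sub.
  by rewrite pcompA hs' hs pcompf1; reflexivity.
have hg : g ∘ bif_map X ≃ bif_map Y ∘ (s ∘ j).
  have [m [h1 h2]] := cg; rewrite h2; apply: omeq_comp; first reflexivity.
  apply: (tfib_omeq (cof_map_tfib Y) (cof_rep_cof X)); apply: omeq_sub.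
  by rewrite h1 pcompA hs tj; reflexivity.
have [k hk] := tcof_extend (bif_map X) hj' (bif_rep_fib X).
have [h hh] := tcof_extend (k ∘ s') (bif_map_tcof Y) (bif_rep_fib X).
exists h; split.
  apply: (tcof_omeq (bif_map_tcof X) (bif_rep_fib X)).
  rewrite -pcompA hg pcompA hh -pcompA (pcompA s') s's !pcomp1f hk; reflexivity.
apply: (tcof_omeq (bif_map_tcof Y) (bif_rep_fib Y)).
have gk : g ∘ k ≃ bif_map Y ∘ s.
  apply: (tcof_omeq hj' (bif_rep_fib Y)).
  by rewrite -pcompA hk hg pcompA; reflexivity.
by rewrite -pcompA hh pcompA gk -pcompA ss' pcomp1f pcompf1; reflexivity.
Qed.

End Hovey.

(** * The homotopy category as a stable category *)

(** In the biproduct [i1] and [i1 + i2 a] are both sections of [p1], so [T] identifies them;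
    followed by [g p1 + b p2] they become [g] and [f]. *)
Lemma null_inverted (C : preadd) (abC : abelian C) (E : category)
    (T : functor (pcat C) E) (X Y Z : C) (f g : phom X Y) (a : phom X Z)
    (b : phom Z Y) :
  (forall B (i1 : phom X B) (i2 : phom Z B) (p1 : phom B X) (p2 : phom B Z),
     biproduct i1 i2 p1 p2 -> @iso E _ _ (fmap T p1)) ->
  f ⊞ ⊟ g ≈ b ∘ a -> @heq E _ _ (fmap T f) (fmap T g).
Proof.
move=> TP e.
have [B [i1 [i2 [p1 [p2 hB]]]]] := ab_bip abC X Z; have [h1 h2 h12 h21 _] := hB.
have ip : iso (fmap T (p1 : @hom (pcat C) B X)) := TP _ _ _ _ _ hB.
have ei : fmap T (i1 ⊞ i2 ∘ a : @hom (pcat C) X B) ≡ fmap T (i1 : @hom (pcat C) X B).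
  apply: (iso_mono ip); rewrite -!fmapM; apply: fmap_proper.
  change (p1 ∘ (i1 ⊞ i2 ∘ a) ≈ p1 ∘ i1).
  by rewrite pcompDr pcompA h12 pcomp0f eadd0; reflexivity.
pose h : @hom (pcat C) B Y := g ∘ p1 ⊞ b ∘ p2.
transitivity (fmap T h ⊙ fmap T (i1 ⊞ i2 ∘ a : @hom (pcat C) X B)).
  rewrite -fmapM; apply: fmap_proper.
  change (f ≈ (g ∘ p1 ⊞ b ∘ p2) ∘ (i1 ⊞ i2 ∘ a)).
  rewrite pcompDr !pcompDl -!pcompA h1 h21 !(pcompA p1) h12 (pcompA p2) h2.
  rewrite !pcompf0 pcomp0f pcomp1f !pcompf0 pcompf1 -e.
  abel.
rewrite ei -fmapM; apply: fmap_proper; change ((g ∘ p1 ⊞ b ∘ p2) ∘ i1 ≈ g).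
by rewrite pcompDl -!pcompA h1 h21 pcompf0 pcompf1 eadd0; reflexivity.
Qed.

(** The injection [i1] has cokernel [Z], so it is inverted, and [p1] with it, being a retraction of
    [i1]. *)
Lemma null_inverted_mono (C : preadd) (abC : abelian C) (E : category)
    (T : functor (pcat C) E) (P : C -> Prop) :
  (forall X Y (i : phom X Y), mono_with_coker P i -> @iso E _ _ (fmap T i)) ->
  forall X Y Z (f g : phom X Y) (a : phom X Z) (b : phom Z Y),
    P Z -> f ⊞ ⊟ g ≈ b ∘ a -> @heq E _ _ (fmap T f) (fmap T g).
Proof.
move=> TP X Y Z f g a b PZ; apply: null_inverted => // B i1 i2 p1 p2 hB.
have [h1 h2 h12 h21 _] := hB.
apply: (iso_retraction (f := fmap T (i1 : @hom (pcat C) X B))).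
  apply: TP; split; first exact: split_mono h1.
  by exists Z, p2; split=> //; case: (bip_ses hB).
by rewrite -fmapM -fmap1; apply: fmap_proper.
Qed.

Lemma null_inverted_epi (C : preadd) (abC : abelian C) (E : category)
    (T : functor (pcat C) E) (P : C -> Prop) :
  (forall X Y (p : phom X Y), epi_with_ker P p -> @iso E _ _ (fmap T p)) ->
  forall X Y Z (f g : phom X Y) (a : phom X Z) (b : phom Z Y),
    P Z -> f ⊞ ⊟ g ≈ b ∘ a -> @heq E _ _ (fmap T f) (fmap T g).
Proof.
move=> TP X Y Z f g a b PZ; apply: null_inverted => // B i1 i2 p1 p2 hB.
have [h1 h2 h12 h21 _] := hB.
apply: TP; split; first exact: split_epi h1.
by exists Z, i2; split=> //; case: (bip_ses (bip_sym hB)).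
Qed.

Section Stable.
Variables (C : preadd) (abC : abelian C) (Q W R N : C -> Prop).
Hypothesis hQWR : hovey_triple Q W R.
(** [N] lies between the trivial bifibrant and the trivially cofibrant objects. This covers both the
    flat cotorsion complexes and the trivial bifibrant objects themselves. *)
Hypothesis bifibN : forall Z, bifib Q W R Z -> N Z.
Hypothesis N_tcof : forall Z, N Z -> both Q W Z.

Notation M := (hovey_model Q W R).
Notation S := (stable_cat (both Q R) N).
Notation "f ≃ g" := (omeq Q W R f g) (at level 70).
Notation cofr := (cof_rep hQWR).
Notation cofm := (cof_map hQWR).
Notation bifr := (bif_rep hQWR).
Notation bifm := (bif_map hQWR).

Let oe X Y : Equivalence (@omeq C Q W R X Y) := omeq_equiv abC hQWR X Y.
#[local] Existing Instance oe.
Let oc X Y T : Proper (@omeq C Q W R Y T ==> @omeq C Q W R X Y ==> @omeq C Q W R X T)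
  (@pcomp C X Y T) := @omeq_comp _ abC _ _ _ hQWR X Y T.
#[local] Existing Instance oc.
Let os X Y : subrelation (@eeq (phom X Y)) (@omeq C Q W R X Y) :=
  @omeq_sub _ abC _ _ _ hQWR X Y.
#[local] Existing Instance os.

Lemma omeq_stable (X Y : S) (f g : phom (sval X) (sval Y)) :
  f ≃ g -> @heq S X Y f g.
Proof.
move=> [Z [a [b [h e]]]]; apply: quot_rel; exists Z, a, b; split=> //.
exact: bifibN.
Qed.

Definition bif_ob (X : C) : S := exist _ (bifr X) (bif_rep_core abC hQWR X).

Definition bif_hom (X Y : C) (f : phom X Y) : phom (bifr X) (bifr Y) :=
  witness (companion_ex abC hQWR f).

Lemma bif_homP (X Y : C) (f : phom X Y) : companion f (bif_hom f).
Proof. exact: witnessP. Qed.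

Program Definition bif_pre : functor (pcat C) S :=
  {| fob := bif_ob; fmap := fun X Y f => bif_hom f |}.
Next Obligation.
move=> X Y f g fg; apply: omeq_stable.
by apply: (companion_uniq abC _ (bif_homP f) (bif_homP g)); apply: os.
Qed.
Next Obligation.
move=> X; apply: omeq_stable.
apply: (companion_uniq abC _ (bif_homP _) (companion_id hQWR X)); reflexivity.
Qed.
Next Obligation.
move=> X Y Z g f; apply: omeq_stable.
apply: (companion_uniq abC _ (bif_homP _) (companion_comp (bif_homP g) (bif_homP f))).
reflexivity.
Qed.

Lemma iso_stable (X Y : S) (f : phom (sval X) (sval Y)) :
  (exists h, h ∘ f ≃ pid _ /\ f ∘ h ≃ pid _) -> @iso S X Y f.
Proof. by move=> [h [e e']]; exists h; split; apply: omeq_stable. Qed.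

Lemma bif_pre_weq (X Y : C) (f : @hom (pcat C) X Y) :
  weq M f -> iso (fmap bif_pre f).
Proof.
move=> [Z [i [p [hi hp e]]]]; apply: (iso_heq (f := fmap bif_pre (p ⊙ i))).
  by apply: fmap_proper; symmetry.
apply: (iso_heq (symmetry (fmapM bif_pre _ _))); apply: iso_comp; apply: iso_stable.
  exact: (tfib_companion abC hp (bif_homP _)).
exact: (tcof_companion abC hi (bif_homP _)).
Qed.

Definition bif : functor (Ho M) S :=
  @loc_lift (pcat C) S (@weq (pcat C) M) bif_pre bif_pre_weq.

Lemma gamma_tcof (X Y : C) (i : @hom (pcat C) X Y) :
  mono_with_coker (both Q W) i -> iso (fmap (gamma M) i).
Proof. by move=> hi; apply: loc_iso; apply: (weq_tcof abC hQWR). Qed.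

Lemma gamma_tfib (X Y : C) (i : @hom (pcat C) X Y) :
  epi_with_ker (both R W) i -> iso (fmap (gamma M) i).
Proof. by move=> hi; apply: loc_iso; apply: (weq_tfib abC hQWR). Qed.

Definition core_gamma : functor (@fullsub (pcat C) (both Q R)) (Ho M) :=
  fcomp (gamma M) (fullsub_incl _).

Lemma core_gammaP (X Y : @fullsub (pcat C) (both Q R)) (f g : hom X Y) :
  stable_rel N f g -> fmap core_gamma f ≡ fmap core_gamma g.
Proof.
move=> [Z [a [b [hZ e]]]].
exact: (null_inverted_mono abC gamma_tcof (N_tcof hZ) e).
Qed.

Definition core_emb : functor S (Ho M) := quot_lift core_gammaP.

Definition gq X : @hom (Ho M) (cofr X) X := fmap (gamma M) (cofm X : @hom (pcat C) _ _).
Definition gr X : @hom (Ho M) (cofr X) (bifr X) :=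
  fmap (gamma M) (bifm X : @hom (pcat C) _ _).

Lemma gq_iso X : iso (gq X).
Proof. by apply: gamma_tfib; apply: cof_map_tfib. Qed.

Lemma gr_iso X : iso (gr X).
Proof. by apply: gamma_tcof; apply: bif_map_tcof. Qed.

Definition theta_map X : @hom (Ho M) (bifr X) X := gq X ⊙ inv (gr_iso X).

Lemma theta_natural (X Y : C) (f : @hom (pcat C) X Y) :
  theta_map Y ⊙ fmap (fcomp core_emb bif) (fmap (gamma M) f)
  ≡ fmap (idf (Ho M)) (fmap (gamma M) f) ⊙ theta_map X.
Proof.
have [m [h1 h2]] := bif_homP f.
apply: (iso_epi (gr_iso X)); rewrite -!ccompA invl ccompf1.
have -> : fmap (fcomp core_emb bif) (fmap (gamma M) f) ⊙ gr X
    ≡ gr Y ⊙ fmap (gamma M) (m : @hom (pcat C) _ _).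
  transitivity (fmap (gamma M) (bif_hom f ∘ bifm X : @hom (pcat C) _ _)).
    by symmetry; apply: (fmapM (gamma M)).
  transitivity (fmap (gamma M) (bifm Y ∘ m : @hom (pcat C) _ _)).
    exact: (fmap_proper (gamma M)).
  exact: (fmapM (gamma M)).
rewrite invlA; transitivity (fmap (gamma M) (cofm Y ∘ m : @hom (pcat C) _ _)).
  by symmetry; apply: (fmapM (gamma M)).
transitivity (fmap (gamma M) (f ∘ cofm X : @hom (pcat C) _ _)).
  exact: (fmap_proper (gamma M)).
exact: (fmapM (gamma M)).
Qed.

Definition theta_nat : nattrans (fcomp core_emb bif) (idf (Ho M)) :=
  @loc_nat (pcat C) (Ho M) (@weq (pcat C) M) (fcomp core_emb bif) (idf (Ho M))
    theta_map theta_natural.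

Lemma theta_iso (X : Ho M) : iso (theta_nat X).
Proof. exact: iso_comp (gq_iso X) (iso_inv (gr_iso X)). Qed.

Definition theta : natiso (fcomp core_emb bif) (idf (Ho M)) := natiso_of theta_iso.

Lemma thetaE X : theta (gamma M X) ⊙ gr X ≡ gq X.
Proof. by rewrite -ccompA invl ccompf1; reflexivity. Qed.

Lemma cof_section_ex (A : C) : Q A -> exists s, cofm A ∘ s ≈ pid A.
Proof. by move=> qA; apply: (tfib_lift abC hQWR (pid A) (cof_map_tfib hQWR A)). Qed.

(** A cofibrant object splits its own replacement map, so this comparison is a morphism of [C], with
    no formal inverse involved. *)
Definition beta_map (A : S) : @hom S A (bif (core_emb A)) :=
  bifm (sval A) ∘ witness (cof_section_ex (proj1 (svalP A))).

Lemma beta_mapE (A : S) :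
  exists2 s, cofm (sval A) ∘ s ≈ pid (sval A) & beta_map A = bifm (sval A) ∘ s.
Proof. by exists (witness (cof_section_ex (proj1 (svalP A)))) => //;
  exact: (witnessP (cof_section_ex _)). Qed.

Lemma beta_natural (A B : S) (f : @hom S A B) :
  beta_map B ⊙ fmap (idf S) f ≡ fmap (fcomp bif core_emb) f ⊙ beta_map A.
Proof.
have [s hs ->] := beta_mapE A; have [t ht ->] := beta_mapE B.
have [m [h1 h2]] := bif_homP f; apply: omeq_stable.
change (bifm (sval B) ∘ t ∘ f ≃ bif_hom f ∘ (bifm (sval A) ∘ s)).
rewrite (pcompA (bif_hom f)) h2 -!pcompA; apply: oc; first reflexivity.
have [qA _] := svalP A.
apply: (tfib_omeq abC hQWR (cof_map_tfib hQWR _) qA); apply: os.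
by rewrite !pcompA ht h1 pcomp1f -pcompA hs pcompf1; reflexivity.
Qed.

Lemma beta_iso (A : S) : iso (beta_map A).
Proof.
have [s hs ->] := beta_mapE A; have [qA rA] := svalP A; apply: iso_stable.
have [h hh] := tcof_extend abC hQWR (cofm (sval A)) (bif_map_tcof hQWR _) rA.
exists h; split; first by rewrite pcompA hh hs; reflexivity.
apply: (tcof_omeq abC hQWR (bif_map_tcof hQWR _) (bif_rep_fib hQWR _)).
rewrite -pcompA hh -pcompA pcomp1f -{2}(pcompf1 (bifm (sval A))).
apply: oc; first reflexivity.
apply: (tfib_omeq abC hQWR (cof_map_tfib hQWR _) (cof_rep_cof hQWR _)); apply: os.
by rewrite pcompA hs pcomp1f pcompf1; reflexivity.
Qed.

Definition beta : natiso (idf S) (fcomp bif core_emb) :=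
  natiso_of (t := @Nattrans S S (idf S) (fcomp bif core_emb) beta_map beta_natural)
    beta_iso.

Lemma core_emb_equivalence : is_equivalence core_emb.
Proof.
exists bif; split; constructor; last exact: theta.
exact: (@Natiso _ _ (fcomp bif core_emb) (idf S) (nbwd beta) beta (nbwdK beta) (nfwdK beta)).
Qed.

(** A triangle identity between [theta] and [beta], through which derived functors are evaluated on
    [theta]. With the isomorphism [bif (gq X)] cancelled it becomes the claim [e], which holds by
    uniqueness of lifts and extensions. *)
Lemma bif_theta (X : C) :
  fmap bif (theta (gamma M X)) ⊙ beta (bif (gamma M X)) ≡ cid (bif (gamma M X)).
Proof.
have e : beta_map (bif_ob X) ⊙ fmap bif_pre (cofm X : @hom (pcat C) _ _)
    ≡ fmap bif_pre (bifm X : @hom (pcat C) _ _).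
  have [s hs ->] := beta_mapE (bif_ob X); apply: omeq_stable.
  change (bifm (bifr X) ∘ s ∘ bif_hom (cofm X) ≃ bif_hom (bifm X)).
  have [m [h1 h2]] := bif_homP (cofm X); have [n [h3 h4]] := bif_homP (bifm X).
  apply: (tcof_omeq abC hQWR (bif_map_tcof hQWR _) (bif_rep_fib hQWR _)).
  rewrite h4 -!pcompA h2; apply: oc; first reflexivity.
  apply: (tfib_omeq abC hQWR (cof_map_tfib hQWR _) (cof_rep_cof hQWR _)).
  rewrite h3 !pcompA hs pcomp1f; apply: oc; first reflexivity.
  by apply: (tfib_omeq abC hQWR (cof_map_tfib hQWR _) (cof_rep_cof hQWR _)); apply: os.
have ig : iso (fmap bif (gr X)) := iso_fmap bif (gr_iso X).
have iq : iso (fmap bif (gq X)) := iso_fmap bif (gq_iso X).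
have et : fmap bif (theta (gamma M X)) ≡ fmap bif (gq X) ⊙ inv ig.
  have -> : fmap bif (theta (gamma M X)) ≡ fmap bif (gq X) ⊙ fmap bif (inv (gr_iso X)).
    exact: (fmapM bif (gq X) (inv (gr_iso X))).
  by rewrite (fmap_inv (gr_iso X) ig); reflexivity.
rewrite et; apply: (iso_epi iq); rewrite -!ccompA.
have -> : beta (bif (gamma M X)) ⊙ fmap bif (gq X) ≡ fmap bif (gr X) by exact: e.
by rewrite invl ccompf1 ccomp1f; reflexivity.
Qed.

End Stable.

(** * The derived adjunction of the identity functor *)

Section Derived.
Variables (C : preadd) (abC : abelian C) (Q1 W1 R1 N1 Q2 W2 R2 : C -> Prop).
Hypothesis h1 : hovey_triple Q1 W1 R1.
Hypothesis h2 : hovey_triple Q2 W2 R2.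
Hypothesis bifibN1 : forall Z, bifib Q1 W1 R1 Z -> N1 Z.
Hypothesis N1_tcof : forall Z, N1 Z -> both Q1 W1 Z.
Hypothesis Q12 : forall X, Q1 X -> Q2 X.
Hypothesis R21 : forall X, R2 X -> R1 X.

Notation N2 := (bifib Q2 W2 R2).
Notation M1 := (hovey_model Q1 W1 R1).
Notation M2 := (hovey_model Q2 W2 R2).
Notation S1 := (stable_cat (both Q1 R1) N1).
Notation S2 := (stable_cat (both Q2 R2) N2).

Let bifibN2 Z : bifib Q2 W2 R2 Z -> N2 Z. Proof. by []. Qed.
Let N2_tcof Z : N2 Z -> both Q2 W2 Z. Proof. by case=> -[]. Qed.

Notation bif1 := (bif abC h1 bifibN1).
Notation bif2 := (bif abC h2 bifibN2).
Notation theta1 := (theta abC h1 bifibN1 N1_tcof).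
Notation theta2 := (theta abC h2 bifibN2 N2_tcof).
Notation emb1 := (core_emb abC h1 N1_tcof).
Notation emb2 := (core_emb abC h2 N2_tcof).
Notation beta1 := (beta abC h1 bifibN1 N1_tcof).
Notation beta2 := (beta abC h2 bifibN2 N2_tcof).
Notation g1 := (gamma M1).
Notation g2 := (gamma M2).
Notation rep1 := (bif_rep h1).
Notation rep2 := (bif_rep h2).

(** The trivially cofibrant objects are left orthogonal to the fibrant ones, so fewer fibrant
    objects leave more of them. *)
Lemma tcof12 X : both Q1 W1 X -> both Q2 W2 X.
Proof. by move/(tcofE h1) => h; apply/(tcofE h2) => N /R21; apply: h. Qed.

Lemma tfib21 X : both R2 W2 X -> both R1 W1 X.
Proof. by move/(tfibE h2) => h; apply/(tfibE h1) => N /Q12; apply: h. Qed.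

Lemma gamma2_tcof1 (X Y : C) (i : @hom (pcat C) X Y) :
  mono_with_coker (both Q1 W1) i -> iso (fmap g2 i).
Proof.
move=> [mi [P [y [hy /tcof12 hP]]]]; apply: (gamma_tcof abC h2); split=> //.
by exists P, y.
Qed.

Lemma gamma1_tfib2 (X Y : C) (i : @hom (pcat C) X Y) :
  epi_with_ker (both R2 W2) i -> iso (fmap g1 i).
Proof.
move=> [mi [P [y [hy /tfib21 hP]]]]; apply: (gamma_tfib abC h1); split=> //.
by exists P, y.
Qed.

Lemma emb12P (X Y : @fullsub (pcat C) (both Q1 R1)) (f g : hom X Y) :
  stable_rel N1 f g ->
  fmap (fcomp g2 (fullsub_incl _)) f ≡ fmap (fcomp g2 (fullsub_incl _)) g.
Proof.
move=> [Z [a [b [/N1_tcof hZ e]]]].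
exact: (null_inverted_mono abC gamma2_tcof1 hZ e).
Qed.

Lemma emb21P (X Y : @fullsub (pcat C) (both Q2 R2)) (f g : hom X Y) :
  stable_rel N2 f g ->
  fmap (fcomp g1 (fullsub_incl _)) f ≡ fmap (fcomp g1 (fullsub_incl _)) g.
Proof.
move=> [Z [a [b [[[_ rZ] wZ] e]]]].
exact: (null_inverted_epi abC gamma1_tfib2 (conj rZ wZ) e).
Qed.

Definition emb12 : functor S1 (Ho M2) := quot_lift emb12P.
Definition emb21 : functor S2 (Ho M1) := quot_lift emb21P.

(** Replacement is bifibrant rather than one-sided so as to pass through the stable categories. The
    surplus step does no harm: trivial cofibrations of the first model are inverted in [Ho M2],
    trivial fibrations of the second in [Ho M1]. *)
Definition left_der : functor (Ho M1) (Ho M2) := fcomp emb12 bif1.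
Definition right_der : functor (Ho M2) (Ho M1) := fcomp emb21 bif2.

Notation q1 X := (cof_map h1 X : @hom (pcat C) _ _).
Notation q2 X := (cof_map h2 X : @hom (pcat C) _ _).
Notation r1 X := (bif_map h1 X : @hom (pcat C) _ _).
Notation r2 X := (bif_map h2 X : @hom (pcat C) _ _).

Lemma r1_iso X : iso (fmap g2 (r1 X)).
Proof. by apply: gamma2_tcof1; apply: bif_map_tcof. Qed.

Lemma q2_iso X : iso (fmap g1 (q2 X)).
Proof. by apply: gamma1_tfib2; apply: cof_map_tfib. Qed.

Definition eps_map (X : C) : hom (left_der (g1 X)) (g2 X) :=
  fmap g2 (q1 X) ⊙ inv (r1_iso X).

Definition eta_map (Y : C) : hom (g1 Y) (right_der (g2 Y)) :=
  fmap g1 (r2 Y) ⊙ inv (q2_iso Y).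

Lemma eps_natural (X Y : C) (f : @hom (pcat C) X Y) :
  eps_map Y ⊙ fmap left_der (fmap g1 f) ≡ fmap g2 f ⊙ eps_map X.
Proof.
have [m [e e']] := bif_homP abC h1 f.
apply: (iso_epi (r1_iso X)); rewrite -!ccompA invl ccompf1.
have -> : fmap left_der (fmap g1 f) ⊙ fmap g2 (r1 X)
    ≡ fmap g2 (r1 Y) ⊙ fmap g2 (m : @hom (pcat C) _ _).
  transitivity (fmap g2 (bif_hom abC h1 f ∘ bif_map h1 X : @hom (pcat C) _ _)).
    by symmetry; apply: (fmapM g2).
  transitivity (fmap g2 (bif_map h1 Y ∘ m : @hom (pcat C) _ _)).
    exact: (fmap_proper g2).
  exact: (fmapM g2).
rewrite invlA; transitivity (fmap g2 (cof_map h1 Y ∘ m : @hom (pcat C) _ _)).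
  by symmetry; apply: (fmapM g2).
transitivity (fmap g2 (f ∘ cof_map h1 X : @hom (pcat C) _ _)).
  exact: (fmap_proper g2).
exact: (fmapM g2).
Qed.

Lemma eta_natural (X Y : C) (f : @hom (pcat C) X Y) :
  eta_map Y ⊙ fmap g1 f ≡ fmap right_der (fmap g2 f) ⊙ eta_map X.
Proof.
have [m [e e']] := bif_homP abC h2 f.
apply: (iso_epi (q2_iso X)); rewrite -!ccompA invl ccompf1.
have -> : fmap g1 f ⊙ fmap g1 (q2 X)
    ≡ fmap g1 (q2 Y) ⊙ fmap g1 (m : @hom (pcat C) _ _).
  transitivity (fmap g1 (f ∘ cof_map h2 X : @hom (pcat C) _ _)).
    by symmetry; apply: (fmapM g1).
  transitivity (fmap g1 (cof_map h2 Y ∘ m : @hom (pcat C) _ _)).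
    by apply: (fmap_proper g1); symmetry.
  exact: (fmapM g1).
rewrite invlA; transitivity (fmap g1 (bif_map h2 Y ∘ m : @hom (pcat C) _ _)).
  by symmetry; apply: (fmapM g1).
transitivity (fmap g1 (bif_hom abC h2 f ∘ bif_map h2 X : @hom (pcat C) _ _)).
  by apply: (fmap_proper g1); symmetry.
exact: (fmapM g1).
Qed.

Definition eps : nattrans (fcomp left_der g1) (fcomp g2 (idf (pcat C))) :=
  @Nattrans (pcat C) (Ho M2) (fcomp left_der g1) (fcomp g2 (idf (pcat C)))
    eps_map eps_natural.

Definition eta : nattrans (fcomp g1 (idf (pcat C))) (fcomp right_der g2) :=
  @Nattrans (pcat C) (Ho M1) (fcomp g1 (idf (pcat C))) (fcomp right_der g2)
    eta_map eta_natural.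

Lemma eps_core (A : S1) :
  eps_map (sval A) ⊙ fmap emb12 (beta1 A) ≡ cid (g2 (sval A)).
Proof.
change (eps_map (sval A) ⊙ fmap g2 (beta_map abC h1 bifibN1 N1_tcof A : @hom (pcat C) _ _) ≡ cid _).
have [s hs ->] := beta_mapE abC h1 bifibN1 N1_tcof A.
rewrite (fmapM g2 (r1 (sval A)) (s : @hom (pcat C) _ _)) -ccompA invlA.
rewrite -fmapM -(fmap1 g2); exact: (fmap_proper g2).
Qed.

Lemma eta_core (A : S2) : eta_map (sval A) ≡ fmap emb21 (beta2 A).
Proof.
change (eta_map (sval A) ≡ fmap g1 (beta_map abC h2 bifibN2 N2_tcof A : @hom (pcat C) _ _)).
have [s hs ->] := beta_mapE abC h2 bifibN2 N2_tcof A.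
rewrite (fmapM g1 (r2 (sval A)) (s : @hom (pcat C) _ _)).
apply: ccomp_proper; first reflexivity.
symmetry; apply: inv_uniq; rewrite -fmapM -(fmap1 g1); exact: (fmap_proper g1).
Qed.

(** Both sides are left inverses of the isomorphism [emb12 (beta1 _)], by [bif_theta] and
    [eps_core]. *)
Lemma left_der_theta (X : C) :
  fmap left_der (theta1 (g1 X)) ≡ eps_map (rep1 X).
Proof.
have ib : iso (fmap emb12 (beta1 (bif1 (g1 X)))).
  by apply: iso_fmap; apply: natiso_iso.
apply: (iso_epi ib); transitivity (cid (g2 (rep1 X))); last first.
  by symmetry; apply: (eps_core (bif1 (g1 X))).
transitivity (fmap emb12 (fmap bif1 (theta1 (g1 X)) ⊙ beta1 (bif1 (g1 X)))).
  symmetry; exact (fmapM emb12 (fmap bif1 (theta1 (g1 X))) (beta1 (bif1 (g1 X)))).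
transitivity (fmap emb12 (cid (bif1 (g1 X)))); last exact: (fmap1 emb12).
apply: (fmap_proper emb12); exact: bif_theta.
Qed.

Lemma right_der_theta (Y : C) :
  fmap right_der (theta2 (g2 Y)) ⊙ eta_map (rep2 Y) ≡ cid (right_der (g2 Y)).
Proof.
transitivity (fmap right_der (theta2 (g2 Y)) ⊙ fmap emb21 (beta2 (bif2 (g2 Y)))).
  by apply: ccomp_proper; [reflexivity | apply: (eta_core (bif2 (g2 Y)))].
transitivity (fmap emb21 (fmap bif2 (theta2 (g2 Y)) ⊙ beta2 (bif2 (g2 Y)))).
  symmetry; exact (fmapM emb21 (fmap bif2 (theta2 (g2 Y))) (beta2 (bif2 (g2 Y)))).
transitivity (fmap emb21 (cid (bif2 (g2 Y)))); last first. exact (fmap1 emb21 (bif2 (g2 Y))).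
exact (fmap_proper emb21 (bif_theta abC h2 bifibN2 N2_tcof Y)).
Qed.


(** Naturality of [eta] along [q1] and [r1], the two legs of the zigzag behind both [eps] and
    [theta1]. This is also what makes the derived unit compatible with the original one. *)
Lemma eps_eta (X : C) :
  fmap right_der (eps_map X) ⊙ eta_map (rep1 X) ≡ eta_map X ⊙ theta1 (g1 X).
Proof.
have ir : iso (fmap right_der (fmap g2 (r1 X))) := iso_fmap right_der (r1_iso X).
have ->: fmap right_der (eps_map X)
    ≡ fmap right_der (fmap g2 (q1 X)) ⊙ inv ir.
  rewrite -(fmap_inv (r1_iso X) ir); exact: (fmapM right_der).
apply: (iso_epi (gr_iso abC h1 X)).
rewrite -(ccompA (eta_map X)) -(ccompA _ (eta_map (rep1 X))).
have -> : eta_map (rep1 X) ⊙ gr h1 X ≡ fmap right_der (fmap g2 (r1 X)) ⊙ eta_map (cof_rep h1 X).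
  exact: (eta_natural (r1 X)).
have -> : theta1 (g1 X) ⊙ gr h1 X ≡ fmap g1 (q1 X).
  exact: (thetaE abC h1 bifibN1 N1_tcof X).
rewrite -(ccompA _ (inv ir)) invlA; symmetry; exact: (eta_natural (q1 X)).
Qed.

Lemma eta_eps (Y : C) :
  theta2 (g2 Y) ⊙ (eps_map (rep2 Y) ⊙ fmap left_der (eta_map Y)) ≡ eps_map Y.
Proof.
have iq : iso (fmap left_der (fmap g1 (q2 Y))) := iso_fmap left_der (q2_iso Y).
have -> : fmap left_der (eta_map Y)
    ≡ fmap left_der (fmap g1 (r2 Y)) ⊙ inv iq.
  rewrite -(fmap_inv (q2_iso Y) iq); exact: (fmapM left_der).
apply: (iso_epi iq).
rewrite -(ccompA (theta2 _)) -(ccompA (eps_map _)) -(ccompA _ (inv iq)) invl ccompf1.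
have -> : eps_map (rep2 Y) ⊙ fmap left_der (fmap g1 (r2 Y))
   ≡ fmap g2 (r2 Y) ⊙ eps_map (cof_rep h2 Y) by exact: (eps_natural (r2 Y)).
rewrite ccompA; have -> : theta2 (g2 Y) ⊙ fmap g2 (r2 Y) ≡ fmap g2 (q2 Y).
  exact: (thetaE abC h2 bifibN2 N2_tcof Y).
symmetry; exact: (eps_natural (q2 Y)).
Qed.

(** [left_der] sends [X] to its replacement, so the unit is [eta] at the replacement, moved back to
    [X] along [theta1]. *)
Definition unit_map (X : C) : @hom (Ho M1) (g1 X) (right_der (left_der (g1 X))) :=
  eta_map (rep1 X) ⊙ inv (natiso_iso theta1 (g1 X)).

Definition counit_map (Y : C) : @hom (Ho M2) (left_der (right_der (g2 Y))) (g2 Y) :=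
  theta2 (g2 Y) ⊙ eps_map (rep2 Y).

Lemma unit_natural (X Y : C) (f : @hom (pcat C) X Y) :
  unit_map Y ⊙ fmap (idf (Ho M1)) (fmap g1 f)
  ≡ fmap (fcomp right_der left_der) (fmap g1 f) ⊙ unit_map X.
Proof.
apply: (iso_epi (natiso_iso theta1 (g1 X))).
rewrite -(ccompA _ (unit_map X)) -(ccompA (eta_map (rep1 X))) invl ccompf1.
rewrite -(ccompA (unit_map Y)).
have <- := natural theta1 (fmap g1 f).
rewrite -(ccompA (eta_map _)) invlA.
have e := eta_natural (bif_hom abC h1 f : @hom (pcat C) _ _).
exact: e.
Qed.

Lemma counit_natural (X Y : C) (f : @hom (pcat C) X Y) :
  counit_map Y ⊙ fmap (fcomp left_der right_der) (fmap g2 f)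
  ≡ fmap (idf (Ho M2)) (fmap g2 f) ⊙ counit_map X.
Proof.
rewrite /counit_map -(ccompA (theta2 _)).
have -> : eps_map (rep2 Y) ⊙ fmap (fcomp left_der right_der) (fmap g2 f)
    ≡ fmap g2 (bif_hom abC h2 f : @hom (pcat C) _ _) ⊙ eps_map (rep2 X).
  exact: (eps_natural (bif_hom abC h2 f : @hom (pcat C) _ _)).
rewrite (ccompA (theta2 _)) (ccompA (fmap _ _)); apply: ccomp_proper; last reflexivity.
exact: (natural theta2 (fmap g2 f)).
Qed.

Definition der_unit_nat : nattrans (idf (Ho M1)) (fcomp right_der left_der) :=
  @loc_nat (pcat C) (Ho M1) (@weq (pcat C) M1) (idf (Ho M1))
    (fcomp right_der left_der) unit_map unit_natural.

Definition der_counit_nat : nattrans (fcomp left_der right_der) (idf (Ho M2)) :=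
  @loc_nat (pcat C) (Ho M2) (@weq (pcat C) M2) (fcomp left_der right_der)
    (idf (Ho M2)) counit_map counit_natural.

Lemma der_triangleL (X : Ho M1) :
  der_counit_nat (left_der X) ⊙ fmap left_der (der_unit_nat X) ≡ cid (left_der X).
Proof.
change (counit_map (rep1 X) ⊙ fmap left_der (unit_map X) ≡ cid (g2 (rep1 X))).
have it := iso_fmap left_der (natiso_iso theta1 (g1 X)).
have -> : fmap left_der (unit_map X) ≡ fmap left_der (eta_map (rep1 X)) ⊙ inv it.
  rewrite -(fmap_inv (natiso_iso theta1 (g1 X)) it); exact: (fmapM left_der).
rewrite ccompA.
have -> : counit_map (rep1 X) ⊙ fmap left_der (eta_map (rep1 X)) ≡ eps_map (rep1 X).
  rewrite -(ccompA (theta2 _)); exact: eta_eps.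
 apply: (iso_epi it); rewrite -ccompA invl ccompf1 ccomp1f.
by symmetry; apply: left_der_theta.
Qed.

Lemma der_triangleR (Y : Ho M2) :
  fmap right_der (der_counit_nat Y) ⊙ der_unit_nat (right_der Y) ≡ cid (right_der Y).
Proof.
change (fmap right_der (counit_map Y) ⊙ unit_map (rep2 Y) ≡ cid (g1 (rep2 Y))).
have -> : fmap right_der (counit_map Y)
   ≡ fmap right_der (theta2 (g2 Y)) ⊙ fmap right_der (eps_map (rep2 Y)).
  exact: (fmapM right_der).
rewrite -(ccompA (fmap right_der (theta2 _))).
have -> : fmap right_der (eps_map (rep2 Y)) ⊙ unit_map (rep2 Y) ≡ eta_map (rep2 Y).
  rewrite (ccompA _ (eta_map _)) (eps_eta (rep2 Y)) -(ccompA (eta_map _)) invr ccompf1.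
  reflexivity.

exact: right_der_theta.
Qed.

Definition der_adjunction : adjunction left_der right_der :=
  @Adjunction _ _ left_der right_der der_unit_nat der_counit_nat
    der_triangleL der_triangleR.

(** At [rep1 X] the map [eps] equals [left_der] of [theta1], an isomorphism. Hence [t] is forced: it
    is [z] at the replacement, moved to [X] along [H] of [theta1]. *)
Lemma left_derP : is_total_left_derived (M := M1) (N := M2) (F := idf (pcat C)) eps.
Proof.
move=> H z.
pose it X : iso (fmap H (theta1 (g1 X))) := iso_fmap H (natiso_iso theta1 (g1 X)).
pose t X : hom (H (g1 X)) (left_der (g1 X)) := z (rep1 X) ⊙ inv (it X).
have tN (X Y : C) (f : @hom (pcat C) X Y) :
  t Y ⊙ fmap H (fmap g1 f) ≡ fmap left_der (fmap g1 f) ⊙ t X.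
  apply: (iso_epi (it X)); rewrite -!ccompA invl ccompf1 -fmapM.
  have e := natural theta1 (fmap g1 f).
  have -> : fmap H (fmap g1 f ⊙ theta1 (g1 X))
      ≡ fmap H (theta1 (g1 Y)) ⊙ fmap H (fmap (fcomp emb1 bif1) (fmap g1 f)).
    by rewrite -fmapM; apply: (fmap_proper H); symmetry.
  rewrite invlA; exact: (natural z (bif_hom abC h1 f : @hom (pcat C) _ _)).
exists (@loc_nat (pcat C) (Ho M2) (@weq (pcat C) M1) H left_der t tN); split.
  move=> X; change (eps_map X ⊙ t X ≡ z X); apply: (iso_epi (it X)).
  rewrite -!ccompA invl ccompf1.
  apply: (iso_epi (iso_fmap H (gr_iso abC h1 X))); rewrite -!ccompA.
  have -> : z (rep1 X) ⊙ fmap H (gr h1 X) ≡ fmap g2 (r1 X) ⊙ z (cof_rep h1 X).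
    exact: (natural z (r1 X)).
  rewrite invlA -fmapM.
  have -> : fmap H (theta1 (g1 X) ⊙ gr h1 X) ≡ fmap H (gq h1 X).
    by apply: (fmap_proper H); apply: thetaE.
  by symmetry; apply: (natural z (q1 X)).
move=> t' t'P X; change (t' (g1 X) ≡ t X); apply: (iso_epi (it X)).
rewrite -ccompA invl ccompf1; have -> := natural t' (theta1 (g1 X)).
by rewrite left_der_theta; apply: (t'P (rep1 X)).
Qed.

Lemma right_derP : is_total_right_derived (M := M1) (N := M2) (G := idf (pcat C)) eta.
Proof.
move=> H z.
pose it Y : iso (fmap H (theta2 (g2 Y))) := iso_fmap H (natiso_iso theta2 (g2 Y)).
pose t Y : hom (right_der (g2 Y)) (H (g2 Y)) := fmap H (theta2 (g2 Y)) ⊙ z (rep2 Y).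
have tN (X Y : C) (f : @hom (pcat C) X Y) :
  t Y ⊙ fmap right_der (fmap g2 f) ≡ fmap H (fmap g2 f) ⊙ t X.
  rewrite /t -ccompA.
  have -> : z (rep2 Y) ⊙ fmap right_der (fmap g2 f)
      ≡ fmap H (fmap g2 (bif_hom abC h2 f : @hom (pcat C) _ _)) ⊙ z (rep2 X).
    exact: (natural z (bif_hom abC h2 f : @hom (pcat C) _ _)).
  rewrite !ccompA -!fmapM; apply: ccomp_proper; last reflexivity.
  by apply: (fmap_proper H); apply: (natural theta2 (fmap g2 f)).
have ei (Y : C) : t Y ⊙ eta_map Y ≡ z Y.
  apply: (iso_epi (q2_iso Y)); rewrite -!ccompA invl ccompf1.
  have -> : z (rep2 Y) ⊙ fmap g1 (r2 Y) ≡ fmap H (fmap g2 (r2 Y)) ⊙ z (cof_rep h2 Y).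
    exact: (natural z (r2 Y)).
  rewrite ccompA -fmapM.
  have -> : fmap H (theta2 (g2 Y) ⊙ fmap g2 (r2 Y)) ≡ fmap H (fmap g2 (q2 Y)).
    by apply: (fmap_proper H); apply: (thetaE abC h2 bifibN2 N2_tcof Y).
  by symmetry; apply: (natural z (q2 Y)).
exists (@loc_nat (pcat C) (Ho M1) (@weq (pcat C) M2) right_der H t tN); split=> //.
move=> t' t'P Y; change (t' (g2 Y) ≡ t Y).
have e := right_der_theta Y.
(* By [e] the map has a left inverse that is itself an isomorphism. *)
have ie : iso (eta_map (rep2 Y)).
  exists (fmap right_der (theta2 (g2 Y))); split=> //.
  apply: (iso_mono (iso_fmap right_der (natiso_iso theta2 (g2 Y)))).
  by rewrite ccompA e ccomp1f ccompf1; reflexivity.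
apply: (iso_epi (iso_fmap right_der (natiso_iso theta2 (g2 Y)))).
have -> := natural t' (theta2 (g2 Y)); apply: (iso_epi ie).
rewrite -!ccompA e ccompf1; apply: ccomp_proper; first reflexivity.
exact: (t'P (rep2 Y)).
Qed.

Definition id_derived_adjunction :
  derived_adjunction M1 M2 (idf_adjunction (pcat C)).
Proof.
refine (@DerivedAdjunction _ _ M1 M2 _ _ (idf_adjunction (pcat C)) left_der right_der
  eps eta left_derP right_derP der_adjunction _ _).
- move=> X.
  change (fmap right_der (eps_map X) ⊙ unit_map X ≡ eta_map X ⊙ fmap g1 (cid (X : pcat C))).
  rewrite ccompA.
  have e := eps_eta X; rewrite e -ccompA invr.
  by apply: ccomp_proper; [reflexivity | symmetry; apply: (fmap1 g1)].
- move=> Y.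
  change (counit_map Y ⊙ fmap left_der (eta_map Y) ≡ fmap g2 (cid (Y : pcat C)) ⊙ eps_map Y).
  rewrite -ccompA; have e := eta_eps Y; rewrite e.
  transitivity (cid (g2 Y) ⊙ eps_map Y); first by rewrite ccomp1f; reflexivity.
  by apply: ccomp_proper; [symmetry; apply: (fmap1 g2) | reflexivity].
Defined.

End Derived.

(** * Abelian groups and complexes form abelian categories *)

Program Definition ekernel (A B : egrp) (f : ehom A B) : egrp :=
  {| esort := {a : A | f a ≈ ezero}; eeq := fun a b => sval a ≈ sval b;
     ezero := exist _ ezero (ehom0 f);
     eadd := fun a b => exist _ (sval a ⊞ sval b) _;
     eopp := fun a => exist _ (⊟ (sval a)) _ |}.
Next Obligation. by move=> A B f [a ha] [b hb] /=; rewrite ehomD ha hb; apply: eadd0. Qed.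
Next Obligation. by move=> A B f [a ha] /=; rewrite ehomN ha; apply: eopp0. Qed.
Next Obligation.
move=> A B f; split.
- by move=> a; reflexivity.
- by move=> a b; symmetry.
- by move=> a b c ab bc; transitivity (sval b).
Qed.
Next Obligation. by move=> A B f a a' ha b b' hb /=; apply: eadd_proper. Qed.
Next Obligation. by move=> A B f a a' ha /=; apply: eopp_proper. Qed.
Next Obligation. by move=> A B f a b c /=; apply: eaddA. Qed.
Next Obligation. by move=> A B f a b /=; apply: eaddC. Qed.
Next Obligation. by move=> A B f a /=; apply: eadd0. Qed.
Next Obligation. by move=> A B f a /=; apply: eaddN. Qed.

Program Definition ekernel_in (A B : egrp) (f : ehom A B) : ehom (ekernel f) A :=
  {| efun := fun a => sval a |}.
Next Obligation. by move=> A B f a b. Qed.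
Next Obligation. by move=> A B f a b; reflexivity. Qed.

Program Definition ecoker_proj (A B : egrp) (f : ehom A B) : ehom B (ecoker f) :=
  {| efun := fun b => (b : ecoker f) |}.
Next Obligation. by move=> A B f a b; apply: ecoker_eq. Qed.
Next Obligation. by move=> A B f a b; apply: ecoker_eq; reflexivity. Qed.

Lemma eab_mono_inj (A B : EAb) (f : phom A B) (a : A) :
  is_mono f -> (f : ehom A B) a ≈ ezero -> a ≈ ezero.
Proof.
move=> mf fa.
exact: (mono0 (T := ekernel f : EAb) (u := ekernel_in f) mf svalP (exist _ a fa)).
Qed.

Lemma eab_epi_surj (A B : EAb) (f : phom A B) (b : B) :
  is_epi f -> exists a, (f : ehom A B) a ≈ b.
Proof.
move=> ef; have [|a ha] := @epi0 EAb _ _ f (ecoker f) (ecoker_proj f) ef _ b.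
  by move=> a; exists a; rewrite e0add; reflexivity.
exists a; have {}ha : b ≈ ezero ⊞ (f : ehom A B) a := ha.
by rewrite ha e0add; reflexivity.
Qed.

Lemma eab_inj_mono (A B : EAb) (f : phom A B) :
  (forall a, (f : ehom A B) a ≈ ezero -> a ≈ ezero) -> is_mono f.
Proof. by move=> h; apply: mono_of0 => T u fu t; apply: h; apply: fu. Qed.

Lemma eab_surj_epi (A B : EAb) (f : phom A B) :
  (forall b, exists a, (f : ehom A B) a ≈ b) -> is_epi f.
Proof.
move=> h T u v e b; have [a <-] := h b; exact: e.
Qed.

Lemma eab_kernelP (A X B : EAb) (g : phom X B) (f : phom A X) :
  is_kernel g f <->
  [/\ forall a, (g : ehom X B) ((f : ehom A X) a) ≈ ezero,
      forall a, (f : ehom A X) a ≈ ezero -> a ≈ ezero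
    & forall x, (g : ehom X B) x ≈ ezero -> exists a, (f : ehom A X) a ≈ x].
Proof.
split=> [[gf mf kf]|[gf mf kf]]; split=> //.
- by move=> a; apply: eab_mono_inj.
- move=> x gx; have [|v hv] := kf (ekernel g) (ekernel_in g); first exact: svalP.
  by exists ((v : ehom (ekernel g) A) (exist _ x gx)); apply: hv.
- exact: eab_inj_mono.
(* Preimages chosen element by element form a homomorphism because [f] is injective. *)
- move=> T u gu; have [v hv] := dep_choice (fun t : T => kf _ (gu t)).
  have inj a b : (f : ehom A X) a ≈ (f : ehom A X) b -> a ≈ b.
    by move=> e; apply: esub_eq; apply: mf; rewrite ehomD ehomN e; apply: eaddN.
  unshelve eexists (@Ehom T A v _ _) => //.
    by move=> a b e; apply: inj; rewrite !hv e; reflexivity.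
  by move=> a b; apply: inj; rewrite ehomD !hv ehomD; reflexivity.
Qed.

Lemma eab_cokernelP (A X B : EAb) (f : phom A X) (g : phom X B) :
  (forall a, (g : ehom X B) ((f : ehom A X) a) ≈ ezero) ->
  (forall b, exists x, (g : ehom X B) x ≈ b) ->
  (forall x, (g : ehom X B) x ≈ ezero -> exists a, (f : ehom A X) a ≈ x) ->
  is_cokernel f g.
Proof.
move=> gf sg kg; split=> //; first exact: eab_surj_epi.
move=> T u uf; have [s hs] := dep_choice sg.
have uE x y : (g : ehom X B) x ≈ (g : ehom X B) y -> (u : ehom X T) x ≈ (u : ehom X T) y.
  move=> e; have [|a ha] := kg (x ⊞ ⊟ y).
    by rewrite ehomD ehomN e; apply: eaddN.
  apply: esub_eq; rewrite -ehomN -ehomD -ha; exact: uf.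
unshelve eexists (@Ehom B T (fun b => (u : ehom X T) (s b)) _ _).
- by move=> a b e; apply: uE; rewrite !hs.
- by move=> a b; rewrite -ehomD; apply: uE; rewrite ehomD !hs; reflexivity.
- by move=> x; apply: uE; apply: hs.
Qed.

Lemma eab_exactP (A X B : EAb) (f : phom A X) (g : phom X B) :
  exact_seq f g <->
  (forall a, (g : ehom X B) ((f : ehom A X) a) ≈ ezero) /\
  (forall x, (g : ehom X B) x ≈ ezero -> exists a, (f : ehom A X) a ≈ x).
Proof.
split.
  move=> [K [k [e [/eab_kernelP[gk mk kk] ee fke]]]]; split=> [a|x /kk[y hy]].
    by rewrite (fke a); apply: gk.
  have [a ha] := eab_epi_surj y ee; exists a; rewrite -hy -ha; exact: fke.
move=> [gf kg]; pose e : ehom A (ekernel g) :=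
  @Ehom A (ekernel g) (fun a => exist _ ((f : ehom A X) a) (gf a))
    (fun a b ab => ehom_proper f ab) (fun a b => ehomD f a b).
exists (ekernel g), (ekernel_in g), e; split.
- apply/eab_kernelP; split=> //; first exact: svalP.
  by move=> x gx; exists (exist _ x gx); reflexivity.
- by apply: eab_surj_epi => -[x gx]; have [a ha] := kg x gx; exists a.
- by move=> a; reflexivity.
Qed.

Program Definition eprod (A B : egrp) : egrp :=
  {| esort := A * B; eeq := fun p q => p.1 ≈ q.1 /\ p.2 ≈ q.2;
     ezero := (ezero, ezero); eadd := fun p q => (p.1 ⊞ q.1, p.2 ⊞ q.2);
     eopp := fun p => (⊟ p.1, ⊟ p.2) |}.
Next Obligation.
move=> A B; split.
- by move=> a; split; reflexivity.
- by move=> a b [e e']; split; symmetry.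
- by move=> a b c [e e'] [e1 e2]; split; [transitivity b.1 | transitivity b.2].
Qed.
Next Obligation. by move=> A B p p' [h h'] q q' [k k']; split; apply: eadd_proper. Qed.
Next Obligation. by move=> A B p p' [h h']; split; apply: eopp_proper. Qed.
Next Obligation. by move=> A B a b c /=; split; apply: eaddA. Qed.
Next Obligation. by move=> A B a b /=; split; apply: eaddC. Qed.
Next Obligation. by move=> A B a /=; split; apply: eadd0. Qed.
Next Obligation. by move=> A B a /=; split; apply: eaddN. Qed.

Program Definition eunit : egrp :=
  {| esort := unit; eeq := fun _ _ => True; ezero := tt;
     eadd := fun _ _ => tt; eopp := fun _ => tt |}.
Next Obligation. by split. Qed.
Next Obligation. by []. Qed.
Next Obligation. by []. Qed.
Next Obligation. by []. Qed.
Next Obligation. by []. Qed.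
Next Obligation. by []. Qed.
Next Obligation. by []. Qed.

Lemma abelian_EAb : abelian EAb.
Proof.
split.
- by exists (eunit : EAb).
- move=> A B; exists (eprod A B : EAb).
  unshelve eexists (@Ehom A (eprod A B) (fun a => (a, ezero)) _ _).
  + by move=> a b e; split=> //; reflexivity.
  + by move=> a b; split=> /=; [reflexivity | rewrite eadd0; reflexivity].
  unshelve eexists (@Ehom B (eprod A B) (fun b => (ezero, b)) _ _).
  + by move=> a b e; split=> //; reflexivity.
  + by move=> a b; split=> /=; [rewrite eadd0; reflexivity | reflexivity].
  unshelve eexists (@Ehom (eprod A B) A (fun p => p.1) _ _).
  + by move=> a b [].
  + by move=> a b; reflexivity.
  unshelve eexists (@Ehom (eprod A B) B (fun p => p.2) _ _).
  + by move=> a b [].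
  + by move=> a b; reflexivity.
  split=> [a|a|a|a|[a b]] /=; try reflexivity.
  by rewrite eadd0 e0add; split; reflexivity.
- move=> A B f; exists (ekernel f : EAb), (ekernel_in f); apply/eab_kernelP; split=> //.
    exact: svalP.
  by move=> x gx; exists (exist _ x gx); reflexivity.
- move=> A B f; exists (ecoker f : EAb), (ecoker_proj f); apply: eab_cokernelP.
  + by move=> a; exists a; rewrite e0add; reflexivity.
  + by move=> b; exists b; reflexivity.
  + move=> x [a ha]; exists a; have {}ha : x ≈ ezero ⊞ (f : ehom A B) a := ha.
    by rewrite ha e0add; reflexivity.
- move=> X Y Q f q mf [qf eq kq]; apply/eab_kernelP; split.
  + exact: qf.
  + by move=> a; apply: eab_mono_inj.
  + move=> x qx; have [|v hv] := kq (ecoker f) (ecoker_proj f).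
      by move=> a; exists a; rewrite e0add; reflexivity.
    have [a ha] : (ecoker_proj f x : ecoker f) ≈ ezero.
      transitivity ((v : ehom Q (ecoker f)) ((q : ehom Y Q) x)).
        by symmetry; apply: hv.
      by rewrite qx; apply: ehom0.
    exists a; have {}ha : x ≈ ezero ⊞ (f : ehom X Y) a := ha.
    by rewrite ha e0add; reflexivity.
- move=> A B K g k eg /eab_kernelP[gk mk kk]; apply: eab_cokernelP => //.
  by move=> b; apply: eab_epi_surj.
Qed.

Lemma diff_choice (T : int -> int -> Type)
    (P : forall i j : int, i = j + 1 -> T i j -> Prop) :
  (forall i j h, exists x, P i j h x) ->
  exists d : forall i j : int, i = j + 1 -> T i j, forall i j h, P i j h (d i j h).
Proof. by move=> h; exists (fun i j e => witness (h i j e)) => i j e; apply: witnessP. Qed.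

(** * Kernels and cokernels of complexes, computed degreewise *)

Section ChAbelian.
Variables (C : preadd).

Lemma ch_kernel (X Y K : Ch C) (f : phom X Y) (k : phom K X) :
  (forall i, is_kernel ((f : chmap X Y) i) ((k : chmap K X) i)) -> is_kernel f k.
Proof.
move=> h; split.
- by move=> i; case: (h i).
- by move=> T u v e i; have [_ m _] := h i; apply: m; apply: e.
- move=> T u e.
  have [v hv] : exists v : forall i, phom ((T : complex C) i) ((K : complex C) i),
      forall i, (k : chmap K X) i ∘ v i ≈ (u : chmap T X) i.
    by apply: (dep_choice (P := fun i w => (k : chmap _ _) i ∘ w ≈ (u : chmap _ _) i)) => i;
      have [_ _ l] := h i; apply: l; apply: e.
  unshelve eexists (@Chmap _ T K v _) => // i j hij.
  have [_ m _] := h j; apply: m.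
  by rewrite !pcompA -chm_comm -pcompA !hv chm_comm; reflexivity.
Qed.

Lemma ch_cokernel (X Y K : Ch C) (f : phom X Y) (k : phom Y K) :
  (forall i, is_cokernel ((f : chmap X Y) i) ((k : chmap Y K) i)) -> is_cokernel f k.
Proof.
move=> h; split.
- by move=> i; case: (h i).
- by move=> T u v e i; have [_ m _] := h i; apply: m; apply: e.
- move=> T u e.
  have [v hv] : exists v : forall i, phom ((K : complex C) i) ((T : complex C) i),
      forall i, v i ∘ (k : chmap Y K) i ≈ (u : chmap Y T) i.
    by apply: (dep_choice (P := fun i w => w ∘ (k : chmap _ _) i ≈ (u : chmap _ _) i)) => i;
      have [_ _ l] := h i; apply: l; apply: e.
  unshelve eexists (@Chmap _ K T v _) => // i j hij.
  have [_ m _] := h i; apply: m.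
  by rewrite -!pcompA chm_comm hv pcompA hv chm_comm; reflexivity.
Qed.

Lemma ch_ses (X Y Z : Ch C) (f : phom X Y) (g : phom Y Z) :
  (forall i, ses ((f : chmap X Y) i) ((g : chmap Y Z) i)) -> ses f g.
Proof. by move=> h; split; [apply: ch_kernel | apply: ch_cokernel] => i; case: (h i). Qed.

Variable abC : abelian C.

Lemma ch_kernel_ex (X Y : Ch C) (f : phom X Y) :
  exists (K : Ch C) (k : phom K X),
    forall i, is_kernel ((f : chmap X Y) i) ((k : chmap K X) i).
Proof.
have [K hK] := dep_choice (fun i => ab_ker abC ((f : chmap X Y) i)).
have [k hk] := dep_choice hK.
have [dd hdd] : exists d : forall i j : int, i = j + 1 -> phom (K i) (K j),
    forall i j h, k j ∘ d i j h ≈ cd X h ∘ k i.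
  apply: (diff_choice (P := fun i j h w => k j ∘ w ≈ cd X h ∘ k i)) => i j h.
  have [_ _ l] := hk j; apply: l; have [fk _ _] := hk i.
  by rewrite pcompA -chm_comm -pcompA fk pcompf0; reflexivity.
have ddK i j l (h : i = j + 1) (h' : j = l + 1) : dd j l h' ∘ dd i j h ≈ ezero.
  have [_ m _] := hk l; apply: (mono0 m).
  by rewrite pcompA hdd -pcompA hdd pcompA cdd pcomp0f; reflexivity.
have kd i j (h : i = j + 1) : cd X h ∘ k i ≈ k j ∘ dd i j h by symmetry.
by exists (@Complex C K dd ddK), (@Chmap C (@Complex C K dd ddK) X k kd).
Qed.

Lemma ch_cokernel_ex (X Y : Ch C) (f : phom X Y) :
  exists (K : Ch C) (k : phom Y K),
    forall i, is_cokernel ((f : chmap X Y) i) ((k : chmap Y K) i).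
Proof.
have [K hK] := dep_choice (fun i => ab_cok abC ((f : chmap X Y) i)).
have [k hk] := dep_choice hK.
have [dd hdd] : exists d : forall i j : int, i = j + 1 -> phom (K i) (K j),
    forall i j h, d i j h ∘ k i ≈ k j ∘ cd Y h.
  apply: (diff_choice (P := fun i j h w => w ∘ k i ≈ k j ∘ cd Y h)) => i j h.
  have [_ _ l] := hk i; apply: l; have [fk _ _] := hk j.
  by rewrite -pcompA chm_comm pcompA fk pcomp0f; reflexivity.
have ddK i j l (h : i = j + 1) (h' : j = l + 1) : dd j l h' ∘ dd i j h ≈ ezero.
  have [_ m _] := hk i; apply: (epi0 m).
  by rewrite -pcompA hdd pcompA hdd -pcompA cdd pcompf0; reflexivity.
by exists (@Complex C K dd ddK), (@Chmap C Y (@Complex C K dd ddK) k hdd).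
Qed.

(** An arbitrary kernel is isomorphic to the one built degreewise. *)
Lemma ch_kernel_at (X Y K : Ch C) (f : phom X Y) (k : phom K X) :
  is_kernel f k -> forall i, is_kernel ((f : chmap X Y) i) ((k : chmap K X) i).
Proof.
move=> hk i; have [L [l hl]] := ch_kernel_ex f.
have [u [v [uv vu ku lv]]] := kernel_uniq hk (ch_kernel hl).
have [h m e] := hl i; split.
- by have [h' _ _] := hk; apply: h'.
- apply: (mono_heq (ku i)); apply: mono_comp => //.
  exact: split_mono (vu i).
- move=> T w /e[x hx]; exists ((v : chmap L K) i ∘ x).
  rewrite pcompA -hx; apply: pcomp_proper; last reflexivity.
  exact: (lv i).
Qed.

Lemma ch_cokernel_at (X Y K : Ch C) (f : phom X Y) (k : phom Y K) :
  is_cokernel f k -> forall i, is_cokernel ((f : chmap X Y) i) ((k : chmap Y K) i).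
Proof.
move=> hk i; have [L [l hl]] := ch_cokernel_ex f.
have [h1 h2 h3] := hk; have [l1 l2 l3] := ch_cokernel hl.
have [u hu] := h3 _ l l1; have [v hv] := l3 _ k h1.
have vu : v ∘ u ≈ pid K by apply: h2; rewrite -pcompA hu hv pcomp1f; reflexivity.
have uv : u ∘ v ≈ pid L by apply: l2; rewrite -pcompA hv hu pcomp1f; reflexivity.
have [h m e] := hl i; split.
- exact: h1.
- apply: (epi_heq (hv i)); apply: epi_comp => //.
  exact: split_epi (vu i).
- move=> T w /e[x hx]; exists (x ∘ (u : chmap K L) i).
  rewrite -pcompA -hx; apply: pcomp_proper; first reflexivity.
  exact: (hu i).
Qed.

Lemma ch_ses_at (X Y Z : Ch C) (f : phom X Y) (g : phom Y Z) :
  ses f g -> forall i, ses ((f : chmap X Y) i) ((g : chmap Y Z) i).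
Proof.
by move=> [hf hg] i; split; [apply: ch_kernel_at | apply: ch_cokernel_at].
Qed.

Lemma ch_mono_at (X Y : Ch C) (f : phom X Y) :
  is_mono f -> forall i, is_mono ((f : chmap X Y) i).
Proof.
move=> mf i; have [K [k hk]] := ch_kernel_ex f; have [fk _ _] := ch_kernel hk.
have k0 := mono0 mf fk; have [_ _ l] := hk i; apply: mono_of0 => T u /l[v hv].
by rewrite -hv; apply: (transitivity (pcomp_eql v (k0 i))); apply: pcomp0f.
Qed.

Lemma ch_epi_at (X Y : Ch C) (f : phom X Y) :
  is_epi f -> forall i, is_epi ((f : chmap X Y) i).
Proof.
move=> mf i; have [K [k hk]] := ch_cokernel_ex f; have [fk _ _] := ch_cokernel hk.
have k0 := epi0 mf fk; have [_ _ l] := hk i; apply: epi_of0 => T u /l[v hv].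
by rewrite -hv; apply: (transitivity (pcomp_eqr v (k0 i))); apply: pcompf0.
Qed.

Lemma abelian_Ch : abelian (Ch C).
Proof.
split.
- have [Z hZ] := ab_zero abC.
  unshelve eexists (@Complex C (fun=> Z) (fun _ _ _ => ezero) _).
    by move=> *; apply: pcomp0f.
  by move=> i; apply: hZ.
- move=> X Y.
  have [B hB] := dep_choice (fun i => ab_bip abC ((X : complex C) i) ((Y : complex C) i)).
  have [i1 {}hB] := dep_choice hB; have [i2 {}hB] := dep_choice hB.
  have [p1 {}hB] := dep_choice hB; have [p2 {}hB] := dep_choice hB.
  pose d i j (h : i = j + 1) := i1 j ∘ cd X h ∘ p1 i ⊞ i2 j ∘ cd Y h ∘ p2 i.
  have di1 i j h : d i j h ∘ i1 i ≈ i1 j ∘ cd X h.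
    have [h1 h2 h12 h21 _] := hB i.
    by rewrite pcompDl -!pcompA h1 h21 !pcompf0 eadd0 pcompf1; reflexivity.
  have di2 i j h : d i j h ∘ i2 i ≈ i2 j ∘ cd Y h.
    have [h1 h2 h12 h21 _] := hB i.
    by rewrite pcompDl -!pcompA h2 h12 !pcompf0 e0add pcompf1; reflexivity.
  have p1d i j h : p1 j ∘ d i j h ≈ cd X h ∘ p1 i.
    have [h1 h2 h12 h21 _] := hB j.
    by rewrite pcompDr !pcompA h1 h12 !pcomp0f eadd0 pcomp1f; reflexivity.
  have p2d i j h : p2 j ∘ d i j h ≈ cd Y h ∘ p2 i.
    have [h1 h2 h12 h21 _] := hB j.
    by rewrite pcompDr !pcompA h2 h21 !pcomp0f e0add pcomp1f; reflexivity.
  have dK i j k (h : i = j + 1) (h' : j = k + 1) : d j k h' ∘ d i j h ≈ ezero.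
    rewrite {2}/d pcompDr !pcompA di1 di2.
    by rewrite -!(pcompA _ (cd _ _) (cd _ _)) !cdd !pcompf0 !pcomp0f eadd0; reflexivity.
  pose Bc := @Complex C B d dK.
  have dp1 i j (h : i = j + 1) : cd X h ∘ p1 i ≈ p1 j ∘ cd Bc h by symmetry.
  have dp2 i j (h : i = j + 1) : cd Y h ∘ p2 i ≈ p2 j ∘ cd Bc h by symmetry.
  exists Bc, (@Chmap C X Bc i1 di1), (@Chmap C Y Bc i2 di2).
  exists (@Chmap C Bc X p1 dp1), (@Chmap C Bc Y p2 dp2).
  by split=> i; case: (hB i).
- by move=> X Y f; have [K [k hk]] := ch_kernel_ex f; exists K, k; apply: ch_kernel.
- by move=> X Y f; have [K [k hk]] := ch_cokernel_ex f; exists K, k; apply: ch_cokernel.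
- move=> X Y Q f q mf hq; apply: ch_kernel => i; apply: (ab_mono abC).
    exact: ch_mono_at.
  exact: ch_cokernel_at.
- move=> X Y Q f q mf hq; apply: ch_cokernel => i; apply: (ab_epi abC).
    exact: ch_epi_at.
  exact: ch_kernel_at.
Qed.

End ChAbelian.

(** * Mapping cones and the Verdier quotient *)

Lemma idx_shift (i j : int) : i = j + 1 -> i - 1 = (j - 1) + 1.
Proof. by move=> ->; rewrite addrK subrK. Qed.

Lemma idx_predE (i j : int) : j = i + 1 -> j - 1 = i.
Proof. by move=> ->; rewrite addrK. Qed.

Lemma idx_inj (i j k : int) : k = i + 1 -> k = j + 1 -> i = j.
Proof. by move=> /idx_predE <- /idx_predE. Qed.

Lemma cd_irr (C : preadd) (X : complex C) (i j : int) (h h' : i = j + 1) :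
  cd X h = cd X h'.
Proof. by rewrite (eq_irrelevance h h'). Qed.

Section Shift.
Variables (C : preadd) (X : complex C).

(** [X[1]], without the usual sign, and the suspension, with it. *)
Program Definition shift : complex C :=
  {| cob := fun j => X (j - 1); cd := fun i j h => cd X (idx_shift h) |}.
Next Obligation. by move=> i j k h h' /=; apply: cdd. Qed.

Program Definition susp : complex C :=
  {| cob := fun j => X (j - 1); cd := fun i j h => ⊟ (cd X (idx_shift h)) |}.
Next Obligation.
by move=> i j k h h' /=; rewrite pcompNf pcompfN cdd !eopp0; reflexivity.
Qed.

End Shift.

Section ConeEx.
Variables (C : preadd) (abC : abelian C) (X Y : complex C) (f : chmap X Y).

(** The second summand is [X (j - 1)], while [is_cone] speaks of every [i] with [j = i + 1]; hence
    the transport along [idx_predE]. *)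
Lemma cone_component j : exists (B : C) (i1 : phom (Y j) B) (p1 : phom B (Y j))
    (i2 : forall i, j = i + 1 -> phom (X i) B)
    (p2 : forall i, j = i + 1 -> phom B (X i)),
  forall i (h : j = i + 1), biproduct i1 (i2 i h) p1 (p2 i h).
Proof.
have [B [i1 [i2 [p1 [p2 hB]]]]] := ab_bip abC (Y j) (X (j - 1)).
exists B, i1, p1.
exists (fun i h => eq_rect (j - 1) (fun k => phom (X k) B) i2 i (idx_predE h)).
exists (fun i h => eq_rect (j - 1) (fun k => phom B (X k)) p2 i (idx_predE h)).
by move=> i h; move: (idx_predE h) => {h} e; case: i / e.
Qed.

Lemma cone_ex : exists Cf, is_cone f Cf.
Proof.
have [B hB] := dep_choice cone_component; have [i1 {}hB] := dep_choice hB.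
have [p1 {}hB] := dep_choice hB; have [i2' {}hB] := dep_choice hB.
have [p2' {}hB] := dep_choice hB.
pose i2 i j (h : j = i + 1) : phom (X i) (B j) := i2' j i h.
pose p2 i j (h : j = i + 1) : phom (B j) (X i) := p2' j i h.
have {}hB i j (h : j = i + 1) : biproduct (i1 j) (i2 i j h) (p1 j) (p2 i j h) := hB j i h.
pose d i j (h : i = j + 1) : phom (B i) (B j) :=
  i1 j ∘ (cd Y h ∘ p1 i) ⊞
  (i1 j ∘ f j ⊞ ⊟ (i2 _ _ (idx_pred j) ∘ cd X (idx_pred j))) ∘ p2 j i h.
have d1 i j (h : j = i + 1) : d j i h ∘ i1 j ≈ i1 i ∘ cd Y h.
  have [h1 h2 h12 h21 _] := hB _ _ h.
  by rewrite pcompDl -!pcompA h1 h21 !pcompf0 eadd0 pcompf1; reflexivity.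
have d2 i j k (h : j = i + 1) (h' : k = j + 1) :
    d k j h' ∘ i2 j k h' ≈ i1 j ∘ f j ⊞ ⊟ (i2 i j h ∘ cd X h).
  have [h1 h2 h12 h21 _] := hB _ _ h'.
  rewrite pcompDl -!pcompA h12 h2 !pcompf0 e0add pcompf1.
  have e := idx_predE h; subst i; rewrite (eq_irrelevance h (idx_pred j)).
  reflexivity.
have dK i j k (h : i = j + 1) (h' : j = k + 1) : d j k h' ∘ d i j h ≈ ezero.
  have e := idx_inj h' (idx_pred j); subst k; rewrite (eq_irrelevance h' (idx_pred j)).
  rewrite {2}/d pcompDr !pcompA pcompDr pcompfN !pcompA d1 (d2 _ _ _ (idx_pred (j - 1))).
  rewrite -(pcompA _ (cd Y _) (cd Y _)) cdd pcompf0 pcomp0f e0add.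
  rewrite !pcompDl !pcompNf !pcompDl !pcompNf -!pcompA.
  rewrite (pcompA (cd X _) (cd X _)) cdd pcomp0f pcompf0 eopp0 eadd0.
  by rewrite (pcompA (cd Y _)) (chm_comm f) -!pcompA; apply: eaddN.
exists (@Complex C B d dK), i1, p1, i2, p2; split.
  by move=> i j h; case: (hB _ _ h).
by move=> i j k h h'; split; [apply: d1 | apply: d2].
Qed.

End ConeEx.

Section Cone.
Variables (C : preadd) (X Y : complex C) (f : chmap X Y) (Cf : complex C).
Variables (i1 : forall j, phom (Y j) (Cf j)) (p1 : forall j, phom (Cf j) (Y j))
  (i2 : forall i j : int, j = i + 1 -> phom (X i) (Cf j))
  (p2 : forall i j : int, j = i + 1 -> phom (Cf j) (X i)).
Hypothesis hB : forall (i j : int) (h : j = i + 1),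
  biproduct (i1 j) (i2 h) (p1 j) (p2 h).
Hypothesis hd : forall (i j k : int) (h : j = i + 1) (h' : k = j + 1),
  cd Cf h ∘ i1 j ≈ i1 i ∘ cd Y h /\
  cd Cf h' ∘ i2 h' ≈ i1 j ∘ f j ⊞ ⊟ (i2 h ∘ cd X h).

Lemma cone_d1 (i j : int) (h : j = i + 1) : cd Cf h ∘ i1 j ≈ i1 i ∘ cd Y h.
Proof. by have [] := hd h (erefl (j + 1)). Qed.

Lemma cone_d2 (i j k : int) (h : j = i + 1) (h' : k = j + 1) :
  cd Cf h' ∘ i2 h' ≈ i1 j ∘ f j ⊞ ⊟ (i2 h ∘ cd X h).
Proof. by have [] := hd h h'. Qed.

Lemma cone_dec i j (h : j = i + 1) T (u : phom T (Cf j)) :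
  u ≈ i1 j ∘ (p1 j ∘ u) ⊞ i2 h ∘ (p2 h ∘ u).
Proof.
have [_ _ _ _ e] := hB h; rewrite !pcompA -pcompDl e pcomp1f; reflexivity.
Qed.

Lemma cone_ext_in i j (h : j = i + 1) T (u v : phom T (Cf j)) :
  p1 j ∘ u ≈ p1 j ∘ v -> p2 h ∘ u ≈ p2 h ∘ v -> u ≈ v.
Proof. by move=> e e'; rewrite (cone_dec h u) (cone_dec h v) e e'; reflexivity. Qed.

Lemma cone_ext_out i j (h : j = i + 1) T (u v : phom (Cf j) T) :
  u ∘ i1 j ≈ v ∘ i1 j -> u ∘ i2 h ≈ v ∘ i2 h -> u ≈ v.
Proof.
have [_ _ _ _ e] := hB h => e1 e2.
by rewrite -(pcompf1 u) -(pcompf1 v) -e !pcompDr !pcompA e1 e2; reflexivity.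
Qed.

Lemma cone_p1d (j k : int) (h : k = j + 1) :
  p1 j ∘ cd Cf h ≈ cd Y h ∘ p1 k ⊞ f j ∘ p2 h.
Proof.
have [a1 a2 a12 a21 a] := hB (idx_pred j); have [b1 b2 b12 b21 b] := hB h.
apply: (cone_ext_out (h := h)); rewrite pcompDl -!pcompA.
  by rewrite cone_d1 pcompA a1 b1 b21 pcompf0 eadd0 pcomp1f pcompf1; reflexivity.
rewrite (cone_d2 (idx_pred j)) pcompDr pcompfN !pcompA a1 a12 !pcomp0f.
rewrite eopp0 eadd0 pcomp1f -!pcompA b12 b2 pcompf0 e0add pcompf1; reflexivity.
Qed.

Lemma cone_p2d (i j k : int) (h : j = i + 1) (h' : k = j + 1) :
  p2 h ∘ cd Cf h' ≈ ⊟ (cd X h ∘ p2 h').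
Proof.
have [a1 a2 a12 a21 a] := hB h; have [b1 b2 b12 b21 b] := hB h'.
apply: (cone_ext_out (h := h')); rewrite pcompNf -!pcompA.
  by rewrite cone_d1 pcompA a21 b21 pcompf0 pcomp0f eopp0; reflexivity.
rewrite (cone_d2 h) pcompDr pcompfN !pcompA a21 a2 pcomp0f e0add pcomp1f.
by rewrite -pcompA b2 pcompf1; reflexivity.
Qed.

Definition cone_in_map : chmap Y Cf := @Chmap C Y Cf i1 (fun j i h => cone_d1 h).

Program Definition cone_out_map : chmap Cf (susp X) :=
  @Chmap C Cf (susp X) (fun j => p2 (idx_pred j)) _.
Next Obligation.
move=> k j h /=; have e := idx_inj h (idx_pred k); subst j.
rewrite (cone_p2d (idx_pred (k - 1)) h) pcompNf.
by rewrite (eq_irrelevance h (idx_pred k)) (cd_irr X (idx_shift _) (idx_pred (k - 1))); reflexivity.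
Qed.

Lemma cone_ses : @ses (Ch C) _ _ _ cone_in_map cone_out_map.
Proof. by apply: ch_ses => j; apply: bip_ses (hB _). Qed.

End Cone.

(** The map [C(id_X) -> Cf] induced by the pair [(id_X, f)]. *)
Section ConeCompare.
Variables (C : preadd) (X Y : complex C) (f : chmap X Y) (Cf CX : complex C).
Variables (i1 : forall j, phom (Y j) (Cf j)) (p1 : forall j, phom (Cf j) (Y j))
  (i2 : forall i j : int, j = i + 1 -> phom (X i) (Cf j))
  (p2 : forall i j : int, j = i + 1 -> phom (Cf j) (X i)).
Hypothesis hB : forall (i j : int) (h : j = i + 1),
  biproduct (i1 j) (i2 h) (p1 j) (p2 h).
Hypothesis hd : forall (i j k : int) (h : j = i + 1) (h' : k = j + 1),
  cd Cf h ∘ i1 j ≈ i1 i ∘ cd Y h /\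
  cd Cf h' ∘ i2 h' ≈ i1 j ∘ f j ⊞ ⊟ (i2 h ∘ cd X h).
Variables (i1' : forall j, phom (X j) (CX j)) (p1' : forall j, phom (CX j) (X j))
  (i2' : forall i j : int, j = i + 1 -> phom (X i) (CX j))
  (p2' : forall i j : int, j = i + 1 -> phom (CX j) (X i)).
Hypothesis hB' : forall (i j : int) (h : j = i + 1),
  biproduct (i1' j) (i2' h) (p1' j) (p2' h).
Hypothesis hd' : forall (i j k : int) (h : j = i + 1) (h' : k = j + 1),
  cd CX h ∘ i1' j ≈ i1' i ∘ cd X h /\
  cd CX h' ∘ i2' h' ≈ i1' j ∘ (pid (X : Ch C) : chmap X X) j ⊞ ⊟ (i2' h ∘ cd X h).

Definition cone_cmp j : phom (CX j) (Cf j) :=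
  i1 j ∘ (f j ∘ p1' j) ⊞ i2 (idx_pred j) ∘ p2' (idx_pred j).

Lemma cone_cmpE i j (h : j = i + 1) :
  cone_cmp j ≈ i1 j ∘ (f j ∘ p1' j) ⊞ i2 h ∘ p2' h.
Proof.
rewrite /cone_cmp; have e := idx_inj h (idx_pred j); subst i.
by rewrite (eq_irrelevance h (idx_pred j)); reflexivity.
Qed.

Lemma cone_cmp_p1 j : p1 j ∘ cone_cmp j ≈ f j ∘ p1' j.
Proof.
have [a1 a2 a12 a21 a] := hB (idx_pred j).
by rewrite pcompDr !pcompA a1 a12 !pcomp0f eadd0 pcomp1f; reflexivity.
Qed.

Lemma cone_cmp_p2 i j (h : j = i + 1) : p2 h ∘ cone_cmp j ≈ p2' h.
Proof.
have [a1 a2 a12 a21 a] := hB h; rewrite (cone_cmpE h).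
by rewrite pcompDr !pcompA a2 a21 !pcomp0f e0add pcomp1f; reflexivity.
Qed.

Lemma cone_cmp_comm i j (h : i = j + 1) :
  cd Cf h ∘ cone_cmp i ≈ cone_cmp j ∘ cd CX h.
Proof.
apply: (cone_ext_in hB (h := idx_pred j)); rewrite !pcompA.
  rewrite (cone_p1d hB hd h) cone_cmp_p1 pcompDl -!pcompA cone_cmp_p1.
  rewrite (cone_p1d hB' hd' h) (cone_cmp_p2 h) pcompDr.
  by rewrite (pcompA (cd Y h)) (chm_comm f) -pcompA pcomp1f; reflexivity.
rewrite (cone_p2d hB hd) cone_cmp_p2 pcompNf -pcompA cone_cmp_p2.
by rewrite (cone_p2d hB' hd'); reflexivity.
Qed.

Definition cone_cmp_map : chmap CX Cf := @Chmap C CX Cf cone_cmp cone_cmp_comm.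

(** For a degreewise short exact [X -> Y -> P], the cone of [f] is an extension of [P] by the cone
    of the identity. So the cone of a trivial cofibration is trivially cofibrant. *)
Lemma cone_quotient_ses (P : complex C) (y : chmap Y P) :
  (forall i, ses (f i) (y i)) ->
  exists z : chmap Cf P, @ses (Ch C) CX Cf P cone_cmp_map z.
Proof.
move=> sy.
have zd i j (h : i = j + 1) : cd P h ∘ (y i ∘ p1 i) ≈ (y j ∘ p1 j) ∘ cd Cf h.
  rewrite pcompA (chm_comm y) -!pcompA (cone_p1d hB hd h) pcompDr.
  by rewrite (pcompA (y j) (f j)) (ses0 (sy j)) pcomp0f eadd0; reflexivity.
exists (@Chmap C Cf P _ zd); apply: ch_ses => j /=.
have [[yf mf kf] [_ ey cy]] := sy j; have [a1 a2 a12 a21 a] := hB (idx_pred j).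
have [b1 b2 b12 b21 b] := hB' (idx_pred j).
have mc : is_mono (cone_cmp j).
  apply: mono_of0 => T u cu; apply: (cone_ext_in hB' (h := idx_pred j)).
    rewrite pcompf0; apply: (mono0 mf); rewrite pcompA -cone_cmp_p1 -pcompA cu.
    exact: pcompf0.
  by rewrite -(cone_cmp_p2 (idx_pred j)) -!pcompA cu !pcompf0; reflexivity.
split; split=> //.
- by rewrite -pcompA cone_cmp_p1 pcompA yf pcomp0f; reflexivity.
- move=> T u; rewrite -pcompA => /kf[v hv].
  exists (i1' j ∘ v ⊞ i2' (idx_pred j) ∘ (p2 (idx_pred j) ∘ u)).
  apply: (cone_ext_in hB (h := idx_pred j)); rewrite pcompA.
    rewrite cone_cmp_p1 pcompDr -!pcompA !(pcompA (p1' j)) b1 b12.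
    by rewrite pcomp0f pcompf0 eadd0 pcomp1f; exact: hv.
  rewrite cone_cmp_p2 pcompDr !(pcompA (p2' _)) b21 b2 pcomp0f e0add pcomp1f.
  reflexivity.
- by rewrite -pcompA cone_cmp_p1 pcompA yf pcomp0f; reflexivity.
- by apply: epi_comp => //; apply: split_epi a1.
- move=> T u uc.
  have ui2 : u ∘ i2 (idx_pred j) ≈ ezero.
    have <- : cone_cmp j ∘ i2' (idx_pred j) ≈ i2 (idx_pred j).
      rewrite pcompDl -!pcompA b12 b2 !pcompf0 e0add pcompf1; reflexivity.
    by rewrite pcompA uc pcomp0f; reflexivity.
  have [|v hv] := cy _ (u ∘ i1 j).
    rewrite -pcompA; have <- : cone_cmp j ∘ i1' j ≈ i1 j ∘ f j.
      rewrite pcompDl -!pcompA b1 b21 !pcompf0 eadd0 pcompf1; reflexivity.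
    by rewrite pcompA uc pcomp0f; reflexivity.
  exists v; apply: (cone_ext_out hB (h := idx_pred j)); rewrite -!pcompA.
    by rewrite a1 pcompf1.
  by rewrite a12 !pcompf0; symmetry.
Qed.

(** [Z] is a model of the mapping cylinder: [f] factors as the monomorphism [(f, i1')] with cokernel
    [Cf], followed by the projection [r1], whose kernel is the cone of the identity. *)
Lemma cone_cylinder_ses (Z : Ch C) (j1 : phom (Y : Ch C) Z) (j2 : phom (CX : Ch C) Z)
    (r1 : phom Z (Y : Ch C)) (r2 : phom Z (CX : Ch C)) :
  biproduct j1 j2 r1 r2 ->
  exists (m : phom (X : Ch C) Z) (z : phom Z (Cf : Ch C)), ses m z /\ r1 ∘ m ≈ f.
Proof.
move=> hZ; have [z1 z2 z12 z21 z] := hZ.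
pose io : phom (X : Ch C) CX := cone_in_map hd'.
pose al : phom (Y : Ch C) Cf := cone_in_map hd.
pose de : phom (CX : Ch C) Cf := cone_cmp_map.
exists (j1 ∘ (f : phom (X : Ch C) Y) ⊞ j2 ∘ io), (al ∘ r1 ⊞ ⊟ (de ∘ r2)).
split; last first.
  by rewrite pcompDr !pcompA z1 z12 pcomp0f eadd0 pcomp1f; reflexivity.
apply: ch_ses => j.
have {}hZ : biproduct ((j1 : chmap _ _) j) ((j2 : chmap _ _) j)
    ((r1 : chmap _ _) j) ((r2 : chmap _ _) j).
  by split; [exact: (z1 j) | exact: (z2 j) | exact: (z12 j) | exact: (z21 j) | exact: (z j)].
move: hZ {z1 z2 z12 z21 z}; rewrite /=.
set k1 := (j1 : chmap _ _) j; set k2 := (j2 : chmap _ _) j.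
set s1 := (r1 : chmap _ _) j; set s2 := (r2 : chmap _ _) j.
move=> [z1 z2 z12 z21 z].
have [a1 a2 a12 a21 a] := hB (idx_pred j).
have [b1 b2 b12 b21 b] := hB' (idx_pred j).
set m := k1 ∘ f j ⊞ k2 ∘ i1' j; set w := i1 j ∘ s1 ⊞ ⊟ (cone_cmp j ∘ s2).
have m1 : s1 ∘ m ≈ f j.
  by rewrite pcompDr !pcompA z1 z12 pcomp0f eadd0 pcomp1f; reflexivity.
have m2 : s2 ∘ m ≈ i1' j.
  by rewrite pcompDr !pcompA z2 z21 pcomp0f e0add pcomp1f; reflexivity.
have wk1 : w ∘ k1 ≈ i1 j.
  by rewrite pcompDl pcompNf -!pcompA z1 z21 !pcompf0 eopp0 eadd0 pcompf1; reflexivity.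
have wk2 : w ∘ k2 ≈ ⊟ (cone_cmp j).
  by rewrite pcompDl pcompNf -!pcompA z12 z2 !pcompf0 e0add pcompf1; reflexivity.
have ci1 : cone_cmp j ∘ i1' j ≈ i1 j ∘ f j.
  by rewrite pcompDl -!pcompA b1 b21 !pcompf0 eadd0 pcompf1; reflexivity.
have ci2 : cone_cmp j ∘ i2' (idx_pred j) ≈ i2 (idx_pred j).
  by rewrite pcompDl -!pcompA b12 b2 !pcompf0 e0add pcompf1; reflexivity.
have wm : w ∘ m ≈ ezero.
  by rewrite pcompDr !pcompA wk1 wk2 pcompNf ci1 eaddN; reflexivity.
split; split=> //.
- apply: (@split_mono _ _ _ _ (p1' j ∘ s2)).
  by rewrite -pcompA m2.
- move=> T u; rewrite pcompDl pcompNf -!pcompA => /esub_eq wu.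
  exists (p1' j ∘ (s2 ∘ u)).
  have e1 : s1 ∘ u ≈ f j ∘ (p1' j ∘ (s2 ∘ u)).
    transitivity (p1 j ∘ (i1 j ∘ (s1 ∘ u))).
      by rewrite pcompA a1 pcomp1f; reflexivity.
    by rewrite wu pcompA cone_cmp_p1 -pcompA; reflexivity.
  have e2 : p2' (idx_pred j) ∘ (s2 ∘ u) ≈ ezero.
    rewrite -(cone_cmp_p2 (idx_pred j)) -pcompA -wu pcompA a21; exact: pcomp0f.
  have e3 : s2 ∘ u ≈ i1' j ∘ (p1' j ∘ (s2 ∘ u)).
    transitivity (i1' j ∘ (p1' j ∘ (s2 ∘ u)) ⊞ i2' (idx_pred j) ∘ (p2' (idx_pred j) ∘ (s2 ∘ u))).
      exact: (cone_dec hB').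
    by rewrite e2 pcompf0 eadd0; reflexivity.
  transitivity (k1 ∘ (s1 ∘ u) ⊞ k2 ∘ (s2 ∘ u)).
    by rewrite /m pcompDl -!pcompA -e1 -e3; reflexivity.
  by rewrite !pcompA -pcompDl z pcomp1f; reflexivity.
- apply: (@split_epi _ _ _ _ (k1 ∘ p1 j ⊞ ⊟ (k2 ∘ (i2' (idx_pred j) ∘ p2 (idx_pred j))))).
  rewrite pcompDr pcompfN !pcompA wk1 wk2 !pcompNf eoppK ci2; exact: a.
- move=> T u um.
  have e1 : u ∘ k1 ∘ f j ≈ ⊟ (u ∘ k2 ∘ i1' j).
    apply: eopp_uniq; rewrite eaddC -!pcompA -pcompDr; exact: um.
  exists (u ∘ k1 ∘ p1 j ⊞ ⊟ (u ∘ k2 ∘ (i2' (idx_pred j) ∘ p2 (idx_pred j)))).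
  set v := _ ⊞ _.
  have v1 : v ∘ i1 j ≈ u ∘ k1.
    rewrite pcompDl pcompNf -!pcompA a1 a21 !pcompf0 eopp0 eadd0 pcompf1.
    reflexivity.
  have v2 : v ∘ i2 (idx_pred j) ≈ ⊟ (u ∘ k2 ∘ i2' (idx_pred j)).
    rewrite pcompDl pcompNf -!pcompA a12 a2 !pcompf0 e0add pcompf1.
    reflexivity.
  have vc : v ∘ cone_cmp j ≈ ⊟ (u ∘ k2).
    apply: (cone_ext_out hB' (h := idx_pred j)); rewrite pcompNf -pcompA.
      by rewrite ci1 pcompA v1 e1; reflexivity.
    by rewrite ci2 v2; reflexivity.
  rewrite -(pcompf1 u) -z !pcompDr !pcompA.
  by rewrite pcompfN pcompA v1 vc pcompNf eoppK; reflexivity.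
Qed.

(** The difference [g - h] and the homotopy are the two components of a chain map out of the cone of
    the identity. *)
Lemma homotopic_factor (g h : chmap X Y) : homotopic g h ->
  exists b : phom (CX : Ch C) (Y : Ch C),
    (g : phom (X : Ch C) Y) ⊞ ⊟ (h : phom (X : Ch C) Y)
    ≈ b ∘ (cone_in_map hd' : phom (X : Ch C) CX).
Proof.
move=> [s hs]; pose phi i := g i ⊞ ⊟ (h i).
pose b j : phom (CX j) (Y j) := phi j ∘ p1' j ⊞ s _ _ (idx_pred j) ∘ p2' (idx_pred j).
have b1 j : b j ∘ i1' j ≈ phi j.
  have [c1 c2 c12 c21 c] := hB' (idx_pred j).
  by rewrite pcompDl -!pcompA c1 c21 !pcompf0 eadd0 pcompf1; reflexivity.
have b2 i j (e : j = i + 1) : b j ∘ i2' e ≈ s i j e.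
  have [c1 c2 c12 c21 c] := hB' (idx_pred j).
  have e' := idx_inj e (idx_pred j); subst i; rewrite (eq_irrelevance e (idx_pred j)).
  by rewrite pcompDl -!pcompA c2 c12 !pcompf0 e0add pcompf1; reflexivity.
have bd i j (e : i = j + 1) : cd Y e ∘ b i ≈ b j ∘ cd CX e.
  apply: (cone_ext_out hB' (h := e)); rewrite -!pcompA.
    rewrite b1 (cone_d1 hd') pcompA b1 /phi pcompDr pcompDl pcompfN pcompNf !chm_comm.
    reflexivity.
  rewrite b2 (cone_d2 hd' (idx_pred j)) pcompDr pcompfN pcompf1 b1 pcompA b2.
  rewrite /phi (hs _ _ _ e (idx_pred j)) -eaddA eaddN eadd0; reflexivity.
exists (@Chmap C CX Y b bd) => j; symmetry; exact: b1.
Qed.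

End ConeCompare.

(** * Exact complexes with prescribed cycles *)

Section Exact.
Variables (C : preadd) (abC : abelian C).
Implicit Types X Y Z K L T N G : C.

Lemma exact_kernel X Y Z (f : phom X Y) (g : phom Y Z) K (k : phom K Y) :
  exact_seq f g -> is_kernel g k -> exists e, is_epi e /\ f ≈ k ∘ e.
Proof.
move=> [L [l [e [hl ee fe]]]] hk.
have [u [v [uv vu ku lv]]] := kernel_uniq hl hk.
exists (u ∘ e); split; first by apply: epi_comp => //; apply: split_epi uv.
by rewrite pcompA ku.
Qed.

(** If [t] kills [e] and [m] is the kernel of [t], the cokernel of [l m] kills [f], hence factors
    through [q] and kills [l]. So [l] factors through [l m], which makes [m] a split epimorphism and
    [t] zero. *)
Lemma image_epi X Y Q (f : phom X Y) (q : phom Y Q) L (l : phom L Y)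
    (e : phom X L) : is_cokernel f q -> is_kernel q l -> f ≈ l ∘ e -> is_epi e.
Proof.
move=> [qf eq cq] [ql ml kl] fe; apply: epi_of0 => T t te.
have [M [m [tm mm km]]] := ab_ker abC t; have [e' he'] := km _ e te.
have [P [p hp]] := ab_cok abC (l ∘ m).
have [pm mp lp] := ab_mono abC (mono_comp ml mm) hp.
have [|p' hp'] := cq _ p; first by rewrite fe -he' pcompA pcompA -(pcompA p) pm pcomp0f; reflexivity.
have [|v hv] := lp _ l; first by rewrite -hp' -pcompA ql pcompf0; reflexivity.
have mv : m ∘ v ≈ pid L by apply: ml; rewrite pcompA hv pcompf1; reflexivity.
by rewrite -(pcompf1 t) -mv pcompA tm pcomp0f; reflexivity.
Qed.

(** Reduces exactness to the vanishing of a single map, which can be tested after a monomorphism out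
    of [Q] or, for modules, on elements. *)
Lemma exact_of_test X Y Z Q (f : phom X Y) (g : phom Y Z) (q : phom Y Q) K
    (k : phom K Y) :
  g ∘ f ≈ ezero -> is_cokernel f q -> is_kernel g k -> q ∘ k ≈ ezero ->
  exact_seq f g.
Proof.
move=> gf hq [gk mk kk] qk; have [L [l hl]] := ab_ker abC q.
have [ql ml ll] := hl; have [qf _ _] := hq; have [e he] := ll _ f qf.
have ee : is_epi e by apply: (image_epi hq hl); symmetry.
exists L, l, e; split=> //; last by symmetry.
split=> //; first by apply: (epi0 ee); rewrite -pcompA he.
by move=> T u /kk[v hv]; apply: ll; rewrite -hv pcompA qk pcomp0f; reflexivity.
Qed.

Lemma exact_id0 X Y Z (f : phom X Y) (g : phom Y Z) :
  is_epi f -> g ≈ ezero -> exact_seq f g.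
Proof.
move=> ef g0; exists Y, (pid Y), f; split=> //; last by symmetry; apply: pcomp1f.
split; first by rewrite g0 pcomp0f; reflexivity.
  by move=> T u v; rewrite !pcomp1f.
by move=> T u _; exists u; apply: pcomp1f.
Qed.

Lemma exact_0id X Y Z (f : phom X Y) (g : phom Y Z) :
  is_mono g -> f ≈ ezero -> exact_seq f g.
Proof.
move=> mg f0; have [O hO] := ab_zero abC; exists O, ezero, ezero; split.
- split; first exact: pcompf0.
    by move=> T u v _; rewrite -(pcomp1f u) -(pcomp1f v) hO !pcomp0f; reflexivity.
  by move=> T u gu; exists ezero; rewrite (mono0 mg gu); apply: pcompf0.
- by move=> T u v _; rewrite -(pcompf1 u) -(pcompf1 v) hO !pcompf0; reflexivity.
- by rewrite pcompf0.
Qed.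

Variable A : C -> Prop.
Implicit Types S : complex C.

Lemma cycles_kernel S n Z : is_cycles S n Z -> forall m (h : n = m + 1),
  exists z : phom Z (S n), is_kernel (cd S h) z.
Proof.
move=> [m' [h' [z hz]]] m h; have e := idx_inj h h'; subst m'.
by exists z; rewrite (cd_irr S h h').
Qed.

Lemma ewc_ses S : exact_with_cycles A S ->
  exists (Z : int -> C) (z : forall n, phom (Z n) (S n))
    (e : forall n m, n = m + 1 -> phom (S n) (Z m)),
    (forall n, A (Z n)) /\ forall n m (h : n = m + 1),
      [/\ ses (z n) (e n m h), cd S h ≈ z m ∘ e n m h & is_kernel (cd S h) (z n)].
Proof.
move=> [ex cy]; have [Z hZ] := dep_choice cy.
have [z hz] : exists z : forall n, phom (Z n) (S n),
    forall n, is_kernel (cd S (idx_pred n)) (z n).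
  apply: (dep_choice (P := fun n x => is_kernel (cd S (idx_pred n)) x)) => n.
  exact: cycles_kernel (hZ n).1 _ _.
have {}hz n m (h : n = m + 1) : is_kernel (cd S h) (z n).
  have e := idx_inj h (idx_pred n); subst m; rewrite (cd_irr S h (idx_pred n)).
  exact: hz.
have [e he] := diff_choice (fun n m h =>
  exact_kernel (ex _ _ _ h (idx_pred m)) (hz m _ (idx_pred m))).
exists Z, z, e; split=> [n|n m h]; first by case: (hZ n).
have [ee e'] := he n m h; split=> //; apply: (ses_of_epi abC) => //.
have [_ mz _] := hz m _ (idx_pred m); apply/(kernel_mono_comp (e n m h) (z n) mz).
by apply: kernel_heq (hz n m h) => //; reflexivity.
Qed.

Lemma ewc_compwise S : ext_closed A -> exact_with_cycles A S -> compwise A S.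
Proof.
move=> hA /ewc_ses[Z [z [e [AZ h]]]] n; have [s _ _] := h _ _ (idx_pred n).
exact: hA s (AZ _) (AZ _).
Qed.

(** Since [u] kills boundaries it factors through the cycles [Z m]; from there it extends to [S m],
    because the cokernel [Z (m - 1)] lies in [A] and [G] is orthogonal to it. *)
Lemma ewc_extend S G n m (h : n = m + 1) (u : phom (S n) G) :
  exact_with_cycles A S -> rorth A G ->
  (forall k (h' : k = n + 1), u ∘ cd S h' ≈ ezero) ->
  exists x, x ∘ cd S h ≈ u.
Proof.
move=> /ewc_ses[Z [z [e [AZ hS]]]] hG hu.
have [s1 d1 _] := hS _ _ h; have [s2 d2 _] := hS _ _ (erefl (n + 1)).
have [s0 _ _] := hS _ _ (idx_pred m); have [_ [_ _ c1]] := s1.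
have [|y hy] := c1 _ u.
  by apply: (epi0 (ses_epi s2)); rewrite -pcompA -d2; apply: hu.
have [x hx] := extend_ext abC y (ses_mono s0) (proj2 s0) (hG _ (AZ _)).
by exists x; rewrite d1 pcompA hx.
Qed.

End Exact.

(** * Extensions of complexes and their test objects *)

Section Extensions.
Variables (C : preadd) (abC : abelian C).
Implicit Types (X Y S E : complex C) (G M N : C).

(** Degreewise sections [s] exist; their failure to commute with the differentials is a cycle of
    degree -1 in the Hom complex. If it is the boundary of [b], then [s - F b] is a chain map and
    still a section. *)
Lemma ext1_zero_dg X Y : (forall i, ext1_zero (X i) (Y i)) ->
  exact_complex (Hom_complex X Y) -> @ext1_zero (Ch C) X Y.
Proof.
move=> hXY ex E f g sfg; have sc := ch_ses_at abC sfg.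
pose F : chmap Y E := f; pose Gm : chmap E X := g.
have [s hs] : exists s : forall i, phom (X i) ((E : complex C) i),
    forall i, Gm i ∘ s i ≈ pid (X i).
  exact: (dep_choice (fun i => hXY i _ _ _ (sc i))).
have idxN (i j : int) : j = i + -1 -> i = j + 1 by move=> ->; rewrite subrK.
(* A cochain of degree -1 takes a proof of [j = i + -1]; the choice runs over pairs of indices
   packed with this proof. *)
have [c hc] : exists c : forall p : {ij : int * int | ij.2 = ij.1 + -1},
    phom (X (sval p).1) (Y (sval p).2), forall p (h : (sval p).1 = (sval p).2 + 1),
    F _ ∘ c p ≈ cd E h ∘ s _ ⊞ ⊟ (s _ ∘ cd X h).
  apply: (dep_choice (P := fun (p : {ij : int * int | ij.2 = ij.1 + -1}) x =>
    forall h : (sval p).1 = (sval p).2 + 1, F _ ∘ x ≈ cd E h ∘ s _ ⊞ ⊟ (s _ ∘ cd X h)))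
    => -[[i j] /= e].
  have [[_ _ k] _] := sc j; have [|v hv] := k _ (cd E (idxN _ _ e) ∘ s i ⊞ ⊟ (s j ∘ cd X (idxN _ _ e))).
    rewrite pcompDr pcompfN !pcompA -(chm_comm Gm) hs -pcompA hs pcompf1 pcomp1f.
    exact: eaddN.
  by exists v => h; rewrite (cd_irr X h (idxN _ _ e)) (cd_irr E h (idxN _ _ e)).
pose cc : hom_deg X Y (-1) := fun i j e => c (exist (fun ij : int * int => ij.2 = ij.1 + -1) (i, j) e).
have {}hc (i j : int) e (h : i = j + 1) : F j ∘ cc i j e ≈ cd E h ∘ s i ⊞ ⊟ (s j ∘ cd X h).
  exact: (hc (exist _ (i, j) e) h).
have mF j : is_mono (F j) := ses_mono (sc j).
have /eab_exactP[_ exd] := ex 0 (-1) (-2) (erefl _) (erefl _).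
(* The side goal, that [cc] is a cycle, is checked after the monomorphism [F j], where the two mixed
   terms [d s d] cancel. *)
have [|b hb] := exd cc.
  move=> i j e /=; apply: (mono0 (mF j)).
  rewrite /esign /= eoppK pcompDr !pcompA -(chm_comm F) -pcompA.
  rewrite (hc _ _ _ (idxN i (j + 1) (hom_idxl (erefl _) e))).
  rewrite (hc _ _ _ (idxN (i - 1) j (hom_idxr (erefl _) e))).
  rewrite pcompDr pcompDl pcompfN pcompNf !pcompA cdd pcomp0f e0add.
  rewrite -(pcompA _ (cd X _) (cd X _)) cdd pcompf0 eopp0 eadd0.
  have e2 : i - 1 = j + 1 by rewrite e -addrA.
  move: (idxN (i - 1) j _) (idxN i (j + 1) _) (idx_pred i); rewrite e2 => h1 h2 h3.
  rewrite (cd_irr E h1 (erefl (j + 1))) (cd_irr X h3 h2); exact: eNadd.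
have e0 i : i = i + 0 :> int by rewrite addr0.
have eN (i j : int) : i = j + 1 -> j = i + -1 :> int by move=> ->; rewrite addrK.
pose bb i := b i i (e0 i).
have {}hb (i j : int) (h : i = j + 1) :
    cd Y h ∘ bb i ⊞ ⊟ (bb j ∘ cd X h) ≈ cc i j (eN i j h).
  rewrite -(hb i j (eN i j h)) /= /esign /=; subst i.
  apply: eadd_proper.
    move: (hom_idxl _ _) => h1; rewrite /bb (eq_irrelevance (e0 (j + 1)) h1).
    reflexivity.
  apply: eopp_proper.
  have e3 : j + 1 - 1 = j by rewrite addrK.
  move: (hom_idxr _ _) (idx_pred (j + 1)); rewrite e3 => h1 h2.
  by rewrite /bb (eq_irrelevance (e0 j) h1) (cd_irr X h2 (erefl (j + 1))); reflexivity.
have sd (i j : int) (h : i = j + 1) :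
    cd E h ∘ (s i ⊞ ⊟ (F i ∘ bb i)) ≈ (s j ⊞ ⊟ (F j ∘ bb j)) ∘ cd X h.
  apply: esub_eq; rewrite pcompDr pcompDl pcompfN pcompNf !pcompA (chm_comm F).
  transitivity ((cd E h ∘ s i ⊞ ⊟ (s j ∘ cd X h))
     ⊞ ⊟ (F j ∘ (cd Y h ∘ bb i ⊞ ⊟ (bb j ∘ cd X h)))).
    by rewrite pcompDr pcompfN !pcompA; abel.
  by rewrite hb (hc _ _ _ h) eaddN; reflexivity.
exists (@Chmap C X E _ sd) => i /=; change (Gm i ∘ (s i ⊞ ⊟ (F i ∘ bb i)) ≈ pid (X i)).
have gf : Gm i ∘ F i ≈ ezero := ses0 (sc i).
by rewrite pcompDr pcompfN pcompA gf pcomp0f eopp0 eadd0; apply: hs.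
Qed.

(** The product of all spheres on [G]. *)
Program Definition zero_complex (G : C) : complex C :=
  {| cob := fun=> G; cd := fun _ _ _ => ezero |}.
Next Obligation. by move=> *; apply: pcomp0f. Qed.

(** Only differentials of [S] enter: a cocycle is a family of maps to [G] killing boundaries, and
    [ewc_extend] extends each of them along the next differential. *)
Lemma zero_complex_dg (A : C -> Prop) S G : exact_with_cycles A S -> rorth A G ->
  exact_complex (Hom_complex S (zero_complex G)).
Proof.
move=> hS hG n m k h h'; apply/eab_exactP; split.
  by move=> a i j e; apply: hom_diffK.
move=> u hu.
have idx (i j : int) : j = i + n -> j = i + 1 + m by move=> ->; rewrite h -addrA (addrC 1).
have ud i j (e : j = i + 1 + m) l (hl : l = i + 1 + 1) :
    u (i + 1) j e ∘ cd S hl ≈ ezero.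
  subst l; have := hu (i + 1 + 1) j; rewrite /= => {}hu.
  have e1 : j = i + 1 + 1 + k by rewrite e h' (addrC k) addrA.
  have := hu e1; rewrite pcomp0f e0add.
  move: (hom_idxr h' e1) (idx_pred (i + 1 + 1)).
  have -> : i + 1 + 1 - 1 = i + 1 by rewrite addrK.
  move=> h1 h2; rewrite (eq_irrelevance h1 e) (cd_irr S h2 (erefl _)) => {}hu.
  have hu2 : esign m (u (i + 1) j e ∘ cd S (erefl (i + 1 + 1))) ≈ ezero.
    by rewrite -(eoppK (esign m _)) hu eopp0; reflexivity.
  by rewrite -(esignK m (_ ∘ _)) hu2 esign0; reflexivity.
(* The differential of [w] in degree [n] is [- (-1)^n w d], the target having zero differential;
   solving for [u] gives [w d = - (-1)^n u]. *)
have [v hv] : exists v : forall p : {ij : int * int | ij.2 = ij.1 + n},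
    phom (S (sval p).1) G, forall p (e : (sval p).2 = (sval p).1 + 1 + m),
    v p ∘ cd S (erefl ((sval p).1 + 1)) ≈ ⊟ (esign n (u ((sval p).1 + 1) (sval p).2 e)).
  apply: (dep_choice (P := fun (p : {ij : int * int | ij.2 = ij.1 + n}) x =>
    forall e, x ∘ cd S (erefl ((sval p).1 + 1)) ≈ ⊟ (esign n (u ((sval p).1 + 1) (sval p).2 e))))
    => -[[i j] /= e].
  have [|x hx] := ewc_extend abC (erefl (i + 1)) (u := ⊟ (esign n (u (i + 1) j (idx _ _ e)))) hS hG.
    by move=> l hl; rewrite pcompNf pcompSf ud esign0 eopp0; reflexivity.
  by exists x => e'; rewrite hx (eq_irrelevance e' (idx _ _ e)); reflexivity.
pose w i j e := v (exist (fun ij : int * int => ij.2 = ij.1 + n) (i, j) e).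
have {}hv i j e e' : w i j e ∘ cd S (erefl (i + 1)) ≈ ⊟ (esign n (u (i + 1) j e')).
  exact: (hv (exist _ (i, j) e)).
exists w => i j e; rewrite /= pcomp0f e0add.
have [l el] : exists l, i = l + 1 by exists (i - 1); apply: idx_pred.
subst i; move: (hom_idxr h e) (idx_pred (l + 1)).
have -> : l + 1 - 1 = l by rewrite addrK.
move=> h1 h2; rewrite (cd_irr S h2 (erefl _)) (hv _ _ _ e).
by rewrite esignN eoppK esignK; reflexivity.
Qed.

(** Testing extensions by [zero_complex G] amounts to extending maps to [G]
    along the differentials. *)
Lemma ext1_zero_complex S G : @ext1_zero (Ch C) S (zero_complex G) ->
  forall n m (h : n = m + 1) (c : phom (S n) G),
    (forall k (h' : k = n + 1), c ∘ cd S h' ≈ ezero) ->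
    exists w, w ∘ cd S h ≈ c.
Proof.
move=> hS n m h c hc.
have [cc hc2] : exists cc : forall i, phom (S i) G, forall i,
    (forall k (h' : k = i + 1), cc i ∘ cd S h' ≈ ezero) /\
    forall e : n = i, cc i ≈ eq_rect n (fun i => phom (S i) G) c i e.
  apply: (dep_choice (P := fun i x => (forall k (h' : k = i + 1), x ∘ cd S h' ≈ ezero) /\
    forall e : n = i, x ≈ eq_rect n (fun i => phom (S i) G) c i e)) => i.
  have [<-|ne] := eqVneq n i.
    exists c; split=> // e; rewrite (eq_irrelevance e (erefl n)); reflexivity.
  exists ezero; split=> [k h'|e]; first exact: pcomp0f.
  by rewrite e eqxx in ne.
have hcc i k (h' : k = i + 1) : cc i ∘ cd S h' ≈ ezero by have [hk _] := hc2 i; apply: hk.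
have ccn : cc n ≈ c := (hc2 n).2 (erefl n).
have [B hB] := dep_choice (fun i => ab_bip abC G (S i)).
have [i1 {}hB] := dep_choice hB; have [i2 {}hB] := dep_choice hB.
have [p1 {}hB] := dep_choice hB; have [p2 {}hB] := dep_choice hB.
(* The extension of [S] by [zero_complex G] twisted by [cc], which is [c] extended by zero:
   [d (g, x) = (cc x, d x)]. The first component of a section then extends [c]. *)
pose d i j (h : i = j + 1) := i1 j ∘ (cc i ∘ p2 i) ⊞ i2 j ∘ (cd S h ∘ p2 i).
have di1 i j (e : i = j + 1) : d i j e ∘ i1 i ≈ i1 j ∘ ezero.
  have [_ _ _ h21 _] := hB i.
  by rewrite pcompDl -!pcompA h21 !pcompf0 eadd0; reflexivity.
have p2d i j (e : i = j + 1) : cd S e ∘ p2 i ≈ p2 j ∘ d i j e.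
  have [_ h2 _ h21 _] := hB j.
  by rewrite pcompDr !pcompA h2 h21 !pcomp0f e0add pcomp1f; reflexivity.
have p1d i j (e : i = j + 1) : p1 j ∘ d i j e ≈ cc i ∘ p2 i.
  have [h1 _ h12 _ _] := hB j.
  by rewrite pcompDr !pcompA h1 h12 !pcomp0f eadd0 pcomp1f; reflexivity.
have dK i j k (e : i = j + 1) (e' : j = k + 1) : d j k e' ∘ d i j e ≈ ezero.
  rewrite {1}/d pcompDl -!pcompA -p2d (pcompA (cc j)) hcc (pcompA (cd S e')) cdd.
  by rewrite !pcomp0f !pcompf0 eadd0; reflexivity.
pose E := @Complex C B d dK.
pose a : chmap (zero_complex G) E := @Chmap C (zero_complex G) E i1 di1.
pose b : chmap E S := @Chmap C E S p2 p2d.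
have sab : @ses (Ch C) (zero_complex G) E S a b.
  by apply: ch_ses => i; apply: bip_ses (hB i).
have [s hs] := hS _ _ _ sab; exists (p1 m ∘ (s : chmap S E) m).
rewrite -pcompA -(chm_comm (s : chmap S E)) pcompA p1d -pcompA.
by have e : p2 n ∘ (s : chmap S E) n ≈ pid (S n) := hs n; rewrite e pcompf1.
Qed.

(** The sum of the disks on [M] in all degrees of the parity given by [b]. *)
Definition alt_diff (b : bool) (M : C) (i : int) : phom M M :=
  if odd (absz i) (+) b then pid M else ezero.

Program Definition alt (b : bool) (M : C) : complex C :=
  {| cob := fun=> M; cd := fun i j _ => alt_diff b M i |}.
Next Obligation.
move=> b M i j k h h'; rewrite /alt_diff h odd_absz_succ.
by case: (odd _); case: b => /=; rewrite ?pcomp0f ?pcompf0; reflexivity.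
Qed.

Lemma alt_exact b M : exact_complex (alt b M).
Proof.
move=> i j k h h'; rewrite /= /alt_diff h odd_absz_succ.
case: (odd _ (+) b) (addNb (odd (absz j)) b) => /= ->.
  by apply: (exact_0id abC); [apply: (@split_mono _ _ _ _ (pid M)); apply: pcomp1f | reflexivity].
by apply: exact_id0; [apply: (@split_epi _ _ _ _ (pid M)); apply: pcomp1f | reflexivity].
Qed.

Lemma alt_cycles (M : C) : is_cycles (alt false M) 0 M.
Proof.
exists (-1), (erefl _), (pid M); split.
- by rewrite /= /alt_diff /= pcomp0f; reflexivity.
- by move=> T u v; rewrite !pcomp1f.
- by move=> T u _; exists u; apply: pcomp1f.
Qed.

(** On a disk a section is free in the upper degree, where the differential is the identity, and in
    the lower degree it must be the differential of that choice. *)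
Lemma alt_ext1_zero b M Y : (forall i, ext1_zero M (Y i)) ->
  @ext1_zero (Ch C) (alt b M) Y.
Proof.
move=> hM E f g sfg; have sc := ch_ses_at abC sfg.
pose Gm : chmap E (alt b M) := g.
have [t ht] := dep_choice (fun i => hM i _ _ _ (sc i)).
pose s i : phom M ((E : complex C) i) := if odd (absz i) (+) b then t i
  else cd E (erefl (i + 1)) ∘ t (i + 1).
have sd i j (h : i = j + 1) : cd E h ∘ s i ≈ s j ∘ alt_diff b M i.
  rewrite /s /alt_diff; have -> : odd (absz i) (+) b = ~~ (odd (absz j) (+) b).
    by rewrite h odd_absz_succ addNb.
  case: (odd _ (+) b) => /=.
    by rewrite pcompA cdd pcomp0f pcompf0; reflexivity.
  by subst i; rewrite pcompf1; reflexivity.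
exists (@Chmap C (alt b M) E s sd) => i; change (Gm i ∘ s i ≈ pid M).
rewrite /s; case e: (odd _ (+) b); first exact: ht.
rewrite pcompA -(chm_comm Gm) -pcompA.
have {}ht : Gm (i + 1) ∘ t (i + 1) ≈ pid M := ht (i + 1).
rewrite ht pcompf1 /= /alt_diff odd_absz_succ addNb e; reflexivity.
Qed.

End Extensions.

(** [dg_rorth] over a general category; for modules the two are convertible. *)
Definition dg_class (C : preadd) (A : C -> Prop) (Y : Ch C) : Prop :=
  compwise (rorth A) Y /\
  forall X, exact_with_cycles A X -> exact_complex (Hom_complex X Y).

Lemma ewc_lorth_dg (C : preadd) (abC : abelian C) (A : C -> Prop) (X : Ch C) :
  compwise A X -> exact_with_cycles A X -> lorth (dg_class A) X.
Proof.
by move=> cX eX Y [cY eY]; apply: (ext1_zero_dg abC); [move=> i; apply: cY | apply: eY].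
Qed.

(** The complexes [zero_complex G], [G] in [rorth A], detect exactness, as every
    object embeds in such a [G]; an object [M] with [Ext(M, G) = 0] for all these
    [G] lies in [A], because [alt false M] is then cofibrant. *)
Lemma lorth_dg_ewc (C : preadd) (abC : abelian C) (A : C -> Prop)
    (W : Ch C -> Prop) :
  hovey_triple (compwise A : Ch C -> Prop) W (dg_class A) ->
  forall X : Ch C, lorth (dg_class A) X -> exact_with_cycles A X.
Proof.
move=> hW X hX; have [AX wX] : both (compwise A : Ch C -> Prop) W X by apply/(tcofE hW).
pose S : complex C := X.
have test G : rorth A G -> forall n m (h : n = m + 1) (c : phom (S n) G),
    (forall k (h' : k = n + 1), c ∘ cd S h' ≈ ezero) -> exists w, w ∘ cd S h ≈ c.
  move=> hG; apply: (ext1_zero_complex abC); apply: hX; split=> [i|Z hZ] //.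
  exact: (zero_complex_dg abC hZ hG).
have emb N : exists G (g : phom N G), is_mono g /\ rorth A G.
  (* A fibrant preenvelope of [zero_complex N], read in degree 0: fibrant complexes have components
     in [rorth A]. *)
  have [_ _ [_ _ h]] := hW; have [B [D [f [g [s _ [cB _]]]]]] := h (zero_complex N).
  exists ((B : complex C) 0), ((f : chmap _ _) 0); split; last exact: cB.
  exact: ch_mono_at abC _ _ _ (ses_mono s) 0.
have AP M : (forall G, rorth A G -> ext1_zero M G) -> A M.
  move=> hM; suff h : compwise A (alt false M) by apply: (h 0).
  apply/(cofE hW) => Y [[cY _] _]; apply: (alt_ext1_zero abC) => i.
  by apply: hM; apply: cY.
have ex : exact_complex S.
  move=> i j k h h'; have [N [q hq]] := ab_cok abC (cd S h).
  have [G [g [mg hG]]] := emb N; have [K [l hl]] := ab_ker abC (cd S h').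
  have [qd _ _] := hq; have [dl _ _] := hl.
  apply: (exact_of_test abC _ hq hl); first exact: cdd.
  have [|w hw] := test _ hG j k h' (g ∘ q).
    move=> i' e; have e' : i = i' by rewrite e h.
    move: e; case: i' / e' => e; rewrite (cd_irr S e h) -pcompA qd.
    exact: pcompf0.
  by apply: (mono0 mg); rewrite pcompA -hw -pcompA dl pcompf0; reflexivity.
split=> // n; have [Z [z hz]] := ab_ker abC (cd S (idx_pred n)).
exists Z; split; first by exists (n - 1), (idx_pred n), z.
(* An extension of the cycles by [G] splits: [e] lifts to [t] on [S (n + 1)]; [t] after the
   differential takes values in [G], where it extends along that differential to [w]; and [t - a w]
   kills boundaries, so it factors through [e] as a section. *)
apply: AP => G hG E a p sap.
have [_ mz _] := hz.
have [e [ee he]] := exact_kernel (ex _ _ _ (erefl (n + 1)) (idx_pred n)) hz.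
have [t ht] := lift_ext abC e (ses_epi sap) (proj1 sap) (hG _ (AX (n + 1))).
have [[_ ma ka] _] := sap.
have [|c hc] := ka _ (t ∘ cd S (erefl (n + 1 + 1))).
  by rewrite pcompA ht; apply: (mono0 mz); rewrite pcompA -he cdd; reflexivity.
have [|w hw] := test _ hG _ _ (erefl (n + 1 + 1)) c.
  move=> k h'; apply: (mono0 ma).
  by rewrite pcompA hc -pcompA cdd pcompf0; reflexivity.
have [K [k hk]] := ab_ker abC e.
have hk' : is_kernel (cd S (erefl (n + 1))) k.
  by apply: (kernel_heq (symmetry he) (reflexivity k)); apply/(kernel_mono_comp e k mz).
have [e2 [ee2 he3]] := exact_kernel (ex _ _ _ (erefl (n + 1 + 1)) (erefl (n + 1))) hk'.
have [_ _ ce] := ab_epi abC ee hk.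
have [|s hs] := ce _ (t ⊞ ⊟ (a ∘ w)).
  apply: (epi0 ee2); rewrite -pcompA -he3 pcompDl pcompNf -pcompA hw hc.
  exact: eaddN.
exists s; apply: ee; rewrite -pcompA hs pcompDr pcompfN pcompA (ses0 sap) ht pcomp0f.
by rewrite eopp0 eadd0 pcomp1f; reflexivity.
Qed.

(** * The cone of an identity *)

Section ConeId.
Variables (C : preadd) (abC : abelian C) (X CX : complex C).
Variables (i1 : forall j, phom (X j) (CX j)) (p1 : forall j, phom (CX j) (X j))
  (i2 : forall i j : int, j = i + 1 -> phom (X i) (CX j))
  (p2 : forall i j : int, j = i + 1 -> phom (CX j) (X i)).
Hypothesis hB : forall (i j : int) (h : j = i + 1),
  biproduct (i1 j) (i2 h) (p1 j) (p2 h).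
Hypothesis hd : forall (i j k : int) (h : j = i + 1) (h' : k = j + 1),
  cd CX h ∘ i1 j ≈ i1 i ∘ cd X h /\
  cd CX h' ∘ i2 h' ≈ i1 j ∘ (pid (X : Ch C) : chmap X X) j ⊞ ⊟ (i2 h ∘ cd X h).

(** The cycles in degree [j] are the pairs [(x, - d x)], a copy of [X j]. *)
Lemma cone_id_kernel j k (h : j = k + 1) :
  is_kernel (cd CX h) (i1 j ⊞ ⊟ (i2 h ∘ cd X h)).
Proof.
have [a1 a2 a12 a21 a] := hB h; split.
- rewrite pcompDr pcompfN (pcompA (cd CX h)) (cone_d1 hd) (cone_d2 hd (idx_pred k)).
  rewrite pcompf1 pcompDl pcompNf -(pcompA (i2 _)) cdd pcompf0 eopp0 eadd0.
  exact: eaddN.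
- apply: (@split_mono _ _ _ _ (p1 j)).
  by rewrite pcompDr pcompfN (pcompA (p1 j)) a1 a12 pcomp0f eopp0 eadd0; reflexivity.
- move=> T u du; exists (p1 j ∘ u).
  have e : p2 h ∘ u ≈ ⊟ (cd X h ∘ (p1 j ∘ u)).
    apply: eopp_uniq; rewrite pcompA.
    transitivity (p1 k ∘ (cd CX h ∘ u)); last by rewrite du pcompf0; reflexivity.
    by rewrite (pcompA (p1 k)) (cone_p1d hB hd h) pcomp1f pcompDl; reflexivity.
  rewrite [in X in _ ≈ X](cone_dec hB h u) e pcompDl pcompNf pcompfN !pcompA.
  reflexivity.
Qed.

Lemma cone_id_exact : exact_complex CX.
Proof.
move=> i j k h h'; have hk := cone_id_kernel h'; have [_ mk kk] := hk.
have [a1 a2 a12 a21 a] := hB (idx_pred j).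
have [b1 b2 b12 b21 b] := hB h'.
exists (X j), (i1 j ⊞ ⊟ (i2 h' ∘ cd X h')), (p1 j ∘ cd CX h); split=> //.
  apply: (@split_epi _ _ _ _ (i2 h)).
  rewrite -pcompA (cone_d2 hd (idx_pred j)) pcompf1 pcompDr pcompfN a1.
  by rewrite pcompA a12 pcomp0f eopp0 eadd0; reflexivity.
have [v hv] := kk _ _ (cdd CX h h').
have e : v ≈ p1 j ∘ cd CX h.
  rewrite -hv pcompA pcompDr pcompfN (pcompA (p1 j)) b1 b12 pcomp0f eopp0 eadd0.
  by symmetry; apply: pcomp1f.
by rewrite -e; symmetry.
Qed.

Lemma cone_id_ewc (P : C -> Prop) : compwise P X -> exact_with_cycles P CX.
Proof.
move=> PX; split; first exact: cone_id_exact.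
move=> n; exists (X n); split=> //; exists (n - 1), (idx_pred n).
eexists; exact: cone_id_kernel.
Qed.

(** The contraction is the restriction of [r] to the suspended summand. *)
Lemma cone_id_retract (r : phom (CX : Ch C) (X : Ch C)) :
  r ∘ (cone_in_map hd : phom (X : Ch C) CX) ≈ pid (X : Ch C) ->
  homotopic (pid (X : Ch C)) (ezero : phom (X : Ch C) X).
Proof.
move=> hr; pose r' : chmap CX X := r.
have r1 j : r' j ∘ i1 j ≈ pid (X j) := hr j.
exists (fun i j h => r' j ∘ i2 h) => i j k h h' /=.
rewrite eopp0 eadd0 pcompA (chm_comm r') -pcompA (cone_d2 hd h') pcompf1.
by rewrite pcompDr pcompfN !pcompA r1 -eaddA eNadd eadd0; reflexivity.
Qed.

End ConeId.

Lemma homotopic_of_null (C : preadd) (X Y Z : complex C) (f g : chmap X Y)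
    (a : phom (X : Ch C) (Z : Ch C)) (b : phom (Z : Ch C) (Y : Ch C)) :
  homotopic (pid (Z : Ch C)) (ezero : phom (Z : Ch C) Z) ->
  (f : phom (X : Ch C) Y) ⊞ ⊟ (g : phom (X : Ch C) Y) ≈ b ∘ a -> homotopic f g.
Proof.
move=> [s hs] e; pose a' : chmap X Z := a; pose b' : chmap Z Y := b.
exists (fun i j h => b' j ∘ (s i j h ∘ a' i)) => i j k h h'.
have {}e : f i ⊞ ⊟ (g i) ≈ b' i ∘ a' i := e i; rewrite e.
have {}hs : pid (Z i) ≈ cd Z h ∘ s i j h ⊞ s k i h' ∘ cd Z h'.
  by rewrite -(hs i j k h h') /= eopp0 eadd0; reflexivity.
transitivity (b' i ∘ (pid (Z i) ∘ a' i)); first by rewrite pcomp1f; reflexivity.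
rewrite hs pcompDl pcompDr !pcompA (chm_comm b') -!pcompA (chm_comm a').
reflexivity.
Qed.

(** * The second homotopy category as a Verdier quotient *)

Section Verdier.
Variables (C : preadd) (abC : abelian C) (P : C -> Prop) (W R : Ch C -> Prop).
Notation Q := (compwise P : Ch C -> Prop).
Hypothesis hW : hovey_triple Q W R.
Hypothesis ewcE : forall X : Ch C, both Q W X <-> exact_with_cycles P X.

Notation M := (hovey_model Q W R).
Notation S := (stable_cat (both Q R) (bifib Q W R)).
Notation D := (verdier_quotient P (exact_with_cycles P)).
Notation vf := (verdier_functor P (exact_with_cycles P)).
Notation F := (@fullsub (pcat (Ch C)) (compwise P)).

Let abCh := abelian_Ch abC.

Let bifibN Z : bifib Q W R Z -> bifib Q W R Z. Proof. by []. Qed.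
Let N_tcof Z : bifib Q W R Z -> both Q W Z. Proof. by case=> -[]. Qed.

(** The suspension of [Z] is cofibrant, as cofibrancy only concerns components, and [Z] is trivially
    fibrant. So the embedding of [Z] into the cone of its identity splits. *)
Lemma bifib_contractible (Z : Ch C) : bifib Q W R Z ->
  homotopic (pid Z) (ezero : phom Z Z).
Proof.
move=> [[qZ rZ] wZ].
have [CZ [i1 [p1 [i2 [p2 [hB hd]]]]]] := cone_ex abC (pid Z : chmap Z Z).
have s := cone_ses hB hd.
have qs : Q (susp Z) by move=> j; apply: qZ.
have [r hr] := extend_ext abCh (pid Z) (ses_mono s) (proj2 s)
  (cof_tfib_ext hW qs (conj rZ wZ)).
exact: (cone_id_retract hr).
Qed.

(** The difference of homotopic maps factors through the cone of the identity of [X], which is exact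
    with cycles [X n] in [P] and thus trivially cofibrant. *)
Lemma gamma_homotopic (X Y : F) (f g : hom X Y) : @homotopy_rel C P X Y f g ->
  fmap (fcomp (gamma M) (fullsub_incl _)) f
  ≡ fmap (fcomp (gamma M) (fullsub_incl _)) g.
Proof.
move=> hfg; have [CX [i1 [p1 [i2 [p2 [hB hd]]]]]] := cone_ex abC (pid (sval X) : chmap _ _).
have [b hb] := homotopic_factor hB hd hfg.
have tC : both Q W CX by apply/ewcE; apply: (cone_id_ewc hB hd); apply: svalP X.
exact: (null_inverted_mono abCh (gamma_tcof abCh hW) tC hb).
Qed.

Definition homotopy_gamma : functor (homotopy_cat P) (Ho M) :=
  quot_lift gamma_homotopic.

(** Through the cylinder, [f = r1 m]: here [m] is a trivial cofibration with cokernel [Cf], and [r1]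
    is a retraction of the trivial cofibration [j1]. *)
Lemma cone_inverted (X Y : homotopy_cat P) (f : hom X Y) :
  cone_in (exact_with_cycles P) f -> iso (fmap homotopy_gamma f).
Proof.
move=> [Cf [[i1 [p1 [i2 [p2 [hB hd]]]]] eC]].
have [CX [i1' [p1' [i2' [p2' [hB' hd']]]]]] := cone_ex abC (pid (sval X) : chmap _ _).
have [Z [j1 [j2 [r1 [r2 hZ]]]]] := ab_bip abCh (sval Y) CX.
have [z1 z2 z12 z21 z] := hZ.
have [m [w [smw rm]]] := cone_cylinder_ses hB hd hB' hd' hZ.
have tC : both Q W CX by apply/ewcE; apply: (cone_id_ewc hB' hd'); apply: svalP X.
have im : iso (fmap (gamma M) (m : @hom (pcat (Ch C)) (sval X) Z)).
  apply: (gamma_tcof abCh hW); split; first exact: ses_mono smw.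
  by exists Cf, w; split; [case: smw | apply/ewcE].
have ij : iso (fmap (gamma M) (j1 : @hom (pcat (Ch C)) (sval Y) Z)).
  apply: (gamma_tcof abCh hW); split; first exact: split_mono z1.
  by exists CX, r2; split=> //; case: (bip_ses hZ).
have ir : iso (fmap (gamma M) (r1 : @hom (pcat (Ch C)) Z (sval Y))).
  apply: (iso_retraction ij); rewrite -(fmap1 (gamma M)).
  transitivity (fmap (gamma M) (r1 ∘ j1 : @hom (pcat (Ch C)) _ _)).
    by symmetry; apply: (fmapM (gamma M)).
  exact: (fmap_proper (gamma M)).
apply: (iso_heq (f := fmap (gamma M) (r1 : @hom (pcat (Ch C)) Z (sval Y)) ⊙ fmap (gamma M) (m : @hom (pcat (Ch C)) (sval X) Z))).
  transitivity (fmap (gamma M) (r1 ∘ m : @hom (pcat (Ch C)) _ _)).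
    by symmetry; apply: (fmapM (gamma M)).
  exact: (fmap_proper (gamma M) rm).
exact: iso_comp.
Qed.

Definition verdier_gamma : functor D (Ho M) :=
  @loc_lift (homotopy_cat P) (Ho M) (@cone_in C P (exact_with_cycles P))
    homotopy_gamma cone_inverted.

Lemma verdier_homotopic (X Y : F) (f g : hom X Y) :
  @homotopic C (sval X) (sval Y) f g -> fmap vf f ≡ fmap vf g.
Proof. by move=> h; apply: zz_mor; apply: quot_rel. Qed.

Lemma verdier_omeq (X Y : F) (f g : hom X Y) :
  @omeq (Ch C) Q W R (sval X) (sval Y) f g -> fmap vf f ≡ fmap vf g.
Proof.
move=> [Z [a [b [hZ e]]]]; apply: verdier_homotopic.
exact: (homotopic_of_null (bifib_contractible hZ) e).
Qed.

Definition core_incl_ob (X : @fullsub (pcat (Ch C)) (both Q R)) : F :=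
  exist _ (sval X) (proj1 (svalP X)).

Program Definition core_incl : functor (@fullsub (pcat (Ch C)) (both Q R)) F :=
  {| fob := core_incl_ob; fmap := fun X Y f => f |}.
Next Obligation. by move=> X Y f g. Qed.
Next Obligation. by move=> X; reflexivity. Qed.
Next Obligation. by move=> *; reflexivity. Qed.

Lemma core_verdierP (X Y : @fullsub (pcat (Ch C)) (both Q R)) (f g : hom X Y) :
  stable_rel (bifib Q W R) f g -> fmap (fcomp vf core_incl) f ≡ fmap (fcomp vf core_incl) g.
Proof. by move=> h; apply: (@verdier_omeq (core_incl X) (core_incl Y)). Qed.

Definition core_verdier : functor S D := quot_lift core_verdierP.

Notation bifF := (bif abCh hW bifibN).

Definition verdier_bif : functor (Ho M) D := fcomp core_verdier bifF.

Lemma verdier_gamma_bif : inhabited (natiso (fcomp verdier_gamma verdier_bif) (idf (Ho M))).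
Proof.
pose t := @loc_nat (pcat (Ch C)) (Ho M) (@weq (pcat (Ch C)) M)
  (fcomp verdier_gamma verdier_bif) (idf (Ho M))
  (theta_map abCh hW) (theta_natural abCh hW bifibN N_tcof).
constructor; apply: (natiso_of (t := t)) => X.
exact: iso_comp (gq_iso abCh hW X) (iso_inv (gr_iso abCh hW X)).
Qed.

Lemma verdier_tcof (X Y : F) (f : hom X Y) :
  @mono_with_coker (Ch C) (both Q W) (sval X) (sval Y) f -> iso (fmap vf f).
Proof.
move=> [mf [N [y [hy tN]]]].
have sfy := ses_of_mono abCh mf hy; have sc := ch_ses_at abC sfy.
have [Cf hC] := cone_ex abC (f : chmap (sval X) (sval Y)).
have [i1 [p1 [i2 [p2 [hB hd]]]]] := hC.
have [CX [i1' [p1' [i2' [p2' [hB' hd']]]]]] := cone_ex abC (pid (sval X) : chmap _ _).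
have [z sz] := cone_quotient_ses hB hd hB' hd' (y := y) sc.
have tC : both Q W CX by apply/ewcE; apply: (cone_id_ewc hB' hd'); apply: svalP X.
have hc : @cone_in C P (exact_with_cycles P) X Y f.
  by exists Cf; split=> //; apply/ewcE; exact (tcof_ext abCh hW sz tC tN).
pose zi : zigzag (@cone_in C P (exact_with_cycles P)) Y X := zinv (W := @cone_in C P (exact_with_cycles P)) f hc.
exists zi; split.
  exact (zz_invl (W := @cone_in C P (exact_with_cycles P)) hc).
exact (zz_invr (W := @cone_in C P (exact_with_cycles P)) hc).
Qed.

(** The zigzag of replacements is already invertible in the Verdier quotient: [r] by [verdier_tcof],
    and [q] because it has a section, [X] being cofibrant, which inverts it up to null maps, that
    is, up to homotopy. *)
Lemma verdier_bif_gamma : inhabited (natiso (fcomp verdier_bif verdier_gamma) (idf D)).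
Proof.
pose qF (X : F) : F := exist _ (cof_rep hW (sval X)) (cof_rep_cof hW (sval X)).
pose bF (X : F) : F := core_incl_ob (bif_ob abCh (bifib Q W R) hW (sval X)).
pose q (X : F) : @hom F (qF X) X := cof_map hW (sval X).
pose r (X : F) : @hom F (qF X) (bF X) := bif_map hW (sval X).
have [s hs] := dep_choice (fun X : F => cof_section_ex abCh hW (svalP X)).
pose s' (X : F) : @hom F X (qF X) := s X.
have ir X : iso (fmap vf (r X)) by apply: verdier_tcof; apply: bif_map_tcof.
have qs X : fmap vf (q X) ⊙ fmap vf (s' X) ≡ cid _.
  rewrite -fmapM -fmap1; apply: (fmap_proper vf); exact: hs.
have sq X : fmap vf (s' X) ⊙ fmap vf (q X) ≡ cid _.
  rewrite -fmapM -fmap1; apply: verdier_omeq.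
  apply: (tfib_omeq abCh hW (cof_map_tfib hW _) (cof_rep_cof hW _)).
  apply: omeq_sub => //.
  change (cof_map hW (sval X) ∘ (s X ∘ cof_map hW (sval X)) ≈ cof_map hW (sval X) ∘ pid _).
  by rewrite pcompA hs pcomp1f pcompf1; reflexivity.
have iq X : iso (fmap vf (q X)) by exists (fmap vf (s' X)).
pose t (X : F) : hom (vf (bF X)) (vf X) := fmap vf (q X) ⊙ inv (ir X).
pose g (X Y : F) (f : hom X Y) : @hom F (bF X) (bF Y) := bif_hom abCh hW f.
have tN (X Y : F) (f : hom X Y) :
    t Y ⊙ fmap vf (g X Y f) ≡ fmap vf f ⊙ t X.
  have [m0 [h1 h2]] := bif_homP abCh hW f.
  pose m : @hom F (qF X) (qF Y) := m0.
  apply: (iso_epi (ir X)); rewrite -!ccompA invl ccompf1 -fmapM.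
  have -> : fmap vf (g X Y f ⊙ r X) ≡ fmap vf (r Y ⊙ m) by apply: (fmap_proper vf).
  rewrite fmapM invlA -!fmapM; exact: (fmap_proper vf).
pose t' (X : D) : @hom D (core_incl_ob (bif_ob abCh (bifib Q W R) hW (sval X))) X := t X.
pose T (X : D) : @hom D (fob (fcomp verdier_bif verdier_gamma) X) (fob (idf D) X) := t' X.
have TN (X Y : D) (f : @hom (homotopy_cat P) X Y) :
    @heq D (fob (fcomp verdier_bif verdier_gamma) X) (fob (idf D) Y)
      (T Y ⊙ fmap (fcomp verdier_bif verdier_gamma) (zmor f : @hom D X Y))
      ((zmor f : @hom D X Y) ⊙ T X).
  change (@zigzag_eq _ (@cone_in C P (exact_with_cycles P)) (bF X) Y
    (zcomp (t' Y) (zmor (g X Y f : @hom (homotopy_cat P) _ _))) (zcomp (zmor f) (t' X))).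
  exact (tN X Y f).
constructor; apply: (natiso_of (t := @loc_nat (homotopy_cat P) D
  (@cone_in C P (exact_with_cycles P)) (fcomp verdier_bif verdier_gamma) (idf D) T TN)) => X.
change (@iso D (bF X) X (t' X)).
exact (iso_comp (iq X) (iso_inv (ir X))).
Qed.

Lemma verdier_gamma_equivalence : is_equivalence verdier_gamma.
Proof.
by exists verdier_bif; split; [apply: verdier_bif_gamma | apply: verdier_gamma_bif].
Qed.

End Verdier.

(** * Modules form an abelian category *)

Definition lin_of (R : pzRingType) (M N : lmodType R) (f : M -> N)
    (h : linear f) : {linear M -> N} :=
  HB.pack f (GRing.isLinear.Build R M N *:%R f h).

Section Kernel.
Variables (R : pzRingType) (M N : lmodType R) (f : {linear M -> N}).

Definition lker_type := {x : M | f x == 0}.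
HB.instance Definition _ := SubType.on lker_type.
HB.instance Definition _ := Choice.on lker_type.

Implicit Types x y z : lker_type.

Lemma lkerP x : f (sval x) = 0.
Proof. exact: eqP (svalP x). Qed.

Definition lker_mk (a : M) (h : f a = 0) : lker_type := exist _ a (introT eqP h).

Lemma lker0_subproof : f 0 = 0. Proof. exact: linear0. Qed.
Lemma lkerD_subproof x y : f (sval x + sval y) = 0.
Proof. by rewrite linearD !lkerP addr0. Qed.
Lemma lkerN_subproof x : f (- sval x) = 0.
Proof. by rewrite linearN lkerP oppr0. Qed.
Lemma lkerZ_subproof a x : f (a *: sval x) = 0.
Proof. by rewrite linearZ /= lkerP scaler0. Qed.

Let lker0 := lker_mk lker0_subproof.
Let lkerD x y := lker_mk (lkerD_subproof x y).
Let lkerN x := lker_mk (lkerN_subproof x).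
Let lkerZ a x := lker_mk (lkerZ_subproof a x).

Lemma lker_addA : associative lkerD.
Proof. by move=> x y z; apply: val_inj; rewrite /= addrA. Qed.
Lemma lker_addC : commutative lkerD.
Proof. by move=> x y; apply: val_inj; rewrite /= addrC. Qed.
Lemma lker_add0 : left_id lker0 lkerD.
Proof. by move=> x; apply: val_inj; rewrite /= add0r. Qed.
Lemma lker_addN : left_inverse lker0 lkerN lkerD.
Proof. by move=> x; apply: val_inj; rewrite /= addNr. Qed.

HB.instance Definition _ :=
  GRing.isZmodule.Build lker_type lker_addA lker_addC lker_add0 lker_addN.

Lemma lker_scaleA a b x : lkerZ a (lkerZ b x) = lkerZ (a * b) x.
Proof. by apply: val_inj; rewrite /= scalerA. Qed.
Lemma lker_scale1 : left_id 1 lkerZ.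
Proof. by move=> x; apply: val_inj; rewrite /= scale1r. Qed.
Lemma lker_scaleDr : right_distributive lkerZ +%R.
Proof. by move=> a x y; apply: val_inj; rewrite /= scalerDr. Qed.
Lemma lker_scaleDl x : {morph lkerZ^~ x : a b / a + b}.
Proof. by move=> a b; apply: val_inj; rewrite /= scalerDl. Qed.

HB.instance Definition _ := GRing.Zmodule_isLmodule.Build R lker_type
  lker_scaleA lker_scale1 lker_scaleDr lker_scaleDl.

Lemma lker_in_linear : linear (sval : lker_type -> M).
Proof. by []. Qed.

End Kernel.

Section Cokernel.
Variables (R : pzRingType) (M N : lmodType R) (f : {linear M -> N}).

(** Excluded middle makes membership in the image boolean, as [choose] requires. *)
Definition lcok_rel (x y : N) : bool :=
  if excluded_middle_informative (exists m, y - x = f m) then true else false.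

Lemma lcok_relP x y : reflect (exists m, y - x = f m) (lcok_rel x y).
Proof. by rewrite /lcok_rel; case: excluded_middle_informative => h; constructor. Qed.

Lemma lcok_rel_refl x : lcok_rel x x.
Proof. by apply/lcok_relP; exists 0; rewrite subrr linear0. Qed.

Lemma lcok_rel_eq x y : lcok_rel x y -> lcok_rel x =1 lcok_rel y.
Proof.
move=> /lcok_relP[m e] z; apply/lcok_relP/lcok_relP => -[n e'].
  by exists (n - m); rewrite linearB -e' -e opprB addrA subrK.
by exists (n + m); rewrite linearD -e' -e addrA subrK.
Qed.

(** [RMod R] asks for a carrier with choice, so the elements of [N / f(M)] are
    canonical representatives rather than classes. *)
Definition lcok_repr (x : N) : N := choose (lcok_rel x) x.

Lemma lcok_reprP x : lcok_rel x (lcok_repr x).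
Proof. by apply: (@chooseP _ (lcok_rel x)); apply: lcok_rel_refl. Qed.

Lemma lcok_repr_eq x y : lcok_rel x y -> lcok_repr x = lcok_repr y.
Proof.
move=> h; rewrite /lcok_repr (eq_choose (lcok_rel_eq h)).
by apply: choose_id; [rewrite -(lcok_rel_eq h) lcok_rel_refl | apply: lcok_rel_refl].
Qed.

Lemma lcok_reprK x : lcok_repr (lcok_repr x) == lcok_repr x.
Proof. by apply/eqP; symmetry; apply: lcok_repr_eq; apply: lcok_reprP. Qed.

Definition lcok_type := {x : N | lcok_repr x == x}.
HB.instance Definition _ := SubType.on lcok_type.
HB.instance Definition _ := Choice.on lcok_type.

Implicit Types x y z : lcok_type.

Definition lcok_class (a : N) : lcok_type := exist _ (lcok_repr a) (lcok_reprK a).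

Lemma lcok_classK x : lcok_class (sval x) = x.
Proof. by apply: val_inj; exact: eqP (svalP x). Qed.

Lemma lcok_class_eq a b : (exists m, b - a = f m) -> lcok_class a = lcok_class b.
Proof. by move=> h; apply: val_inj; apply: lcok_repr_eq; apply/lcok_relP. Qed.

Lemma lcok_class_rep a : exists m, sval (lcok_class a) = a + f m.
Proof.
have /lcok_relP[m e] := lcok_reprP a.
by exists m; rewrite -e addrC subrK.
Qed.

Lemma lcok_class_inj a b : lcok_class a = lcok_class b -> exists m, b - a = f m.
Proof.
move=> e; have [m em] := lcok_class_rep a; have [n en] := lcok_class_rep b.
exists (m - n); rewrite linearB; apply/eqP.
have : a + f m = b + f n by rewrite -em -en e.
move/(congr1 (fun c => c - f n - a)); rewrite addrK => <-.
by rewrite [a + _]addrC addrAC addrK.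
Qed.

Let lcok0 := lcok_class 0.
Let lcokD x y := lcok_class (sval x + sval y).
Let lcokN x := lcok_class (- sval x).
Let lcokZ a x := lcok_class (a *: sval x).

Lemma lcok_classD a b : lcokD (lcok_class a) (lcok_class b) = lcok_class (a + b).
Proof.
apply/esym/lcok_class_eq; have [m ->] := lcok_class_rep a.
have [n ->] := lcok_class_rep b; exists (m + n).
by rewrite linearD addrACA [X in X - _]addrC addrK.
Qed.

Lemma lcok_classN a : lcokN (lcok_class a) = lcok_class (- a).
Proof.
apply/esym/lcok_class_eq; have [m ->] := lcok_class_rep a; exists (- m).
by rewrite opprD opprK addrAC addNr add0r (linearN f).
Qed.

Lemma lcok_classZ r a : lcokZ r (lcok_class a) = lcok_class (r *: a).
Proof.
apply/esym/lcok_class_eq; have [m ->] := lcok_class_rep a; exists (r *: m).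
by rewrite scalerDr [X in X - _]addrC addrK (linearZZ f).
Qed.

Lemma lcok_addA : associative lcokD.
Proof.
move=> x y z; rewrite -(lcok_classK x) -(lcok_classK y) -(lcok_classK z).
by rewrite !lcok_classD addrA.
Qed.
Lemma lcok_addC : commutative lcokD.
Proof. by move=> x y; rewrite /lcokD addrC. Qed.
Lemma lcok_add0 : left_id lcok0 lcokD.
Proof. by move=> x; rewrite -(lcok_classK x) lcok_classD add0r. Qed.
Lemma lcok_addN : left_inverse lcok0 lcokN lcokD.
Proof. by move=> x; rewrite -(lcok_classK x) lcok_classN lcok_classD addNr. Qed.

HB.instance Definition _ :=
  GRing.isZmodule.Build lcok_type lcok_addA lcok_addC lcok_add0 lcok_addN.

Lemma lcok_scaleA a b x : lcokZ a (lcokZ b x) = lcokZ (a * b) x.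
Proof. by rewrite -(lcok_classK x) !lcok_classZ scalerA. Qed.
Lemma lcok_scale1 : left_id 1 lcokZ.
Proof. by move=> x; rewrite -(lcok_classK x) lcok_classZ scale1r. Qed.
Lemma lcok_scaleDr : right_distributive lcokZ +%R.
Proof.
move=> a x y; rewrite -(lcok_classK x) -(lcok_classK y).
by rewrite [X in lcokZ a X]lcok_classD !lcok_classZ scalerDr -lcok_classD.
Qed.
Lemma lcok_scaleDl x : {morph lcokZ^~ x : a b / a + b}.
Proof.
move=> a b; rewrite -(lcok_classK x) !lcok_classZ scalerDl.
by rewrite -lcok_classD.
Qed.

HB.instance Definition _ := GRing.Zmodule_isLmodule.Build R lcok_type
  lcok_scaleA lcok_scale1 lcok_scaleDr lcok_scaleDl.

Lemma lcok_class_linear : linear lcok_class.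
Proof. by move=> a x y; rewrite -lcok_classD -lcok_classZ. Qed.

End Cokernel.

Section Modules.
Variable R : pzRingType.
Implicit Types M N P : RMod R.

Definition lfun M N (f : phom M N) : {linear M -> N} := f.

Definition lker M N (f : phom M N) : RMod R := (lker_type (lfun f) : lmodType R).
Definition lker_in M N (f : phom M N) : phom (lker f) M :=
  lin_of (@lker_in_linear _ _ _ (lfun f)).
Definition lcok M N (f : phom M N) : RMod R := (lcok_type (lfun f) : lmodType R).
Definition lcok_proj M N (f : phom M N) : phom N (lcok f) :=
  lin_of (lcok_class_linear (lfun f)).

Lemma lcok_proj0 M N (f : phom M N) : lcok_proj f ∘ f ≈ ezero.
Proof.
by move=> x; apply: lcok_class_eq; exists (- x); rewrite sub0r (linearN (lfun f)).
Qed.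

Lemma lcok_proj_ker M N (f : phom M N) (y : N) :
  lfun (lcok_proj f) y = 0 -> exists x, lfun f x = y.
Proof.
move=> e; have [m] := lcok_class_inj (f := lfun f) (a := y) (b := 0) e.
by rewrite sub0r => em; exists (- m); rewrite linearN -em opprK.
Qed.

Lemma mod_mono_inj M N (f : phom M N) (x : M) : is_mono f -> lfun f x = 0 -> x = 0.
Proof.
move=> mf fx.
by have /(_ (lker_mk fx)) := mono0 (u := lker_in f) mf (fun y => lkerP y).
Qed.

Lemma mod_epi_surj M N (f : phom M N) (y : N) : is_epi f -> exists x, lfun f x = y.
Proof.
by move=> ef; apply: lcok_proj_ker; apply: (epi0 ef (@lcok_proj0 _ _ f)).
Qed.

Lemma mod_kernelP (A X B : RMod R) (g : phom X B) (f : phom A X) :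
  (forall a, lfun g (lfun f a) = 0) -> (forall a, lfun f a = 0 -> a = 0) ->
  (forall x, lfun g x = 0 -> exists a, lfun f a = x) -> is_kernel g f.
Proof.
move=> gf mf kf; split=> //; first by apply: mono_of0 => T u fu t; apply: mf; apply: fu.
move=> T u gu; have [v hv] := dep_choice (fun t => kf _ (gu t)).
have inj a b : lfun f a = lfun f b -> a = b.
  by move=> e; apply/eqP; rewrite -subr_eq0; apply/eqP; apply: mf; rewrite linearB e subrr.
have lv : linear (v : (T : lmodType R) -> (A : lmodType R)).
  move=> a x y; apply: inj; rewrite linearD linearZ /= !hv.
  exact: (linearP (lfun u)).
by exists (lin_of lv).
Qed.

Lemma mod_cokernelP (A X B : RMod R) (f : phom A X) (g : phom X B) :
  (forall a, lfun g (lfun f a) = 0) -> (forall b, exists x, lfun g x = b) ->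
  (forall x, lfun g x = 0 -> exists a, lfun f a = x) -> is_cokernel f g.
Proof.
move=> gf sg kg; split=> //.
  by move=> T u v e b; have [x <-] := sg b; apply: e.
move=> T u uf; have [s hs] := dep_choice sg.
have uE x y : lfun g x = lfun g y -> lfun u x = lfun u y.
  move=> e; have [|a ha] := kg (x - y); first by rewrite linearB e subrr.
  by apply/eqP; rewrite -subr_eq0 -linearB -ha; apply/eqP; apply: uf.
have lv : linear ((fun b => lfun u (s b)) : (B : lmodType R) -> (T : lmodType R)).
  move=> a x y; rewrite -(linearP (lfun u)); apply: uE.
  by rewrite linearP !hs.
by exists (lin_of lv) => x; apply: uE; apply: hs.
Qed.

Lemma abelian_RMod : abelian (RMod R).
Proof.
split.
(* The kernel of an identity is zero; the empty matrices only provide some module to start from. *)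
- exists (lker (pid (('M[R]_(0, 0) : lmodType R) : RMod R))) => x.
  by apply: val_inj; apply: (lkerP x).
- move=> X0 Y0; pose X : lmodType R := X0; pose Y : lmodType R := Y0.
  pose B : lmodType R := (X * Y)%type.
  have l1 : linear ((fun x => (x, 0)) : X -> B).
    by move=> a x y; apply/eqP; rewrite xpair_eqE /= scaler0 addr0 !eqxx.
  have l2 : linear ((fun x => (0, x)) : Y -> B).
    by move=> a x y; apply/eqP; rewrite xpair_eqE /= scaler0 addr0 !eqxx.
  have l3 : linear ((fun p => p.1) : B -> X) by [].
  have l4 : linear ((fun p => p.2) : B -> Y) by [].
  exists (B : RMod R), (lin_of l1), (lin_of l2), (lin_of l3), (lin_of l4).
  split=> // -[x y] /=.
  by apply/eqP; rewrite xpair_eqE /= addr0 add0r !eqxx.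
- move=> X Y f; exists (lker f), (lker_in f); apply: mod_kernelP.
  + exact: lkerP.
  + by move=> a e; apply: val_inj.
  + by move=> x fx; exists (lker_mk fx).
- move=> X Y f; exists (lcok f), (lcok_proj f); apply: mod_cokernelP.
  + exact: lcok_proj0.
  + by move=> b; exists (sval b); apply: lcok_classK.
  + exact: lcok_proj_ker.
- move=> X Y Q f q mf [qf _ cq]; apply: mod_kernelP => //.
  + by move=> a; apply: mod_mono_inj.
  + move=> x qx; have [v hv] := cq _ _ (@lcok_proj0 _ _ f).
    apply: lcok_proj_ker; rewrite -(hv x); change (lfun v (lfun q x) = 0).
    by rewrite qx linear0.
- move=> X Y K g k eg [gk mk kk]; apply: mod_cokernelP => //.
  + by move=> b; apply: mod_epi_surj.
  + move=> x gx; have [v hv] := kk _ (lker_in g) (fun y => lkerP y).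
    by exists (lfun v (lker_mk gx)); apply: (hv (lker_mk gx)).
Qed.

End Modules.

(** * Tensor products of complexes *)

Section DsumProj.
Variables (I : Type) (A : I -> egrp).

(** Projecting a direct sum over an arbitrary index type to one summand requires deciding equality
    of indices, and transporting when they agree. *)
Definition dsum_cast (i j : I) : ehom (A j) (A i) :=
  match excluded_middle_informative (j = i) with
  | left e => eq_rect j (fun k => ehom (A j) (A k)) (pid (A j : EAb)) i e
  | right _ => ezero : ehom_egrp (A j) (A i)
  end.

Definition dsum_proj (i : I) : ehom (dsum A) (A i) := dsum_lift (dsum_cast i).

Lemma dsum_proj_in i a : dsum_proj i (dsum_in A i a) ≈ a.
Proof.
rewrite /dsum_proj dsum_lift_in /dsum_cast.
case: excluded_middle_informative => [e|//].
rewrite (Eqdep_dec.UIP_dec (fun x y => excluded_middle_informative (x = y)) e erefl).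
reflexivity.
Qed.

Lemma dsum_proj_neq i j a : j <> i -> dsum_proj i (dsum_in A j a) ≈ ezero.
Proof.
move=> ne; rewrite /dsum_proj dsum_lift_in /dsum_cast.
by case: excluded_middle_informative => [//|_]; reflexivity.
Qed.

End DsumProj.

(** An element killed by [g'] is moved to [X], lifted there along [f], and moved back. *)
Lemma eab_retract_exact (A X B A' X' B' : EAb) (f : phom A X) (g : phom X B)
    (f' : phom A' X') (g' : phom X' B') (rA : phom A A')
    (sX : phom X' X) (rX : phom X X') (sB : phom B' B) (rB : phom B B') :
  rX ∘ sX ≈ pid X' -> rB ∘ sB ≈ pid B' ->
  g ∘ sX ≈ sB ∘ g' -> rX ∘ f ≈ f' ∘ rA -> 
  g' ∘ f' ≈ ezero -> exact_seq f g -> exact_seq f' g'.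
Proof.
move=> eX eB gs rf gf /eab_exactP[_ ex]; apply/eab_exactP; split; first exact: gf.
move=> x gx; have [|a ha] := ex ((sX : ehom _ _) x).
  transitivity ((sB : ehom _ _) ((g' : ehom _ _) x)); first exact: gs.
  by rewrite gx; apply: ehom0.
exists ((rA : ehom _ _) a); transitivity ((rX : ehom _ _) ((f : ehom _ _) a)).
  by symmetry; apply: rf.
by rewrite ha; apply: eX.
Qed.

Lemma alt_diff_natural (C : preadd) (b : bool) (N N' : C) (f : phom N N') i :
  alt_diff b N' i ∘ f ≈ f ∘ alt_diff b N i.
Proof.
rewrite /alt_diff; case: (_ (+) _); first by rewrite pcomp1f pcompf1; reflexivity.
by rewrite pcomp0f pcompf0; reflexivity.
Qed.

Definition alt_map (C : preadd) (b : bool) (N N' : C) (f : phom N N') :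
    @phom (Ch C) (alt b N) (alt b N') :=
  @Chmap C (alt b N) (alt b N') (fun=> f) (fun i j h => alt_diff_natural b f i).

Definition zero_complex_map (C : preadd) (N N' : C) (f : phom N N') :
    @phom (Ch C) (zero_complex N) (zero_complex N') :=
  @Chmap C (zero_complex N) (zero_complex N') (fun=> f)
    (fun i j h => transitivity (pcomp0f N' f) (symmetry (pcompf0 N f))).

Lemma alt_map_ses (C : preadd) (b : bool) (A X B : C) (f : phom A X) (g : phom X B) :
  ses f g -> ses (alt_map b f) (alt_map b g).
Proof. by move=> s; apply: ch_ses. Qed.

Lemma zero_complex_map_ses (C : preadd) (A X B : C) (f : phom A X) (g : phom X B) :
  ses f g -> ses (zero_complex_map f) (zero_complex_map g).
Proof. by move=> s; apply: ch_ses. Qed.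

(** Carries exactness from a tensor product of complexes over to its natural direct summands. *)
Lemma retract_ses (C : preadd) (A X B A' X' B' : C) (f : phom A X) (g : phom X B)
    (f' : phom A' X') (g' : phom X' B') (sA : phom A' A) (rA : phom A A')
    (sX : phom X' X) (rX : phom X X') (sB : phom B' B) (rB : phom B B') :
  rA ∘ sA ≈ pid A' -> rX ∘ sX ≈ pid X' -> rB ∘ sB ≈ pid B' ->
  f ∘ sA ≈ sX ∘ f' -> rX ∘ f ≈ f' ∘ rA -> g ∘ sX ≈ sB ∘ g' -> rB ∘ g ≈ g' ∘ rX ->
  ses f g -> ses f' g'.
Proof.
move=> eA eX eB fs rf gs rg [hk hc]; split.
  by apply: (retract_kernel eX eB eA gs _ fs _ hk); symmetry.
by apply: (retract_cokernel eA eX eB fs _ gs _ hc); symmetry.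
Qed.

Section TensProj.
Variable R : pzRingType.

Section Proj.
Variables (X : Ch (RMod R^c)) (Y : Ch (RMod R)).

Definition dot_proj (m i j : int) (e : i + j = m) :
    @phom EAb (dot_deg X Y m) (tens (X i) (Y j)) :=
  @dsum_proj _ (fun p : tidx m => tens (X (ti p)) (Y (tj p))) (Tidx e).

Lemma dot_proj_in m i j (e e' : i + j = m) :
  dot_proj e ∘ dot_in X Y e' ≈ pid (tens (X i) (Y j) : EAb).
Proof.
rewrite (dot_in_irr X Y e' e) => a.
exact: (@dsum_proj_in _ (fun p : tidx m => tens (X (ti p)) (Y (tj p))) (Tidx e)).
Qed.

Lemma dot_proj_neq m i j (e : i + j = m) i' j' (e' : i' + j' = m) :
  i' <> i -> dot_proj e ∘ dot_in X Y e' ≈ ezero.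
Proof.
move=> ne a.
apply: (@dsum_proj_neq _ (fun p : tidx m => tens (X (ti p)) (Y (tj p))) (Tidx e) (Tidx e')).
by move=> [].
Qed.

Lemma dot_d1E (m n : int) (h : m = n + 1) (i j k : int) (e : i + j = m)
    (hk : i = k + 1) (e' : k + j = n) :
  dot_d1 X Y h e ≈ dot_in X Y e' ∘ tens_map (cd X hk) (pid (Y j)).
Proof.
have ek := idx_inj hk (idx_pred i); subst k.
rewrite /dot_d1 (dot_in_irr X Y e' (tidx_predl e h)) (cd_irr X hk (idx_pred i)).
reflexivity.
Qed.

Lemma dot_d2E (m n : int) (h : m = n + 1) (i j k : int) (e : i + j = m)
    (hk : j = k + 1) (e' : i + k = n) :
  dot_d2 X Y h e ≈ dot_in X Y e' ∘ tens_map (pid (X i)) (cd Y hk).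
Proof.
have ek := idx_inj hk (idx_pred j); subst k.
rewrite /dot_d2 (dot_in_irr X Y e' (tidx_predr e h)) (cd_irr Y hk (idx_pred j)).
reflexivity.
Qed.

(** The part of a boundary in bidegree [(a, b)] comes only from bidegrees [(a + 1, b)] and
    [(a, b + 1)]; hence the case distinction on the source. *)
Lemma dot_proj_diff (m n : int) (h : m = n + 1) (a b a' b' : int)
    (e : a + b = n) (ha : a' = a + 1) (hb : b' = b + 1) (e1 : a' + b = m)
    (e2 : a + b' = m) :
  dot_proj e ∘ dot_diff X Y h
  ≈ tens_map (cd X ha) (pid (Y b)) ∘ dot_proj e1
    ⊞ esign a (tens_map (pid (X a)) (cd Y hb) ∘ dot_proj e2).
Proof.
apply: dot_ext => i j ei; rewrite -pcompA dot_diff_in pcompDr pcompDl pcompfS pcompSf.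
rewrite -!pcompA.
have [e3|ne] := eqVneq i a'.
  subst i; have e3 : j = b by apply: (addrI a'); rewrite ei e1.
  subst j; rewrite (dot_d1E h ei ha e) (pcompA (dot_proj e)) dot_proj_in pcomp1f.
  rewrite dot_proj_in pcompf1; apply: eadd_proper; first reflexivity.
  have na : a' <> a.
    by rewrite ha => /eqP; rewrite -subr_eq0 addrC addKr.
  rewrite (dot_proj_neq e2 ei na) pcompf0 esign0 /dot_d2 (pcompA (dot_proj e)).
  by rewrite (dot_proj_neq e _ na) pcomp0f esign0; reflexivity.
have [e3|ne'] := eqVneq i a.
  subst i; have e3 : j = b' by apply: (addrI a); rewrite ei e2.
  subst j; rewrite (dot_d2E h ei hb e) (pcompA (dot_proj e) (dot_in X Y e)).
  rewrite (dot_proj_in e e) pcomp1f (dot_proj_in e2 ei) pcompf1; apply: eadd_proper; last reflexivity.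
  have na : a <> a' by apply/eqP; rewrite eq_sym eq_sym.
  rewrite (dot_proj_neq e1 ei na) pcompf0 /dot_d1 (pcompA (dot_proj e)).
  have na' : a - 1 <> a.
    by move/eqP; rewrite -subr_eq0 addrC addKr.
  by rewrite (dot_proj_neq e _ na') pcomp0f; reflexivity.
have n1 : i <> a' by apply/eqP.
have n2 : i <> a by apply/eqP.
have n3 : i - 1 <> a.
  by move=> e3; case: n1; rewrite ha -e3 subrK.
rewrite (dot_proj_neq e1 ei n1) (dot_proj_neq e2 ei n2) /dot_d1 /dot_d2.
rewrite !(pcompA (dot_proj e)) (dot_proj_neq e _ n3) (dot_proj_neq e _ n2).
by rewrite !pcomp0f !pcompf0 !esign0; reflexivity.
Qed.

Lemma dot_diff_tprod (m n : int) (h : m = n + 1) (i j k l : int) (e : i + j = m)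
    (hk : i = k + 1) (hl : j = l + 1) (e1 : k + j = n) (e2 : i + l = n)
    (x : X i) (y : Y j) :
  (dot_diff X Y h : ehom _ _) ((dot_in X Y e : ehom _ _) (tprod x y))
  ≈ (dot_in X Y e1 : ehom _ _) (tprod (lfun (cd X hk) x) y)
    ⊞ esign i ((dot_in X Y e2 : ehom _ _) (tprod x (lfun (cd Y hl) y))).
Proof.
etransitivity; first exact (dot_diff_in h e (tprod x y)).
apply: eadd_proper.
  exact: (dot_d1E h e hk e1 (tprod x y)).
have ep (A B : egrp) (f : ehom_egrp A B) a :
    (esign i f : ehom_egrp A B) a ≈ esign i ((f : ehom A B) a).
  by rewrite /esign; case: (odd _); reflexivity.
etransitivity; first exact (ep _ _ (dot_d2 X Y h e) (tprod x y)).
apply: esign_proper.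
exact: (dot_d2E h e hl e2 (tprod x y)).
Qed.

Definition mtens_lift (m : int) (B : EAb) (u : @phom EAb (dot_deg X Y m) B)
    (h : u ∘ dot_diff X Y (erefl (m + 1)) ≈ ezero) :
    @phom EAb (mtens X Y m) B.
Proof.
refine (@Ehom (mtens_deg X Y m) B (u : ehom (dot_deg X Y m) B) _ _).
  move=> s t [b e]; rewrite e ehomD.
  have eb : (u : ehom _ _) ((dot_diff X Y (erefl (m + 1)) : ehom _ _) b) ≈ ezero := h b.
  by rewrite eb eadd0; reflexivity.
by move=> s t; apply: (ehomD (u : ehom (dot_deg X Y m) B)).
Defined.

Definition mtens_in (m i j : int) (e : i + j = m) :
    @phom EAb (tens (X i) (Y j)) (mtens X Y m) :=
  (ecoker_proj (dot_diff X Y (erefl (m + 1))) : @phom EAb (dot_deg X Y m) (mtens X Y m))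
  ∘ dot_in X Y e.

End Proj.

Lemma dot_proj_map (X X' : Ch (RMod R^c)) (Y Y' : Ch (RMod R)) (f : phom X X')
    (g : phom Y Y') m i j (e : i + j = m) :
  dot_proj X' Y' e ∘ dot_map f g m
  ≈ tens_map ((f : chmap X X') i) ((g : chmap Y Y') j) ∘ dot_proj X Y e.
Proof.
apply: dot_ext => i' j' e'; rewrite -!pcompA dot_map_in (pcompA (dot_proj X' Y' e)).
have [e3|/eqP ne] := eqVneq i' i.
  subst i'; have e3 : j' = j by apply: (addrI i); rewrite e e'.
  by subst j'; rewrite !dot_proj_in pcompf1 pcomp1f; reflexivity.
by rewrite !dot_proj_neq // pcomp0f pcompf0; reflexivity.
Qed.

Lemma mtens_in_map (X X' : Ch (RMod R^c)) (Y Y' : Ch (RMod R)) (f : phom X X')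
    (g : phom Y Y') m i j (e : i + j = m) :
  (mtens_map f g : chmap _ _) m ∘ mtens_in X Y e
  ≈ mtens_in X' Y' e ∘ tens_map ((f : chmap X X') i) ((g : chmap Y Y') j).
Proof.
move=> a; apply: (@ecoker_eq _ _ (dot_diff X' Y' (erefl (m + 1)))).
exact: (dot_map_in f g e a).
Qed.

(** [N (x) Y_j] is a natural direct summand of [(alt true N (x) Y)_j]. *)
Section AltSummand.
Variables (N : RMod R^c) (Y : Ch (RMod R)) (j : int).

Lemma idx0 : 0 + j = j. Proof. exact: add0r. Qed.
Lemma idxm1 : -1 + (j + 1) = j. Proof. by rewrite addrC addrK. Qed.

(** The differential of [alt true N] from degree 0 to degree -1 is the identity, so modulo
    boundaries [x (x) y] in bidegree [(-1, j + 1)] equals [- x (x) d y] in bidegree [(0, j)]. This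
    is the correction term. *)
Definition alt_sum_pre : @phom EAb (dot_deg (alt true N) Y j) (tens N (Y j)) :=
  dot_proj (alt true N) Y idx0
  ⊞ ⊟ (tens_map (pid N) (cd Y (erefl (j + 1))) ∘ dot_proj (alt true N) Y idxm1).

Lemma alt_sum_preP :
  alt_sum_pre ∘ dot_diff (alt true N) Y (erefl (j + 1)) ≈ ezero.
Proof.
have e1 : 1 + j = j + 1 by rewrite addrC.
have e2 : 0 + (j + 1) = j + 1 by rewrite add0r.
have e3 : -1 + (j + 1 + 1) = j + 1 by rewrite addrC addrK.
rewrite pcompDl pcompNf -pcompA.
rewrite (dot_proj_diff (X := alt true N) (erefl (j + 1)) idx0 (erefl (0 + 1)) (erefl (j + 1)) e1 e2).
rewrite (dot_proj_diff (X := alt true N) (erefl (j + 1)) idxm1 (erefl (-1 + 1)) (erefl (j + 1 + 1)) e2 e3).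
set P1 := dot_proj _ _ e1; set P2 := dot_proj _ _ e2; set P3 := dot_proj _ _ e3.
change (tens_map (ezero : @phom (RMod R^c) N N) (pid (Y j)) ∘ P1
  ⊞ tens_map (pid N) (cd Y (erefl (j + 1))) ∘ P2
  ⊞ ⊟ (tens_map (pid N) (cd Y (erefl (j + 1))) ∘ (tens_map (pid N) (pid (Y (j + 1))) ∘ P2
    ⊞ ⊟ (tens_map (pid N) (cd Y (erefl (j + 1 + 1))) ∘ P3))) ≈ ezero).
rewrite tens_map0l pcomp0f e0add tens_map1 pcomp1f.
rewrite pcompDr pcompfN (pcompA (tens_map _ _) (tens_map _ _)) -tens_mapM cdd tens_map0r.
rewrite pcomp0f eopp0 eadd0; exact: eaddN.
Qed.

Definition alt_sum : @phom EAb (mtens (alt true N) Y j) (tens N (Y j)) :=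
  mtens_lift alt_sum_preP.

Definition alt_summand : @phom EAb (tens N (Y j)) (mtens (alt true N) Y j) :=
  mtens_in (alt true N) Y idx0.

Lemma alt_sumK : alt_sum ∘ alt_summand ≈ pid (tens N (Y j) : EAb).
Proof.
suff e : alt_sum_pre ∘ dot_in (alt true N) Y idx0 ≈ pid (tens N (Y j) : EAb) by move=> a; apply: (e a).
rewrite pcompDl pcompNf -pcompA (dot_proj_in (X := alt true N) (Y := Y) idx0 idx0).
have ne : 0 <> -1 :> int by [].
by rewrite (dot_proj_neq (X := alt true N) (Y := Y) idxm1 idx0 ne) pcompf0 eopp0 eadd0; reflexivity.
Qed.

End AltSummand.

Lemma alt_sum_map (N N' : RMod R^c) (Y Y' : Ch (RMod R)) (f : phom N N')
    (g : phom Y Y') j :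
  alt_sum N' Y' j ∘ (mtens_map (alt_map true f) g : chmap _ _) j
  ≈ tens_map f ((g : chmap Y Y') j) ∘ alt_sum N Y j.
Proof.
suff e : alt_sum_pre N' Y' j ∘ dot_map (alt_map true f) g j
    ≈ tens_map f ((g : chmap Y Y') j) ∘ alt_sum_pre N Y j by move=> a; apply: (e a).
rewrite pcompDl pcompDr pcompNf pcompfN -pcompA.
rewrite (dot_proj_map (X' := alt true N')) (dot_proj_map (X' := alt true N')).
rewrite !pcompA -!tens_mapM pcomp1f pcompf1 (chm_comm (g : chmap Y Y')).
reflexivity.
Qed.

Lemma alt_summand_map (N N' : RMod R^c) (Y Y' : Ch (RMod R)) (f : phom N N')
    (g : phom Y Y') j :
  (mtens_map (alt_map true f) g : chmap _ _) j ∘ alt_summand N Y j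
  ≈ alt_summand N' Y' j ∘ tens_map f ((g : chmap Y Y') j).
Proof. exact (mtens_in_map (alt_map true f) g (idx0 j)). Qed.

(** * Right exactness of the tensor product *)

Section TensDescend.
Variables (N : RMod R^c) (M C : RMod R) (p : phom M C).
Hypothesis p_surj : forall c, exists y, lfun p y = c.
Variables (A : EAb) (u : @phom EAb (tens N M) A).
Hypothesis u_ker : forall x y, lfun p y = 0 -> (u : ehom _ _) (tprod x y) ≈ ezero.

Let sec (c : C) : M := witness (p_surj c).
Let secP c : lfun p (sec c) = c. Proof. exact: (witnessP (p_surj c)). Qed.

Let u_eq x y y' : lfun p y = lfun p y' ->
  (u : ehom _ _) (tprod x y) ≈ (u : ehom _ _) (tprod x y').
Proof.
move=> e; have -> : tprod x y ≈ tprod x (y - y') ⊞ tprod x y'.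
  by rewrite -{1}(subrK y' y); apply/pres_rel/tensDr.
rewrite ehomD u_ker ?e0add; first reflexivity.
by rewrite linearB e subrr.
Qed.

Let desc (q : N * C) : A := (u : ehom _ _) (tprod q.1 (sec q.2)).

Let descP s t : tens_rel s t -> weval desc s ≈ weval desc t.
Proof.
case=> [x x' y|x y y'|a x y]; rewrite /= /desc /= !eadd0.
- rewrite -ehomD; apply: ehom_proper; exact/pres_rel/tensDl.
- rewrite -ehomD.
  transitivity ((u : ehom _ _) (tprod x (sec y + sec y'))).
    by apply: u_eq; rewrite linearD !secP.
  by apply: ehom_proper; apply/pres_rel/tensDr.
- transitivity ((u : ehom _ _) (tprod x (a *: sec y))).
    by apply: ehom_proper; apply/pres_rel/tensZ.
  by apply: u_eq; rewrite linearZ /= !secP.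
Qed.

(** The value on [x (x) c] uses a chosen preimage of [c]; [u_ker] makes it independent of the choice
    and hence bilinear. *)
Definition tens_descend : @phom EAb (tens N C) A := pres_lift descP.

Lemma tens_descendE : tens_descend ∘ tens_map (pid N) p ≈ u.
Proof.
apply: (@pres_ext _ _ _ (tens_descend ∘ tens_map (pid N) p) u) => -[x y].
rewrite /= /desc /= !eadd0; apply: u_eq; exact: secP.
Qed.

End TensDescend.

Lemma tens_map_epi (N : RMod R^c) (M C : RMod R) (p : phom M C) :
  (forall c, exists y, lfun p y = c) -> is_epi (tens_map (pid N) p).
Proof.
move=> hp T u v e; apply: (@pres_ext _ _ _ u v) => -[x c].
have [y <-] := hp c; exact: (e (tprod x y)).
Qed.

End TensProj.

(** * Flat complexes are exact with flat cycles *)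

Section Flat.
Variable R : pzRingType.

Section ZeroSummand.
Variables (N : RMod R^c) (Y : Ch (RMod R)) (j : int).

Definition bcoker : RMod R := lcok (cd Y (erefl (j + 1))).
Definition bproj : phom (Y j) bcoker := lcok_proj (cd Y (erefl (j + 1))).

Lemma bproj_surj c : exists y, lfun bproj y = c.
Proof. by exists (sval c); apply: lcok_classK. Qed.

(** As [zero_complex N] has zero differential, boundaries meet the bidegree [(0, j)] in [N (x) d Y]
    only, and the quotient there is [N (x) (Y j / B_j)]. In this way flatness of [Y] reaches
    [bcoker Y j]. *)
Definition zero_sum_pre : @phom EAb (dot_deg (zero_complex N) Y j) (tens N bcoker) :=
  tens_map (pid N) bproj ∘ dot_proj (zero_complex N) Y (idx0 j).

Lemma zero_sum_preP :
  zero_sum_pre ∘ dot_diff (zero_complex N) Y (erefl (j + 1)) ≈ ezero.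
Proof.
have e1 : 1 + j = j + 1 by rewrite addrC.
have e2 : 0 + (j + 1) = j + 1 by rewrite add0r.
rewrite -pcompA (dot_proj_diff (X := zero_complex N) (erefl (j + 1)) (idx0 j)
  (erefl (0 + 1)) (erefl (j + 1)) e1 e2).
set P1 := dot_proj _ _ e1; set P2 := dot_proj _ _ e2.
change (tens_map (pid N) bproj ∘ (tens_map (ezero : @phom (RMod R^c) N N) (pid (Y j)) ∘ P1
  ⊞ tens_map (pid N) (cd Y (erefl (j + 1))) ∘ P2) ≈ ezero).
rewrite tens_map0l pcomp0f e0add pcompA -tens_mapM /bproj lcok_proj0 tens_map0r.
exact: pcomp0f.
Qed.

Definition zero_sum : @phom EAb (mtens (zero_complex N) Y j) (tens N bcoker) :=
  mtens_lift zero_sum_preP.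

Definition zero_in : @phom EAb (tens N (Y j)) (mtens (zero_complex N) Y j) :=
  mtens_in (zero_complex N) Y (idx0 j).

Lemma zero_in_ker (x : N) (y : Y j) : lfun bproj y = 0 ->
  (zero_in : ehom _ _) (tprod x y) ≈ ezero.
Proof.
move=> /lcok_proj_ker[z zy].
have e2 : 0 + (j + 1) = j + 1 by rewrite add0r.
have em : -1 + (j + 1) = j by rewrite addrC addrK.
(* With [x] in degree 0 the sign is positive, so [x (x) d z] is the boundary of [x (x) z]. *)
exists ((dot_in (zero_complex N) Y e2 : ehom _ _) (tprod x z)).
rewrite e0add; symmetry.
etransitivity; first exact (dot_diff_tprod (X := zero_complex N) (erefl (j + 1)) e2 (k := -1)
  (erefl _) (erefl _) em (idx0 j) (x : (zero_complex N) 0) z).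
transitivity ((ezero : dot_deg (zero_complex N) Y j) ⊞
   (dot_in (zero_complex N) Y (idx0 j) : ehom _ _) (tprod x y)); last first.
  by rewrite e0add; reflexivity.
rewrite zy; apply: eadd_proper; last reflexivity.
change ((dot_in (zero_complex N) Y em : ehom _ _) (tprod (0 : N) z) ≈ ezero).
by rewrite tprod0l; apply: ehom0.
Qed.

Definition zero_summand : @phom EAb (tens N bcoker) (mtens (zero_complex N) Y j) :=
  tens_descend bproj_surj zero_in_ker.

Lemma zero_summandE : zero_summand ∘ tens_map (pid N) bproj ≈ zero_in.
Proof. exact: tens_descendE. Qed.

Lemma zero_sum_in : zero_sum ∘ zero_in ≈ tens_map (pid N) bproj.
Proof.
suff e : zero_sum_pre ∘ dot_in (zero_complex N) Y (idx0 j) ≈ tens_map (pid N) bproj.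
  by move=> a; apply: (e a).
by rewrite -pcompA (dot_proj_in (X := zero_complex N) (Y := Y)) pcompf1; reflexivity.
Qed.

Lemma zero_sumK : zero_sum ∘ zero_summand ≈ pid (tens N bcoker : EAb).
Proof.
apply: (tens_map_epi (N := N) bproj_surj).
by rewrite -pcompA zero_summandE zero_sum_in pcomp1f; reflexivity.
Qed.

End ZeroSummand.

Lemma zero_sum_map (N N' : RMod R^c) (f : phom N N') (Y : Ch (RMod R)) j :
  zero_sum N' Y j ∘ (mtens_map (zero_complex_map f) (pid Y) : chmap _ _) j
  ≈ tens_map f (pid (bcoker Y j)) ∘ zero_sum N Y j.
Proof.
suff e : zero_sum_pre N' Y j ∘ dot_map (zero_complex_map f) (pid Y) j
    ≈ tens_map f (pid (bcoker Y j)) ∘ zero_sum_pre N Y j by move=> a; apply: (e a).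
rewrite -pcompA (dot_proj_map (X' := zero_complex N')) !pcompA -!tens_mapM.
by rewrite !pcomp1f !pcompf1; reflexivity.
Qed.

Lemma zero_summand_map (N N' : RMod R^c) (f : phom N N') (Y : Ch (RMod R)) j :
  (mtens_map (zero_complex_map f) (pid Y) : chmap _ _) j ∘ zero_summand N Y j
  ≈ zero_summand N' Y j ∘ tens_map f (pid (bcoker Y j)).
Proof.
apply: (tens_map_epi (N := N) (@bproj_surj Y j)).
rewrite -!pcompA zero_summandE -tens_mapM pcompf1 pcomp1f.
have -> : tens_map f (bproj Y j) ≈ tens_map (pid N') (bproj Y j) ∘ tens_map f (pid (Y j)).
  by rewrite -tens_mapM pcomp1f pcompf1; reflexivity.
rewrite pcompA zero_summandE.
exact: (mtens_in_map (zero_complex_map f) (pid Y) (idx0 j)).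
Qed.

Lemma flat_module_retract (M F : RMod R) : is_retract M F -> flat_module F -> flat_module M.
Proof.
move=> [s [r rs]] hF A X B f g sfg.
have e N : tens_map (pid N) r ∘ tens_map (pid N) s ≈ pid (tens N M : EAb).
  by rewrite -tens_mapM rs pcomp1f tens_map1; reflexivity.
have n (N N' : RMod R^c) (h : phom N N') (K K' : RMod R) (t : phom K K') :
    tens_map h (pid K') ∘ tens_map (pid N) t ≈ tens_map (pid N') t ∘ tens_map h (pid K).
  by rewrite -!tens_mapM !pcomp1f !pcompf1; reflexivity.
exact (retract_ses (e A) (e X) (e B) (n _ _ f _ _ s) (symmetry (n _ _ f _ _ r))
  (n _ _ g _ _ s) (symmetry (n _ _ g _ _ r)) (hF _ _ _ _ _ sfg)).
Qed.

Lemma flat_complex_retract (M F : Ch (RMod R)) :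
  is_retract M F -> flat_complex F -> flat_complex M.
Proof.
move=> [s [r rs]] hF A X B f g sfg.
have e N : mtens_map (pid N) r ∘ mtens_map (pid N) s ≈ pid (mtens N M : Ch EAb).
  rewrite -mtens_mapM -mtens_map1.
  exact (mtens_map_proper (pcomp1f (pid N)) rs).
have n (N N' : Ch (RMod R^c)) (h : phom N N') (K K' : Ch (RMod R)) (t : phom K K') :
    mtens_map h (pid K') ∘ mtens_map (pid N) t ≈ mtens_map (pid N') t ∘ mtens_map h (pid K).
  rewrite -!mtens_mapM; apply: mtens_map_proper.
    by rewrite pcomp1f pcompf1; reflexivity.
  by rewrite pcomp1f pcompf1; reflexivity.
exact (retract_ses (e A) (e X) (e B) (n _ _ f _ _ s) (symmetry (n _ _ f _ _ r))
  (n _ _ g _ _ s) (symmetry (n _ _ g _ _ r)) (hF _ _ _ _ _ sfg)).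
Qed.

Lemma flat_complex_comp (F : Ch (RMod R)) : flat_complex F ->
  forall j, flat_module ((F : complex _) j).
Proof.
move=> hF j A X B f g sfg.
have s := ch_ses_at abelian_EAb (hF _ _ _ _ _ (alt_map_ses true sfg)) j.
exact (retract_ses (@alt_sumK _ A F j) (@alt_sumK _ X F j) (@alt_sumK _ B F j)
  (alt_summand_map f (pid F) (j := j)) (alt_sum_map f (pid F) (j := j))
  (alt_summand_map g (pid F) (j := j)) (alt_sum_map g (pid F) (j := j)) s).
Qed.

Lemma flat_complex_bcoker (F : Ch (RMod R)) : flat_complex F ->
  forall j, flat_module (bcoker F j).
Proof.
move=> hF j A X B f g sfg.
have s := ch_ses_at abelian_EAb (hF _ _ _ _ _ (zero_complex_map_ses sfg)) j.
exact (retract_ses (@zero_sumK A F j) (@zero_sumK X F j) (@zero_sumK B F j)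
  (zero_summand_map f (Y := F) (j := j)) (zero_sum_map f (Y := F) (j := j))
  (zero_summand_map g (Y := F) (j := j)) (zero_sum_map g (Y := F) (j := j)) s).
Qed.

Program Definition additive_egrp (M : zmodType) : egrp :=
  {| esort := M; eeq := eq; ezero := 0; eadd := +%R; eopp := -%R |}.
Next Obligation. by move=> M a b c; rewrite addrA. Qed.
Next Obligation. by move=> M a b; rewrite addrC. Qed.
Next Obligation. by move=> M a; rewrite addr0. Qed.
Next Obligation. by move=> M a; rewrite subrr. Qed.

Definition reg : RMod R^c := (R^c^o : lmodType R^c).

Lemma tens_actP (M : RMod R) s t : @tens_rel R reg M s t ->
  weval (fun q : reg * M => ((q.1 : R) *: q.2 : additive_egrp M)) s
  ≈ weval (fun q : reg * M => ((q.1 : R) *: q.2 : additive_egrp M)) t.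
Proof.
case=> [x x' y|x y y'|a x y] /=.
- by rewrite !addr0 -scalerDl.
- by rewrite !addr0 -scalerDr.
- by rewrite !addr0 scalerA.
Qed.

Definition tens_act (M : RMod R) : ehom (tens reg M) (additive_egrp M) :=
  pres_lift (@tens_actP M).

Lemma tens_act1 (M : RMod R) (y : M) : tprod (1 : reg) y ≈ ezero -> y = 0.
Proof.
move=> e; have : tens_act M (tprod (1 : reg) y) ≈ ezero by rewrite e; apply: ehom0.
by rewrite /= addr0 scale1r.
Qed.

(** Flatness keeps the embedding of [zero_complex reg] into the cone of its identity injective. For
    a cycle [y], the image of [1 (x) y] is a boundary in the cone, so [1 (x) y] is already zero;
    [zero_sum] then sends it to the class of [y] in [F j / B_j], which must vanish. *)
Lemma flat_complex_exact (F : Ch (RMod R)) : flat_complex F -> exact_complex F.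
Proof.
move=> hF i j k h h'; subst i.
pose q := bproj F j; have abR := abelian_RMod R.
have hq : is_cokernel (cd F (erefl (j + 1))) q.
  apply: mod_cokernelP; [exact: lcok_proj0 | exact: bproj_surj | exact: lcok_proj_ker].
have hl : is_kernel (cd F h') (lker_in (cd F h')).
  by apply: mod_kernelP => [x|x e|x fx]; [exact: lkerP | apply: val_inj |
    exists (lker_mk fx)].
apply: (exact_of_test abR (cdd F _ _) hq hl) => -[y0 hy0]; pose y : (F : complex _) j := y0.
have hy : lfun (cd F h') y = 0 by apply/eqP.
change (lfun q y = 0).
have [CX [i1 [p1 [i2 [p2 [hB hd]]]]]] := cone_ex (abelian_RMod R^c)
  (pid (zero_complex reg : Ch (RMod R^c)) : chmap _ _).
have sC := cone_ses hB hd.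
pose iota : phom (zero_complex reg : Ch (RMod R^c)) CX := cone_in_map hd.
have mi := ch_mono_at abelian_EAb (ses_mono (hF _ _ _ _ _ sC)) (i := j).
have z0 : (zero_in reg F j : ehom _ _) (tprod (1 : reg) y) ≈ ezero.
  apply: (eab_mono_inj mi).
  have e := mtens_in_map iota (pid F) (idx0 j) (tprod (1 : reg) y).
  etransitivity; first exact e.
  (* The suspended copy of 1: its differential is the embedded 1, so
     [d (c (x) y) = 1 (x) y - c (x) d y], whose last term vanishes. *)
  pose c : CX 1 := lfun (i2 _ _ (erefl (0 + 1))) (1 : reg).
  have ej : j = k + 1 := h'.
  have e2 : 1 + k = j by rewrite addrC.
  exists ((dot_in CX F (addrC 1 j) : ehom _ _) (tprod c y)).
  rewrite e0add; symmetry.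
  etransitivity; first exact (dot_diff_tprod (X := CX) (erefl (j + 1)) (addrC 1 j)
    (erefl (0 + 1)) h' (idx0 j) e2 c y).
  have d1 : lfun (cd CX (erefl (0 + 1))) c = lfun (i1 0) (1 : reg).
    have := cone_d2 hd (erefl (-1 + 1)) (erefl (0 + 1)) (1 : reg).
    change (lfun (cd CX (erefl (0 + 1))) c = lfun (i1 0) (1 : reg) - lfun (i2 _ _ (erefl (-1 + 1))) 0 -> lfun (cd CX (erefl (0 + 1))) c = lfun (i1 0) (1 : reg)).
    by rewrite linear0 subr0.
  rewrite d1 hy.
  transitivity ((dot_in CX F (idx0 j) : ehom _ _) (tprod (lfun (i1 0) (1 : reg)) y) ⊞ ezero).
    apply: eadd_proper; first reflexivity.
    transitivity (esign 1 (ezero : dot_deg CX F j)); last exact: esign0.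
    by apply: esign_proper; rewrite tprod0r; apply: ehom0.
  by rewrite eadd0; reflexivity.
apply: tens_act1.
have e1 := @zero_sum_in reg F j (tprod (1 : reg) y).
transitivity ((zero_sum reg F j : ehom _ _) ((zero_in reg F j : ehom _ _) (tprod (1 : reg) y))).
  by symmetry; apply: e1.
by rewrite z0; apply: ehom0.
Qed.

(** By exactness the cycles in degree [n] form a retract of [F (n + 1)] modulo boundaries, which is
    flat by [flat_complex_bcoker]. *)
Lemma flat_complex_ewc (F : Ch (RMod R)) :
  flat_complex F -> exact_with_cycles (@flat_module R) F.
Proof.
move=> hF; have abR := abelian_RMod R; have ex := flat_complex_exact hF; split=> // n.
pose S : complex (RMod R) := F.
have [Z [z hz]] := ab_ker abR (cd S (idx_pred n)); exists Z; split.
  by exists (n - 1), (idx_pred n), z.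
have [e [ee he]] := exact_kernel (ex _ _ _ (erefl (n + 1)) (idx_pred n)) hz.
have [K [k hk]] := ab_ker abR e; have [_ mz _] := hz.
have hk' : is_kernel (cd S (erefl (n + 1))) k.
  by apply: (kernel_heq (symmetry he) (reflexivity k)); apply/(kernel_mono_comp e k mz).
have [e' [ee' he']] := exact_kernel (ex _ _ _ (erefl (n + 1 + 1)) (erefl (n + 1))) hk'.
have [_ _ ce] := ab_epi abR ee hk.
pose q : phom (S (n + 1)) (bcoker F (n + 1)) := bproj F (n + 1).
have hq : is_cokernel (cd S (erefl (n + 1 + 1))) q.
  by apply: mod_cokernelP; [exact: lcok_proj0 | exact: bproj_surj | exact: lcok_proj_ker].
have [q0 _ cq] := hq; have [ek _ _] := hk.
have [|s hs] := ce _ q; first by apply: (epi0 ee'); rewrite -pcompA -he'.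
have [|r hr] := cq _ e; first by rewrite he' pcompA ek pcomp0f; reflexivity.
apply: (flat_module_retract _ (@flat_complex_bcoker F hF (n + 1))).
by exists s, r; apply: ee; rewrite -pcompA hs hr pcomp1f; reflexivity.
Qed.

End Flat.

(** * The two model structures *)

Section Gorenstein.
Variable R : pzRingType.
Variables (B : RMod R^c -> Prop) (D : Ch (RMod R^c) -> Prop).

Let abR := abelian_RMod R.
Let abM := abelian_Ch abR.

(** [F] is the cycle object of [alt false F] in degree 0, where that parity makes the outgoing
    differential zero; tensoring reproduces the same alternating pattern. *)
Lemma flat_gorflat (F : RMod R) : flat_module F -> gorflat_module B F.
Proof.
move=> hF; exists (alt false F); split=> //; last exact: alt_cycles.
  exact: alt_exact.
move=> N _ i j k h h'; have e0 : tens_map (pid N) (ezero : phom F F) ≈ ezero by exact: tens_map0r.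
have e1 : tens_map (pid N) (pid F) ≈ pid (tens N F : EAb) by exact: tens_map1.
have s1 : tens_map (pid N) (pid F) ∘ pid (tens N F : EAb) ≈ pid (tens N F : EAb).
  by rewrite e1 pcomp1f; reflexivity.
have s2 : pid (tens N F : EAb) ∘ tens_map (pid N) (pid F) ≈ pid (tens N F : EAb).
  by rewrite e1 pcomp1f; reflexivity.
change (exact_seq (tens_map (pid N) (alt_diff false F i)) (tens_map (pid N) (alt_diff false F j))).
rewrite /alt_diff h odd_absz_succ; case: (odd (absz j)).
  by apply: (exact_0id abelian_EAb) => //; apply: split_mono s2.
by apply: exact_id0 => //; apply: split_epi s1.
Qed.

Hypothesis hDB : forall X : Ch (RMod R^c), compwise B X -> D X.

Lemma gorflat_complex_comp (M : Ch (RMod R)) : gorflat_complex D M ->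
  compwise (gorflat_module B) M.
Proof.
move=> [F [ex fl te [m [h [z hz]]]]] n.
pose d (i j : int) (e : i = j + 1) := (cd F e : chmap _ _) n.
have dd (i j k : int) (e : i = j + 1) (e' : j = k + 1) : d j k e' ∘ d i j e ≈ ezero.
  exact: (cdd F e e' n).
exists (@Complex (RMod R) (fun i => (F i : complex _) n) d dd); split.
- move=> i j k e e'; have [K [l [u [hl eu fu]]]] := ex _ _ _ e e'.
  exists ((K : complex _) n), ((l : chmap _ _) n), ((u : chmap _ _) n); split.
  + exact: (ch_kernel_at abR hl).
  + exact: (ch_epi_at abR eu).
  + exact: fu.
- by move=> i; exact (@flat_complex_comp R (F i) (fl i) n).
- move=> N BN i j k e e'.
  have DN : D (alt true N) by apply: hDB => l.
  have exN : exact_seq ((mtens_map (pid (alt true N : Ch (RMod R^c))) (cd F e) : chmap _ _) n)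
      ((mtens_map (pid (alt true N : Ch (RMod R^c))) (cd F e') : chmap _ _) n).
    have [K [l [u [hl eu fu]]]] := te _ DN _ _ _ e e'.
    exists ((K : complex _) n), ((l : chmap _ _) n), ((u : chmap _ _) n); split.
    + exact: (ch_kernel_at abelian_EAb hl).
    + exact: (ch_epi_at abelian_EAb eu).
    + exact: fu.
  have mE (Y Y' : Ch (RMod R)) (g : phom Y Y') :
      (mtens_map (pid (alt true N : Ch (RMod R^c))) g : chmap _ _) n ≈ (mtens_map (alt_map true (pid N)) g : chmap _ _) n.
    by apply: mtens_map_proper; [move=> ?; reflexivity | reflexivity].
  have n1 (Y Y' : Ch (RMod R)) (g : phom Y Y') : alt_sum N Y' n ∘ (mtens_map (pid (alt true N : Ch (RMod R^c))) g : chmap _ _) n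
      ≈ tens_map (pid N) ((g : chmap Y Y') n) ∘ alt_sum N Y n.
    by rewrite mE; apply: alt_sum_map.
  have n2 (Y Y' : Ch (RMod R)) (g : phom Y Y') : (mtens_map (pid (alt true N : Ch (RMod R^c))) g : chmap _ _) n ∘ alt_summand N Y n
      ≈ alt_summand N Y' n ∘ tens_map (pid N) ((g : chmap Y Y') n).
    by rewrite mE; apply: alt_summand_map.
  (* In degree [n], tensoring with [alt true N] contains [N (x) -] as a natural direct summand,
     which inherits exactness. *)
  apply: (eab_retract_exact (@alt_sumK _ N (F j) n) (@alt_sumK _ N (F k) n)
    (n2 _ _ (cd F e')) (n1 _ _ (cd F e)) _ exN).
  rewrite -tens_mapM pcomp1f.
  have d0 : d j k e' ∘ d i j e ≈ ezero := dd _ _ _ e e'.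
  transitivity (tens_map (pid N) (d j k e' ∘ d i j e)); first reflexivity.
  by rewrite d0; apply: tens_map0r.
- exists m, h, ((z : chmap _ _) n); exact: (ch_kernel_at abR hz).
Qed.

(** The quotient is the cycle object in degree -1, that is, in degree 0 of the shifted complex. The
    shift without sign keeps the differentials themselves, so all conditions are inherited
    verbatim. *)
Lemma gorflat_cosyzygy (M : Ch (RMod R)) : gorflat_complex D M ->
  exists (F M' : Ch (RMod R)) (z : phom M F) (e : phom F M'),
    [/\ flat_complex F, gorflat_complex D M' & ses z e].
Proof.
move=> [F [ex fl te [m [h [z hz]]]]].
have [K [l hl]] := ab_ker abM (cd F (idx_pred m)).
have [e [ee he]] := exact_kernel (ex _ _ _ h (idx_pred m)) hl.
exists (F 0), K, z, e; split=> //; last first.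
  apply: (ses_of_epi abM) => //; have [_ ml _] := hl.
  apply/(kernel_mono_comp e z ml); apply: kernel_heq hz => //; reflexivity.
exists (shift F); split=> [i j k a b|i|X DX i j k a b|].
- exact: ex.
- exact: fl.
- exact: te.
have em : 0 - 1 = m by rewrite h addrK.
subst m; exists (-1), (erefl _); exists l.
by rewrite /= (cd_irr F (idx_shift _) (idx_pred (0 - 1))).
Qed.

End Gorenstein.

Lemma dg_rorth_anti (R : pzRingType) (A A' : RMod R -> Prop) (Y : Ch (RMod R)) :
  (forall M, A M -> A' M) -> dg_rorth A' Y -> dg_rorth A Y.
Proof.
move=> sAA [cY eY]; split=> [i M /sAA|X [ex cX]]; first exact: cY.
apply: eY; split=> // n; have [Z [hZ AZ]] := cX n.
by exists Z; split=> //; apply: sAA.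
Qed.

Theorem proposition4p6 (R : pzRingType)
    (B : RMod R^c -> Prop)
    (hB : ext_closed (gorflat_module B))
    (D : Ch (RMod R^c) -> Prop)
    (hD : semi_definable D)
    (hDB : forall X : Ch (RMod R^c), compwise B X -> D X)
    (hDI : forall E : Ch (RMod R^c), injective_object E -> D E)
    (W W2 : Ch (RMod R) -> Prop)
    (hW : hovey_triple (gorflat_complex D) W (dg_rorth (@flat_module R)))
    (hW2 : hovey_triple (compwise (gorflat_module B) : Ch (RMod R) -> Prop) W2
             (dg_rorth (gorflat_module B))) :
  left_quillen (Dflat_model D W) (GF_model B W2) (idf (pcat (Ch (RMod R)))) /\
  exists (d : derived_adjunction (Dflat_model D W) (GF_model B W2)
                (idf_adjunction (pcat (Ch (RMod R)))))
         (E1 : functor (Dflat_stable D) (Ho (Dflat_model D W)))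
         (E2 : functor (D_GF B) (Ho (GF_model B W2)))
         (L : functor (Dflat_stable D) (D_GF B))
         (G : functor (D_GF B) (Dflat_stable D))
         (a : adjunction L G),
    [/\ is_equivalence E1,
        inhabited (natiso (fcomp E1 (Dflat_stable_proj D))
                     (fcomp (gamma (Dflat_model D W)) (fullsub_incl _))),
        is_equivalence E2,
        inhabited (natiso (fcomp E2 (D_GF_functor B))
                     (fcomp (gamma (GF_model B W2)) (fullsub_incl _)))
      & adjunction_transported (der_adj d) a E1 E2].
Proof.
have abR := abelian_RMod R; have abM := abelian_Ch abR.
have Q12 X : gorflat_complex D X -> compwise (gorflat_module B) X.
  exact: (gorflat_complex_comp hDB).
have R21 Y : dg_rorth (gorflat_module B) Y -> dg_rorth (@flat_module R) Y.
  by apply: dg_rorth_anti => M; apply: flat_gorflat.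
have T12 := tcof12 hW hW2 R21.
have flat_tcof X : flat_complex X -> both (gorflat_complex D) W X.
  move=> hX; apply/(tcofE hW); apply: (ewc_lorth_dg abR).
    exact: flat_complex_comp.
  exact: flat_complex_ewc.
have N1_tcof Z : flat_cotorsion_complex Z -> both (gorflat_complex D) W Z.
  by case=> /flat_tcof.
have bifibN1 Z : bifib (gorflat_complex D) W (dg_rorth (@flat_module R)) Z ->
    flat_cotorsion_complex Z.
  move=> [[qZ rZ] wZ]; split; last first.
    by move=> X /flat_tcof hX; apply: (tcof_fib_ext hW).
  have [F [Z' [z [e [hF qZ' s]]]]] := gorflat_cosyzygy qZ.
  have [t et] := cof_tfib_ext hW qZ' (conj rZ wZ) s.
  have [r rz] := ses_retraction s et.
  by apply: flat_complex_retract hF; exists z, r.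
have ewcE (X : Ch (RMod R)) : both (compwise (gorflat_module B) : Ch (RMod R) -> Prop) W2 X
    <-> exact_with_cycles (gorflat_module B) X.
  split; first by move/(tcofE hW2)/(lorth_dg_ewc abR hW2).
  (* Components are extensions of cycles by cycles, so [hB] puts them in [gorflat_module B]. *)
  by move=> eX; apply/(tcofE hW2); apply: (ewc_lorth_dg abR) => //; apply: (ewc_compwise abR).
pose d := id_derived_adjunction abM hW hW2 bifibN1 N1_tcof Q12 R21.
pose E1 : functor (Dflat_stable D) (Ho (Dflat_model D W)) := core_emb abM hW N1_tcof.
pose E2 : functor (D_GF B) (Ho (GF_model B W2)) := verdier_gamma abR hW2 ewcE.
have eq1 : is_equivalence E1 := core_emb_equivalence abM hW bifibN1 N1_tcof.
have eq2 : is_equivalence E2 := verdier_gamma_equivalence abR hW2 ewcE.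
split.
  split.
  - by exists (idf _); constructor; apply: idf_adjunction.
  - move=> X Y f [mf [N [n [hn qN]]]]; split=> //; exists N, n; split=> //.
    exact (Q12 _ qN).
  - move=> X Y f [mf [N [n [hn qN]]]]; split=> //; exists N, n; split=> //.
    exact (T12 _ qN).
have [L [G [a ha]]] := transport_adjunction (der_adj d) eq1 eq2.
exists d, E1, E2, L, G, a; split=> //.
- exact (quot_lift_natiso (core_gammaP abM hW N1_tcof)).
- exact (loc_quot_lift_natiso (cone_inverted abR hW2 ewcE)).
Qed.
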